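(* Let $\ell\ge3$, let $\widetilde C$ be an orientation of $C_\ell$ that is not a directed cycle, let $0<\mu\le10^{-2}$, let $0<\eta\ll\mu$, $0<d\ll\mu^2$, $0<\varepsilon\ll d^4,\mu^2,1/\ell$, and let $M\ge M_0>3$ be integers. Then there is $\xi>0$ depending only on $\ell,\widetilde C,\mu,\eta,d,\varepsilon,M$ such that, if $\gamma>0$ is sufficiently small in terms of all preceding constants and $n_0$ is sufficiently large in terms of all of these, the following holds. Let $D$ be an oriented graph of order $n\ge n_0$ with $\sigma_{\mathrm{Ore}}^*(D)\ge(\frac34+\mu)n$ and $\alpha(D)\le\gamma n$. Take an $(\varepsilon,d)$-regularity partition $V_0,V_1,\dots,V_k$ of $D$ with pure digraph $D'$, a partner map $f$ with bad set $E_{\mathrm{bad}}$, and an exceptional tiling $\mathcal F_E$, and put $D_1:=D-V(\mathcal F_E)$. Then there is a set $A\subseteq V(D_1)$ with $|A|\le\eta n$ such that $D_1[A\cup U]$ has a $\widetilde C$-factor whenever $U\subseteq V(D_1)\setminus A$ with $|U|\le\xi n$ and $\ell\mid|A\cup U|$.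
   Context: Notation $a\ll b$: $a$ is chosen sufficiently small in terms of $b$ (i.e. there is a positive function $\phi$ such that the statement holds whenever $0<a\le\phi(b)$). An oriented graph is a finite loopless digraph with at most one arc between any two vertices. $\alpha(D)$ is the independence number of the underlying undirected graph. $d_D^*(v):=\max\{d_D^+(v),d_D^-(v)\}$, and $\sigma_{\mathrm{Ore}}^*(D):=\min\{d_D^*(x)+d_D^*(y):x\ne y,\ xy,yx\notin A(D)\}$ (here $A(D)$ is the arc set), with value $\infty$ if the underlying graph is complete. $P^+:=\{v\in V(D):d_D^+(v)\ge d_D^-(v)\}$, $P^-:=V(D)\setminus P^+$ (either may be empty). A $\widetilde C$-tiling is a set of pairwise vertex-disjoint copies of $\widetilde C$; $V(\mathcal F)$ is the set of vertices it covers; a $\widetilde C$-factor is a $\widetilde C$-tiling covering all vertices. For disjoint vertex sets $X,Y$, $d_{D'}(X,Y)$ is the number of arcs of $D'$ from $X$ to $Y$ divided by $|X||Y|$; $(X,Y)$ is $\varepsilon$-regular if $|d_{D'}(X',Y')-d_{D'}(X,Y)|<\varepsilon$ for all $X'\subseteq X$, $Y'\subseteq Y$ with $|X'|\ge\varepsilon|X|$, $|Y'|\ge\varepsilon|Y|$. An $(\varepsilon,d)$-regularity partition of $D$ with pure digraph $D'$ is a partition $V(D)=V_0\cup V_1\cup\dots\cup V_k$ and a spanning subdigraph $D'\subseteq D$ such that: $M_0\le k\le M$, $|V_0|\le\varepsilon n$, $|V_1|=\dots=|V_k|=:m$; each $V_i$, $i\in[k]$, is contained in $P^+$ or in $P^-$;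 $D'[V_i]$ has no arcs for each $i\in[k]$ and all vertices of $V_0$ are isolated in $D'$; $d_{D'}^{\pm}(v)\ge d_D^{\pm}(v)-(d+2\varepsilon)n$ for every $v\in V(D)\setminus V_0$; for all distinct $i,j\in[k]$, $(V_i,V_j)$ is $\varepsilon$-regular in $D'$ with density $p_{(i,j)}:=d_{D'}(V_i,V_j)$ either $0$ or at least $d$. A partner map is a map $f:[k]\to[k]$ with $f(i)\ne i$ such that $p_{(i,f(i))}\ge d$ whenever $V_i\subseteq P^+$ and $p_{(f(i),i)}\ge d$ whenever $V_i\subseteq P^-$ (such a map exists under the stated hypotheses). Put $B_i:=\{x\in V_i:d_{D'}^+(x,V_{f(i)})<(p_{(i,f(i))}-\varepsilon)m\}$ if $V_i\subseteq P^+$, and $B_i:=\{x\in V_i:d_{D'}^-(x,V_{f(i)})<(p_{(f(i),i)}-\varepsilon)m\}$ if $V_i\subseteq P^-$. The bad set is $E_{\mathrm{bad}}:=V_0\cup\bigcup_iB_i$. An exceptional tiling is a $\widetilde C$-tiling $\mathcal F_E$ of $D$ such that every copy in it contains exactly one vertex of $E_{\mathrm{bad}}$, $E_{\mathrm{bad}}\subseteq V(\mathcal F_E)$, $|V(\mathcal F_E)|=\ell|E_{\mathrm{bad}}|\le2\ell\varepsilon n\le\sqrt\varepsilon n$, and $|V(\mathcal F_E)\cap V_i|\le3\sqrt\varepsilon m$ for every $i\in[k]$ (such a tiling exists under the stated hypotheses). *)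

(* Defs.v *)
From HB Require Import structures.
From mathcomp Require Import all_boot all_order all_algebra.
From mathcomp Require Import reals constructive_ereal.

Set Implicit Arguments.
Unset Strict Implicit.
Unset Printing Implicit Defensive.

Import Order.TTheory GRing.Theory Num.Theory.
Local Open Scope ring_scope.

(* A digraph on the vertex set [T] is its arc relation [D : rel T]: the pair
   (x, y) is an arc iff [D x y]. *)

Definition oriented_graph (T : finType) (D : rel T) : Prop :=
  irreflexive D /\ forall x y, ~~ (D x y && D y x).

Definition underlying (T : finType) (D : rel T) : rel T :=
  [rel x y | D x y || D y x].

Definition isomorphic (S T : finType) (C : rel S) (D : rel T) : Prop :=
  exists2 h : S -> T, bijective h & forall x y, D (h x) (h y) = C x y.

Definition cycle_graph (l : nat) : rel 'I_l :=
  [rel i j | (j == ordS i) || (i == ordS j)].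

Definition directed_cycle (l : nat) : rel 'I_l := [rel i j | j == ordS i].

Definition cycle_orientation (l : nat) (C : rel 'I_l) : Prop :=
  oriented_graph C /\ underlying C =2 cycle_graph (l := l).

(* The vertices outside [W] are kept as isolated ones: the vertex set of [D[W]]
   is always given explicitly, see [has_factor]. *)
Definition induced (T : finType) (D : rel T) (W : {set T}) : rel T :=
  [rel x y | [&& x \in W, y \in W & D x y]].

Definition outdeg_in (T : finType) (D : rel T) (x : T) (Y : {set T}) : nat :=
  #|[set y in Y | D x y]|.

Definition indeg_in (T : finType) (D : rel T) (x : T) (Y : {set T}) : nat :=
  #|[set y in Y | D y x]|.

Definition outdeg (T : finType) (D : rel T) (x : T) : nat :=
  outdeg_in D x [set: T].

Definition indeg (T : finType) (D : rel T) (x : T) : nat :=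
  indeg_in D x [set: T].

Definition maxdeg (T : finType) (D : rel T) (x : T) : nat :=
  maxn (outdeg D x) (indeg D x).

Definition Pplus (T : finType) (D : rel T) : {set T} :=
  [set v | (indeg D v <= outdeg D v)%N].

Definition Pminus (T : finType) (D : rel T) : {set T} := ~: Pplus D.

Definition independent (T : finType) (D : rel T) (S : {set T}) : bool :=
  [forall x in S, forall y in S, ~~ underlying D x y].

Definition independence_number (T : finType) (D : rel T) : nat :=
  (\max_(S : {set T} | independent D S) #|S|)%N.

Definition sigma_ore (R : realType) (T : finType) (D : rel T) : \bar R :=
  \big[Order.min/+oo%E]_(p : T * T
      | [&& p.1 != p.2, ~~ D p.1 p.2 & ~~ D p.2 p.1])
    ((maxdeg D p.1 + maxdeg D p.2)%:R : R)%:E.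

(* A copy of [C] in [D] (a not necessarily induced subdigraph isomorphic to
   [C]) is represented by an embedding. Distinct members of a tiling have
   disjoint images, so no copy is listed twice under different labellings. *)
Definition is_copy (S T : finType) (C : rel S) (D : rel T) (c : {ffun S -> T})
    : Prop :=
  injective c /\ forall i j, C i j -> D (c i) (c j).

Definition vertices (S T : finType) (c : {ffun S -> T}) : {set T} :=
  [set c i | i : S].

Definition tiling (S T : finType) (C : rel S) (D : rel T)
    (F : {set {ffun S -> T}}) : Prop :=
  (forall c, c \in F -> is_copy C D c) /\
  (forall c c', c \in F -> c' \in F -> c != c' ->
     [disjoint vertices c & vertices c']).

Definition covered (S T : finType) (F : {set {ffun S -> T}}) : {set T} :=
  \bigcup_(c in F) vertices c.

(* The digraph [D[W]], with vertex set [W], has a [C]-factor. *)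
Definition has_factor (S T : finType) (C : rel S) (D : rel T) (W : {set T})
    : Prop :=
  exists F : {set {ffun S -> T}}, tiling C (induced D W) F /\ covered F = W.

Definition density (R : realType) (T : finType) (D : rel T) (X Y : {set T}) : R :=
  #|[set p : T * T | [&& p.1 \in X, p.2 \in Y & D p.1 p.2]]|%:R
    / (#|X|%:R * #|Y|%:R).

Definition regular_pair (R : realType) (T : finType) (eps : R) (D : rel T)
    (X Y : {set T}) : Prop :=
  forall X' Y' : {set T}, X' \subset X -> Y' \subset Y ->
    eps * #|X|%:R <= #|X'|%:R -> eps * #|Y|%:R <= #|Y'|%:R ->
    `|density R D X' Y' - density R D X Y| < eps.

Record regularity_partition (R : realType) (T : finType) (D : rel T)
    (eps d : R) (M0 M k m : nat) (V0 : {set T}) (V : 'I_k -> {set T})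
    (D' : rel T) : Prop := RegularityPartition {
  rp_cover : V0 :|: \bigcup_i V i = [set: T];
  rp_disj0 : forall i, [disjoint V0 & V i];
  rp_disj : forall i j, i != j -> [disjoint V i & V j];
  rp_sub : forall x y, D' x y -> D x y;
  rp_k : (M0 <= k <= M)%N;
  rp_V0 : #|V0|%:R <= eps * #|T|%:R;
  rp_card : forall i, #|V i| = m;
  rp_sign : forall i, V i \subset Pplus D \/ V i \subset Pminus D;
  rp_inner : forall i x y, x \in V i -> y \in V i -> ~~ D' x y;
  rp_isolated : forall x y, x \in V0 -> ~~ D' x y /\ ~~ D' y x;
  rp_outdeg : forall v, v \notin V0 ->
    (outdeg D v)%:R - (d + 2 * eps) * #|T|%:R <= (outdeg D' v)%:R;
  rp_indeg : forall v, v \notin V0 ->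
    (indeg D v)%:R - (d + 2 * eps) * #|T|%:R <= (indeg D' v)%:R;
  rp_regular : forall i j, i != j -> regular_pair eps D' (V i) (V j);
  rp_density : forall i j, i != j ->
    density R D' (V i) (V j) = 0 \/ d <= density R D' (V i) (V j)
}.

Definition partner_map (R : realType) (T : finType) (D : rel T) (d : R)
    (k : nat) (V : 'I_k -> {set T}) (D' : rel T) (f : 'I_k -> 'I_k) : Prop :=
  forall i, [/\ f i != i,
    V i \subset Pplus D -> d <= density R D' (V i) (V (f i)) &
    V i \subset Pminus D -> d <= density R D' (V (f i)) (V i)].

(* In a regularity partition, the second case is [V i \subset Pminus D]. *)
Definition bad_vertices (R : realType) (T : finType) (D : rel T) (eps : R)
    (k m : nat) (V : 'I_k -> {set T}) (D' : rel T) (f : 'I_k -> 'I_k) (i : 'I_k)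
    : {set T} :=
  if V i \subset Pplus D then
    [set x in V i | (outdeg_in D' x (V (f i)))%:R
                    < (density R D' (V i) (V (f i)) - eps) * m%:R]
  else
    [set x in V i | (indeg_in D' x (V (f i)))%:R
                    < (density R D' (V (f i)) (V i) - eps) * m%:R].

Definition bad_set (R : realType) (T : finType) (D : rel T) (eps : R)
    (k m : nat) (V0 : {set T}) (V : 'I_k -> {set T}) (D' : rel T)
    (f : 'I_k -> 'I_k) : {set T} :=
  V0 :|: \bigcup_i bad_vertices D eps m V D' f i.

Record exceptional_tiling (R : realType) (l : nat) (C : rel 'I_l) (T : finType)
    (D : rel T) (eps : R) (k m : nat) (V : 'I_k -> {set T}) (Ebad : {set T})
    (F : {set {ffun 'I_l -> T}}) : Prop := ExceptionalTiling {
  et_tiling : tiling C D F;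
  et_one : forall c, c \in F -> #|vertices c :&: Ebad| = 1%N;
  et_cover : Ebad \subset covered F;
  et_card : #|covered F| = (l * #|Ebad|)%N;
  et_bad : (l * #|Ebad|)%:R <= 2 * l%:R * eps * #|T|%:R;
  et_small : 2 * l%:R * eps * #|T|%:R <= Num.sqrt eps * #|T|%:R;
  et_cluster : forall i, #|covered F :&: V i|%:R <= 3 * Num.sqrt eps * m%:R
}.

(* Main.v *)
(** Call [x] and [y] switchable if some bounded set [R], available outside any
    prescribed small set, makes both [D[R u x]] and [D[R u y]] have a factor. As
    the cycle is acyclic it has a source; a vertex whose out-neighbourhood [N] is
    large is completed to a copy by an oriented path of [N], which exists since
    the independence number is tiny (dually for sinks). Hence if [x] and [x']
    have large neighbourhoods in a set of pairwise switchable vertices, they are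
    switchable: exchange the two paths. The Ore condition gives
    (i) two clusters joined with total density above 1/2, which carry copies with
    1 and with 2 vertices in the first cluster and thereby form one class, and
    (ii) a connected reduced graph, along which this class grows to all of [D_1].
    Both follow from the fact that the degrees [d^*] inside a set of [s] vertices
    average at most [3s/4].
    So every [l]-set of [D_1] has bounded absorbers. The set [A] consists of a
    small reservoir [X], in which every vertex has linearly many neighbours, and
    of a chain of absorbers along [X] whose links pass on the number of vertices
    of [X] still present modulo [l]; this chain replaces the usual resilient
    template. The set [U] is covered by copies using [X], and the chain absorbs
    what is left of [X]. *)

Require Import Defs.
From mathcomp Require Import all_boot all_order all_algebra.
From mathcomp Require Import reals constructive_ereal.
From mathcomp Require Import zify ring lra.

Set Implicit Arguments.
Unset Strict Implicit.
Unset Printing Implicit Defensive.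

Import Order.TTheory GRing.Theory Num.Theory.

(** * Oriented paths in sets without large independent subsets *)

(** What could prevent switching between two clusters is the number of vertices that copies have in
    the first one. Types 1 and 2 differ by exactly one vertex, which removes this obstacle. Type 2
    is where a total density above 1/2 enters: densities are 0 or at least [d], so either arcs run
    both ways between the clusters, or one direction alone has density above 1/2 and any two typical
    vertices of the first cluster share many out-neighbours.

    Both uses of the Ore condition compare averages with non-adjacent pairs, and the factor 3/4 just
    fits. Two parts with no arcs between them have average degrees adding up to at most 3n/4, and
    clusters of pairwise total density about 1/2 give an average of about 3n/8, half of the Ore
    bound.

    Switching sets have size bounded in terms of [l] and [M], because the core is extended at most
    [M + 1] times, whereas forbidden sets may have linear size [B]. This gap pays for all that
    follows: whatever has been used already is simply added to the forbidden set. *)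

Section OrientedPaths.
Variables (T : finType) (D : rel T).
Hypothesis irrD : irreflexive D.

(** The direction bit turns every statement about sources ([true]) into one about sinks ([false]) as
    well. *)
Definition darc (b : bool) (x y : T) : bool := if b then D x y else D y x.
Arguments darc : simpl never.

Lemma darcN b x y : darc (~~ b) x y = darc b y x.
Proof. by case: b. Qed.

Lemma darc_irr b x : darc b x x = false.
Proof. by case: b; apply: irrD. Qed.

(** Greedy choice: a vertex of in-degree at most [r] has at most [2 * r] neighbours in [Y], so
    choosing it discards at most [2 * r + 1] vertices. *)
Lemma independent_of_outdeg (e : rel T) (r : nat) (Y : {set T}) :
    irreflexive e -> {in Y, forall u, #|[set v in Y | e u v]| <= r} ->
  exists I : {set T}, [/\ I \subset Y, {in I &, forall u v, ~~ e u v}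
    & #|Y| <= r.*2.+1 * #|I|].
Proof.
move=> irr_e; have [n] := ubnP #|Y|; elim: n Y => // n IHn Y lt_Y_n degY.
have [->|Y_n0] := eqVneq Y set0.
  by exists set0; split; rewrite ?sub0set ?cards0 // => u v; rewrite inE.
(* In-degrees and out-degrees within [Y] have the same sum, so not all in-degrees exceed [r]. *)
have [v vY indeg_v]: exists2 v, v \in Y & #|[set u in Y | e u v]| <= r.
  apply/exists_inP; rewrite -[X in is_true X]negbK negb_exists_in.
  apply/negP => /forall_inP big_in.
  have eq_sum : \sum_(u in Y) #|[set v in Y | e u v]| =
               \sum_(v in Y) #|[set u in Y | e u v]|.
    transitivity (\sum_(u in Y) \sum_(v in Y) e u v).
      apply: eq_bigr => u _; rewrite -sum1_card big_mkcond /=.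
      rewrite [RHS]big_mkcond /=; apply: eq_bigr => v _.
      by rewrite inE; case: (v \in Y); case: (e u v).
    rewrite exchange_big; apply: eq_bigr => v _ /=.
    rewrite -sum1_card big_mkcond /= [RHS]big_mkcond /=; apply: eq_bigr => u _.
    by rewrite inE; case: (u \in Y); case: (e u v).
  have : \sum_(u in Y) #|[set v in Y | e u v]| <= \sum_(u in Y) r.
    exact: leq_sum.
  rewrite eq_sum leqNgt => /negP[].
  have [y yY] := set0Pn _ Y_n0.
  rewrite (bigD1 y) //= [X in _ < X](bigD1 y) //=.
  rewrite -addSn leq_add //; first by rewrite ltnNge big_in.
  by apply: leq_sum => u /andP[uY _]; rewrite leqNgt -ltnNge in big_in *; apply: ltnW; rewrite ltnNge big_in.
set M := [set u in Y | e u v] :|: [set u in Y | e v u].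
have M_le : #|M| <= r.*2.
  by rewrite -addnn (leq_trans (leq_card_setU _ _)) // leq_add ?degY.
pose Y' := Y :\: (v |: M).
have subY' : Y' \subset Y by apply: subsetDl.
have ltY' : #|Y'| < #|Y|.
  apply: proper_card; apply/properP; split=> //; exists v => //.
  by rewrite !inE eqxx.
have [|u /(subsetP subY') uY|I [subI indI cardI]] := IHn Y'.
- by apply: leq_trans ltY' _; rewrite -ltnS.
- apply: leq_trans (degY u uY); apply: subset_leq_card.
  by apply/subsetP=> w; rewrite !inE => /andP[/andP[_ ->] ->].
have vNI : v \notin I.
  by apply/negP => /(subsetP subI); rewrite !inE eqxx.
exists (v |: I); split.
- by rewrite subUset sub1set vY (subset_trans subI).
- have awayI w : w \in I -> ~~ e v w /\ ~~ e w v.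
    move=> /(subsetP subI); rewrite !inE !negb_or !negb_and.
    by case/andP => /and3P[_ H1 H2] wY; move: H1 H2; rewrite wY.
  move=> u w; rewrite !inE => /orP[/eqP->|uI] /orP[/eqP->|wI].
  + by rewrite irr_e.
  + by have [] := awayI w wI.
  + by have [] := awayI u uI.
  + exact: indI.
- rewrite cardsU1 vNI mulnDr muln1.
  rewrite -(cardsID (v |: M) Y) leq_add //.
  apply: leq_trans (subset_leq_card (subsetIr _ _)) _.
  by rewrite cardsU1 (leq_trans (leq_add (leq_b1 _) M_le)).
Qed.

Fixpoint opath (w : seq bool) (x : T) (p : seq T) : bool :=
  match w, p with
  | [::], [::] => true
  | b :: w', y :: p' => darc b x y && opath w' y p'
  | _, _ => false
  end.

Lemma opath_size w x p : opath w x p -> size p = size w.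
Proof. by elim: w x p => [|b w IH] x [|y p] //= /andP[_ /IH->]. Qed.

Lemma opath_nth w x p x0 r : opath w x p -> r < size w ->
  darc (nth true w r) (nth x0 (x :: p) r) (nth x0 p r).
Proof.
elim: w x p r => [|b w IH] x [|y p] [|r] //= /andP[axy opp] // lt_r.
exact: IH.
Qed.

Definition opath_in (W : {set T}) w x p :=
  [&& opath w x p, uniq (x :: p) & all [in W] (x :: p)].

(** The induction needs almost all starting vertices, not just one path. Let [X] be the exceptions
    for [b :: w]. Nearly every [u] in [X] starts a [w]-path inside [X], and a vertex of [X] joined
    to [u] in direction [b] must lie on that path, or it would start a [(b :: w)]-path. So these [u]
    span a digraph of bounded out-degree, and an independent set limits their number. The bounds add
    up as [k^2 + (2k + 1) = (k + 1)^2]. *)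
Lemma opath_start_exceptions w (W : {set T}) :
  exists X : {set T}, [/\ X \subset W,
     #|X| <= (size w).+1 ^ 2 * independence_number D
   & forall x, x \in W -> x \notin X -> exists p, opath_in W w x p].
Proof.
elim: w W => [|b w IH] W.
  exists set0; rewrite sub0set cards0; split=> // x xW _; exists [::].
  by rewrite /opath_in /= xW.
pose S := [set x in W | [exists p : (size w).+1.-tuple T, opath_in W (b :: w) x p]].
pose X := W :\: S; exists X; split; first exact: subsetDl; last first.
  move=> x xW; rewrite !inE xW /= andbT negbK => /existsP[p Hp].
  by exists p.
have [X0 [subX0 cardX0 startX0]] := IH X.
pose Y := X :\: X0.
pose e : rel T := fun u v => darc b v u.
have [|u|I [subI indI cardY]] := @independent_of_outdeg e (size w).+1 Y.
- by move=> u; apply: darc_irr.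
- rewrite inE => /andP[uX0 uX].
  have [p /and3P[opp uniq_p all_p]] := startX0 u uX uX0.
  rewrite -(opath_size opp).
  have -> : (size p).+1 = #|u :: p| by rewrite (card_uniqP uniq_p).
  apply: subset_leq_card; apply/subsetP => v.
  rewrite inE => /andP[/setDP[vX _] avu]; apply/negPn/negP => vNp.
  have [vW vNS] := setDP vX; move/negP: vNS; apply.
  rewrite inE vW; apply/existsP.
  have sz : size (u :: p) == (size w).+1 by rewrite /= (opath_size opp).
  exists (Tuple sz); rewrite /opath_in /= opp andbT (avu : darc b v u).
  move: uniq_p => /= uniq_p; rewrite vNp vW uniq_p /=.
  rewrite -/(all [in W] (u :: p)).
  by apply/allP => z /(allP all_p) /setDP[].
have I_le : #|I| <= independence_number D.
  apply: (@leq_bigmax_cond _ _ (fun S : {set T} => #|S|)).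
  apply/forall_inP => u uI; apply/forall_inP => v vI.
  move: (indI u v uI vI) (indI v u vI uI); rewrite /e /underlying /darc /=.
  by case: (b) => /negPf-> /negPf->.
have : #|X| <= #|X0| + #|Y|.
  by rewrite -(cardsID X0 X) leq_add2r subset_leq_card ?subsetIr.
move=> /leq_trans; apply; apply: leq_trans (leq_add cardX0 cardY) _.
apply: (leq_trans (leq_add (leqnn _) (leq_mul (leqnn _) I_le))).
by rewrite -mulnDl leq_mul2r /=; apply/orP; right; nia.
Qed.

Lemma opath_exists w (W : {set T}) :
  (size w).+1 ^ 2 * independence_number D < #|W| ->
  exists x p, opath_in W w x p.
Proof.
move=> ltW; have [X [subX cardX startX]] := opath_start_exceptions w W.
have /properP[_ [x xW xX]] : X \proper W.
  by rewrite properEcard subX (leq_ltn_trans cardX).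
by have [p Hp] := startX x xW xX; exists x, p.
Qed.

End OrientedPaths.

(** * Copies of the cycle *)

Section CycleWord.
Variables (l : nat) (C : rel 'I_l).
Hypothesis l_ge3 : 3 <= l.
Hypothesis orC : cycle_orientation C.
Hypothesis ndC : ~ isomorphic (@directed_cycle l) C.

Let l_gt0 : 0 < l. Proof. exact: ltn_trans l_ge3. Qed.

Definition cidx (n : nat) : 'I_l := Ordinal (ltn_pmod n l_gt0).

(** The orientation is encoded as a cyclic word, continued periodically so that paths may be read
    from any position without wrapping indices. *)
Definition cdir (n : nat) : bool := C (cidx n) (cidx n.+1).

Lemma ordS_cidx n : ordS (cidx n) = cidx n.+1.
Proof. by apply: val_inj; rewrite /= -addn1 modnDml addn1. Qed.

Lemma cdirE n : cdir n = C (cidx n) (ordS (cidx n)).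
Proof. by rewrite ordS_cidx. Qed.

Lemma cidxD n : cidx (n + l) = cidx n.
Proof. by apply: val_inj; rewrite /= modnDr. Qed.

Lemma cidxDM n k : cidx (n + k * l) = cidx n.
Proof. by apply: val_inj; rewrite /= addnC modnMDl. Qed.

Lemma cidx_ord (i : 'I_l) : cidx i = i.
Proof. by apply: val_inj; rewrite /= modn_small. Qed.

Lemma cdirD n : cdir (n + l) = cdir n.
Proof. by rewrite /cdir -addSn !cidxD. Qed.

Lemma cdirDM n k : cdir (n + k * l) = cdir n.
Proof. by rewrite /cdir -addSn !cidxDM. Qed.

Lemma cycle_arc (i j : 'I_l) : C i j ->
  (j = cidx i.+1 /\ cdir i) \/ (i = cidx j.+1 /\ ~~ cdir j).
Proof.
move=> Cij; have [[_ asymC] undC] := orC.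
have : underlying C i j by rewrite /underlying /= Cij.
rewrite undC /cycle_graph /= => /orP[] /eqP E; [left|right].
  by move: E; rewrite -{1}(cidx_ord i) ordS_cidx => E; rewrite /cdir cidx_ord -E.
move: E; rewrite -{1}(cidx_ord j) ordS_cidx => E; rewrite /cdir cidx_ord -E.
by move: (asymC i j); rewrite Cij.
Qed.

Lemma cdirN n : ~~ cdir n -> C (cidx n.+1) (cidx n).
Proof.
have [_ undC] := orC; rewrite /cdir => /negPf H.
have : underlying C (cidx n) (cidx n.+1) by rewrite undC /cycle_graph /= ordS_cidx eqxx.
by rewrite /underlying /= H.
Qed.

Lemma cdir_both b : exists n, cdir n = b.
Proof.
have [/existsP[i /eqP <-]|] := boolP [exists i : 'I_l, cdir i == b].
  by exists i.
rewrite negb_exists => /forallP H; case: ndC.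
have [[_ asymC] undC] := orC.
case: b H => H.
(* If every edge points backwards, reversing the labels gives the directed cycle. *)
- exists (@rev_ord l); first by exists (@rev_ord l); apply: rev_ordK.
  move=> x y; have E i j : C i j = (i == cidx j.+1).
    apply/idP/eqP => [/cycle_arc[[_ Ci]|[]//]|->].
      by move: (H i); rewrite Ci eqxx.
    by have := @cdirN j; rewrite cidx_ord; apply; move: (H j); case: cdir.
  rewrite E /directed_cycle /= -val_eqE -[RHS]val_eqE /=.
  have := ltn_ord x; have := ltn_ord y.
  move=> ly lx.
  have [ex|nex] := eqVneq x.+1 l; have [y0|y0] := posnP y.
  - by rewrite y0 ex subn1 prednK // !modnn; lia.
  - by rewrite ex modnn (@modn_small (l - y.+1).+1); lia.
  - by rewrite y0 (@modn_small x.+1) ?subn1 ?prednK // ?modnn; lia.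
  - by rewrite (@modn_small x.+1) ?(@modn_small (l - y.+1).+1); lia.
- exists id; first by exists id.
  move=> x y; rewrite /directed_cycle /= -{2}(cidx_ord x) ordS_cidx; apply/idP/eqP.
    case/cycle_arc=> [[]//|[_ /negPf Cy]].
    by move: (H y); rewrite Cy eqxx.
  by move=> ->; move: (H x); rewrite /cdir cidx_ord; case: (C _ _).
Qed.

(** The vertex [cidx s.+1] is a source for [b = true] and a sink for [b = false]; it is found where
    the direction first turns from [~~ b] to [b]. *)
Lemma pole b : exists s, cdir s = ~~ b /\ cdir s.+1 = b.
Proof.
have [n Hn] := cdir_both (~~ b); have [n' Hn'] := cdir_both b.
pose P r := cdir (n + r) == b.
have exP : exists r, P r.
  exists (n' + n * l - n); rewrite /P subnKC ?cdirDM ?Hn' //.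
  by rewrite (leq_trans _ (leq_addl _ _)) // leq_pmulr.
case: (ex_minnP exP) => -[|r]; rewrite /P; first by rewrite addn0 Hn; case: (b).
move=> /eqP Hr min_r; exists (n + r); rewrite -addnS Hr; split=> //.
move: (min_r r); rewrite /P ltnn; move: (cdir _) => v; clear.
by case: b v => [] [] // /(_ isT).
Qed.

Variables (T : finType) (D : rel T).

Definition copyset (S : {set T}) : Prop :=
  exists2 c : {ffun 'I_l -> T}, is_copy C D c & vertices c = S.

Lemma copyset_cycle s (vs : seq T) (x0 : T) : size vs = l -> uniq vs ->
    (forall r, r < l ->
      darc D (cdir (s + r)) (nth x0 vs r) (nth x0 vs (r.+1 %% l))) ->
  copyset [set x in vs].
Proof.
move=> sz_vs uniq_vs arcs.
(* This is [i - s] modulo [l]: the list [vs] is laid around the cycle from the label [s] on. *)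
pose pos (i : 'I_l) := (i + (l - s %% l)) %% l.
have ltpos i : pos i < l by apply: ltn_pmod.
have posK i : cidx (s + pos i) = i.
  apply: val_inj; rewrite /= /pos modnDmr -modnDml addnCA subnKC.
    by rewrite modnDr modn_small.
  by rewrite ltnW // ltn_pmod.
have posS (i : 'I_l) : pos (cidx i.+1) = (pos i).+1 %% l.
  by rewrite /pos /= modnDml addSn -(addn1 (_ %% l)) modnDml addn1.
exists [ffun i => nth x0 vs (pos i)].
  split=> [i j|i j].
    rewrite !ffunE => /eqP; rewrite nth_uniq ?sz_vs // => /eqP E.
    by rewrite -(posK i) E posK.
  rewrite !ffunE => /cycle_arc[[-> di]|[-> dj]]; rewrite posS.
    have := arcs (pos i) (ltpos i).
    by rewrite cdirE posK -{1 2}(cidx_ord i) -cdirE di.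
  have := arcs (pos j) (ltpos j).
  by rewrite cdirE posK -{1 2}(cidx_ord j) -cdirE (negPf dj).
apply/setP => x; rewrite inE; apply/imsetP/idP => [[i _ ->]|xvs].
  by rewrite ffunE mem_nth ?sz_vs.
have lt_ix : index x vs < l by rewrite -sz_vs index_mem.
exists (cidx (s + index x vs)) => //; rewrite ffunE.
suff -> : pos (cidx (s + index x vs)) = index x vs by rewrite nth_index.
rewrite /pos /= modnDml addnAC -modnDml.
have : (s + (l - s %% l)) %% l = 0.
  by rewrite -modnDml subnKC ?modnn // ltnW // ltn_pmod.
by move=> ->; rewrite modn_small.
Qed.

End CycleWord.

Section Copies.
Variables (l : nat) (C : rel 'I_l).
Hypothesis l_ge3 : 3 <= l.
Hypothesis orC : cycle_orientation C.
Hypothesis ndC : ~ isomorphic (@directed_cycle l) C.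
Variables (T : finType) (D : rel T).
Hypothesis irrD : irreflexive D.

Definition nbrs (b : bool) (x : T) (W : {set T}) : {set T} :=
  [set y in W | darc D b x y].

Lemma nbrsS b x (W W' : {set T}) : W \subset W' -> nbrs b x W \subset nbrs b x W'.
Proof.
by move=> /subsetP sW; apply/subsetP => y; rewrite !inE => /andP[/sW-> ->].
Qed.

Lemma nbrs_sub b x W : nbrs b x W \subset W.
Proof. by apply/subsetP => y; rewrite inE => /andP[]. Qed.

Lemma nbrs_irr b x W : x \notin nbrs b x W.
Proof. by rewrite inE darc_irr ?andbF. Qed.

Local Notation cdir := (cdir C l_ge3).
Local Notation copyset := (copyset C D).

(** With [x] at the pole, both cycle edges at [x] leave it in direction [b]; the other [l.-1]
    vertices only have to form a path with the remaining word. *)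
Lemma pole_copy b s x (q : seq T) : cdir s = ~~ b -> cdir s.+1 = b ->
    size q = l.-1 -> uniq (x :: q) ->
    darc D b x (nth x q 0) -> darc D b x (nth x q l.-2) ->
    (forall r, r.+1 < l.-1 ->
      darc D (cdir (s.+1 + r.+1)) (nth x q r) (nth x q r.+1)) ->
  copyset (x |: [set y in q]).
Proof.
move=> cs cs1 sz_q uniq_q arc0 arcl arcs.
have -> : x |: [set y in q] = [set y in x :: q].
  by apply/setP => y; rewrite !inE.
apply: (@copyset_cycle l C l_ge3 orC T D s.+1 (x :: q) x) => //.
  by rewrite /= sz_q prednK //; lia.
case=> [|r] lt_r; first by rewrite addn0 cs1 modn_small; last lia.
have [lt_r1|ge_r1] := ltnP r.+1 l.-1.
  rewrite modn_small; last lia.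
  exact: arcs.
have -> : r.+2 = l by lia.
rewrite modnn; have -> : s.+1 + r.+1 = s + l by lia.
rewrite cdirD cs darcN /=.
by have -> : r = l.-2 by lia.
Qed.

Lemma opath_word s0 k (x : T) p x0 r :
    opath D [seq cdir (s0 + i) | i <- iota 0 k] x p -> r < k ->
  darc D (cdir (s0 + r)) (nth x0 (x :: p) r) (nth x0 (x :: p) r.+1).
Proof.
move=> opp lt_r; have := opath_nth x0 opp (r := r).
by rewrite size_map size_iota (nth_map 0) ?size_iota // nth_iota // => /(_ lt_r).
Qed.

Lemma path_in s0 k (W : {set T}) :
    k < l -> l ^ 2 * independence_number D < #|W| ->
  exists q, [/\ size q = k.+1, uniq q, {subset q <= W} &
    forall x0 r, r < k ->
      darc D (cdir (s0 + r)) (nth x0 q r) (nth x0 q r.+1)].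
Proof.
move=> lt_k ltW; pose w := [seq cdir (s0 + i) | i <- iota 0 k].
have [|x [p /and3P[opp uniq_p /allP all_p]]] := @opath_exists T D irrD w W.
  apply: leq_ltn_trans ltW; rewrite leq_mul2r leq_exp2r //.
  by rewrite size_map size_iota lt_k orbT.
exists (x :: p); split=> //.
  by rewrite /= (opath_size opp) size_map size_iota.
by move=> x0 r lt_r; apply: opath_word opp lt_r.
Qed.

(** [S] is chosen before [x]: the same path completes every vertex that is joined to all of it,
    which is what allows two such vertices to be exchanged. *)
Lemma common_star_copy b (W : {set T}) :
    l ^ 2 * independence_number D < #|W| ->
  exists S : {set T}, [/\ S \subset W, #|S| = l.-1 &
    forall x, S \subset nbrs b x S -> copyset (x |: S)].
Proof.
move=> ltW; have [s [cs cs1]] := pole l_ge3 orC ndC b.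
have [|q [sz_q uniq_q sub_q arcs]] := @path_in s.+2 l.-2 _ _ ltW; first lia.
have sz_q' : size q = l.-1 by rewrite sz_q; lia.
exists [set y in q]; split.
- by apply/subsetP=> y; rewrite inE => /sub_q.
- by rewrite cardsE (card_uniqP uniq_q).
move=> x /subsetP sub_x.
have arcq r : r < l.-1 -> darc D b x (nth x q r).
  rewrite -sz_q' => /(mem_nth x) qr; have := sub_x (nth x q r).
  by rewrite !inE qr /=; apply.
apply: (pole_copy cs cs1) => //.
- rewrite /= uniq_q andbT; apply/negP => xq; have := sub_x x.
  by rewrite !inE xq darc_irr // => /(_ isT).
- by apply: arcq; clear -l_ge3; lia.
- by apply: arcq; clear -l_ge3; lia.
- move=> r lt_r; have := arcs x r; rewrite addSnnS; apply; clear -lt_r; lia.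
Qed.

Lemma star_copy b x (W : {set T}) :
    l ^ 2 * independence_number D < #|nbrs b x W| ->
  exists S : {set T}, [/\ S \subset nbrs b x W, #|S| = l.-1 & copyset (x |: S)].
Proof.
move=> /(common_star_copy b)[S [sSW cS copS]]; exists S; split=> //.
apply: copS; apply/subsetP => y yS; rewrite inE yS.
by have := subsetP sSW y yS; rewrite inE => /andP[].
Qed.

(* [t] is a source of the path left when the source [x] is removed from the
   cycle, so that its image may be moved next to [x]. *)
Lemma two_source_copy x x' (W : {set T}) :
    D x x' -> W \subset nbrs true x W -> W \subset nbrs true x' W ->
    l ^ 2 * independence_number D < #|W| ->
  exists S : {set T}, [/\ S \subset W, #|S| = l.-2 & copyset (x |: (x' |: S))].
Proof.
move=> Dxx' /subsetP subx /subsetP subx' ltW.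
have xNW : x \notin W by apply/negP => /subx; apply/negP/nbrs_irr.
have x'NW : x' \notin W by apply/negP => /subx'; apply/negP/nbrs_irr.
have Dx w : w \in W -> D x w by move=> /subx; rewrite inE => /andP[].
have Dx' w : w \in W -> D x' w by move=> /subx'; rewrite inE => /andP[].
have neq_xx' : x != x' by apply: contraTneq Dxx' => ->; rewrite irrD.
have [s [cs cs1]] := pole l_ge3 orC ndC true.
have [|q [sz_q uniq_q sub_q arcs]] := @path_in s.+2 l.-2 _ _ ltW; first lia.
have sz_q' : size q = l.-1 by rewrite sz_q; lia.
(* By minimality of [t], the edge before [t] points backwards; the edge after it, if there is one,
   points forwards. Hence every path arc at [t] leaves [t]. *)
pose P r := (r == l.-2) || cdir (s.+2 + r).
have exP : exists r, P r by exists l.-2; rewrite /P eqxx.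
case: (ex_minnP exP) => t Pt min_t.
have le_t : t <= l.-2 by apply: min_t; rewrite /P eqxx.
pose q' := set_nth x q t x'.
have sz_q'' : size q' = l.-1 by rewrite size_set_nth sz_q'; clear -le_t l_ge3; lia.
pose S := [set y in q] :\ nth x q t.
have tq : nth x q t \in q by rewrite mem_nth // sz_q'; clear -le_t l_ge3; lia.
have nq' r : nth x q' r = if r == t then x' else nth x q r.
  by rewrite nth_set_nth.
have mem_q' y : (y \in q') = (y \in x' |: S).
  apply/(nthP x)/idP => [[r lt_r <-]|].
    rewrite nq'; case: eqP => [_|/eqP ne_rt]; first by rewrite setU11.
    rewrite sz_q'' in lt_r.
    by rewrite !inE nth_uniq ?sz_q' ?ne_rt ?mem_nth ?sz_q' ?orbT //; clear -le_t l_ge3; lia.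
  rewrite !inE => /orP[/eqP->|/andP[ne_y /(nthP x)[r lt_r E]]].
    by exists t; rewrite ?sz_q'' ?nq' ?eqxx //; clear -le_t l_ge3; lia.
  exists r; first by rewrite sz_q'' -sz_q'.
  by rewrite nq' -E; case: eqP => // E'; move: ne_y; rewrite -E E' eqxx.
have uniq_q' : uniq q'.
  apply/(uniqP x) => r1 r2; rewrite !inE sz_q'' -sz_q' => lt1 lt2.
  rewrite !nq'; case: eqP => [->|ne1]; case: eqP => [->|ne2] //.
  - by move=> E; move: x'NW; rewrite E sub_q ?mem_nth.
  - by move=> E; move: x'NW; rewrite -E sub_q ?mem_nth.
  - by move/eqP; rewrite nth_uniq // => /eqP.
have subS : S \subset W by apply/subsetP=> y; rewrite !inE => /andP[_ /sub_q].
exists S; split=> //.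
  have := cardsD1 (nth x q t) [set y in q].
  rewrite inE tq cardsE (card_uniqP uniq_q) sz_q' -/S.
  by move: #|S| => z; clear -l_ge3; lia.
have -> : x' |: S = [set y in q'] by apply/setP => y; rewrite [RHS]inE mem_q'.
have arcq r : r < l.-1 -> darc D true x (nth x q' r).
  rewrite -sz_q'' => /(mem_nth x); rewrite mem_q' !inE.
  by case/predU1P => [->//|/andP[_ /sub_q/Dx]].
apply: (pole_copy cs cs1) => //.
- rewrite /= uniq_q' andbT mem_q' inE negb_or !inE neq_xx' /=.
  by rewrite negb_and; apply/orP; right; apply: contra xNW => /sub_q.
- by apply: arcq; clear -l_ge3; lia.
- by apply: arcq; clear -l_ge3; lia.
move=> r lt_r; rewrite addnS -addSn !nq'.
have mq i : i < l.-1 -> nth x q i \in W by move=> li; rewrite sub_q ?mem_nth ?sz_q'.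
case: eqP => [Er|ne1]; case: eqP => [Er1|ne2].
- by clear -Er Er1; lia.
- have : P r by rewrite Er. rewrite /P => /orP[/eqP|]; first by clear -lt_r; lia.
  by move=> ->; apply: Dx'; apply: mq; clear -lt_r; lia.
- have : ~~ P r.
    by apply/negP => /min_t; clear -Er1; lia.
  rewrite /P negb_or => /andP[_ /negPf ->].
  by apply: Dx'; apply: mq; clear -lt_r; lia.
- by apply: arcs; clear -lt_r; lia.
Qed.

(* The second vertex of the path after the source is placed next to it. *)
Lemma two_apart_copy x (W : {set T}) v : 3 < l -> v != x ->
    W \subset nbrs true x W -> v \notin W ->
    (forall b, l ^ 2 * independence_number D + l < #|nbrs b v W|) ->
  exists S : {set T}, [/\ S \subset W, #|S| = l.-2 & copyset (x |: (v |: S))].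
Proof.
move=> l_gt3 neq_vx /subsetP subx vNW ltN.
have xNW : x \notin W by apply/negP => /subx; apply/negP/nbrs_irr.
have Dx w : w \in W -> D x w by move=> /subx; rewrite inE => /andP[].
have [s [cs cs1]] := pole l_ge3 orC ndC true.
have [v1 v1N] : exists v1, v1 \in nbrs (~~ cdir s.+2) v W.
  by apply/card_gt0P; apply: leq_ltn_trans (ltN _).
(* The cycle reads [x], [v1], [v], [q] from the pole [s.+1] on, so [q] starts at position [s.+4] and
   has [l - 3] vertices. As [l > 3], the last neighbour of [x] lies in [q] and is not [v]. *)
have [||q [sz_q uniq_q sub_q arcs]] :=
  @path_in (s.+2 + 2) (l - 4) (nbrs (cdir s.+3) v W :\ v1).
- by clear -l_gt3; lia.
- have := ltN (cdir s.+3); have := cardsD1 v1 (nbrs (cdir s.+3) v W).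
  case: (v1 \in _); move: #|nbrs _ _ _| #|_ :\ _| (l ^ 2 * _) => a1 a2 a3; clear -l_gt3; lia.
have sz_q' : size q = (l - 3) by rewrite sz_q; clear -l_gt3; lia.
have qW y : y \in q -> [/\ y \in W, y != v1 & darc D (cdir s.+3) v y].
  by move/sub_q; rewrite !inE => /and3P[-> -> ->].
move: v1N; rewrite inE darcN => /andP[v1W arc1].
have v1Nq : v1 \notin q by apply/negP => /qW[_ /eqP].
have vNq : v \notin q by apply/negP => /qW[]; rewrite (negPf vNW).
exists (v1 |: [set y in q]); split.
- rewrite subUset sub1set v1W; apply/subsetP => y; rewrite inE.
  by case/qW.
- by rewrite cardsU1 inE v1Nq cardsE (card_uniqP uniq_q) sz_q'; clear -l_gt3; lia.
have -> : v |: (v1 |: [set y in q]) = [set y in [:: v1, v & q]].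
  by apply/setP=> y; rewrite !inE orbCA.
apply: (pole_copy cs cs1).
- by rewrite /= sz_q'; clear -l_gt3; lia.
- rewrite /= !inE !negb_or uniq_q v1Nq vNq (eq_sym x v) neq_vx /=.
  rewrite andbT; apply/andP; split; last first.
    by rewrite andbT; apply: contraNneq vNW => <-.
  apply/andP; split; first by apply: contraNneq xNW => ->.
  by apply: contra xNW => /qW[].
- exact: Dx.
- have -> : l.-2 = (l - 4).+2 by clear -l_gt3; lia.
  by rewrite /= ; apply: Dx; case: (qW (nth x q (l - 4))) => //; rewrite mem_nth // sz_q'; clear -l_gt3; lia.
case=> [|[|r]] lt_r /=.
- by rewrite addn1.
- by rewrite addn2; case: (qW (nth x q 0)) => //; rewrite mem_nth // sz_q'; clear -l_gt3; lia.
- have -> : s.+1 + r.+3 = s.+2 + 2 + r by clear; lia.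
  by apply: arcs; clear -lt_r; lia.
Qed.

End Copies.

(** * Factors, switching and absorption *)

Section PointwiseSets.
Variable T : finType.
Implicit Types A B : {set T}.

Lemma disjoint_pointwise A B : [disjoint A & B] ->
  forall z, (z \in A) ==> (z \notin B).
Proof. by move=> dAB z; apply/implyP => /(disjointFr dAB)->. Qed.

Lemma subset_pointwise A B : A \subset B -> forall z, (z \in A) ==> (z \in B).
Proof. by move=> sAB z; apply/implyP => /(subsetP sAB). Qed.

Lemma disjoint_of_pointwise A B :
  (forall z, (z \in A) ==> (z \notin B)) -> [disjoint A & B].
Proof.
move=> H; rewrite -setI_eq0; apply/eqP/setP => z; rewrite !inE.
by have := H z; case: (z \in A) => //= /negPf.
Qed.

Lemma subset_of_pointwise A B :
  (forall z, (z \in A) ==> (z \in B)) -> A \subset B.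
Proof. by move=> H; apply/subsetP => z; apply/implyP/H. Qed.

Lemma notin_disjoint x A : x \notin A -> [disjoint [set x] & A].
Proof. by rewrite disjoints1. Qed.

Lemma in_subset x A : x \in A -> [set x] \subset A.
Proof. by rewrite sub1set. Qed.

Lemma neq_disjoint (x y : T) : x != y -> [disjoint [set x] & [set y]].
Proof. by rewrite disjoints1 inE. Qed.

Lemma leq_cardU A B : #|A :|: B| <= #|A| + #|B|.
Proof. exact: (leq_card_setU A B).1. Qed.

Lemma cardU_disjoint A B : [disjoint A & B] -> #|A :|: B| = #|A| + #|B|.
Proof. by move=> dAB; apply/eqP; rewrite (leq_card_setU A B).2. Qed.

Lemma pick_outside A B : #|B| < #|A| -> exists2 x, x \in A & x \notin B.
Proof.
move=> ltBA; have /subsetPn[x xA xB] : ~~ (A \subset B).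
  by apply: contraL ltBA => /subset_leq_card; rewrite -leqNgt.
by exists x.
Qed.

End PointwiseSets.

(** Inclusions, disjointness and equalities of sets are reduced to propositional statements about
    membership of one generic point [z] and decided by cases. *)
Ltac set_facts z :=
  repeat match goal with
  | H : is_true (disjoint _ _) |- _ => move: (disjoint_pointwise H z); clear H
  | H : is_true (subset _ _) |- _ => move: (subset_pointwise H z); clear H
  | H : is_true (_ \in _) |- _ =>
      move: (subset_pointwise (in_subset H) z); clear H
  | H : is_true (_ \notin _) |- _ =>
      move: (disjoint_pointwise (notin_disjoint H) z); clear H
  | H : is_true (_ != _) |- _ =>
      move: (disjoint_pointwise (neq_disjoint H) z); clear H
  end.

Ltac set_cases z :=
  rewrite ?inE; try done;
  repeat match goal with
  | |- context [z \in ?S] => case: (z \in S); rewrite /= ?andbF ?orbT; try done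
  | |- context [z == ?x] => case: (z == x); rewrite /= ?andbF ?orbT; try done
  end.

Ltac set_tac :=
  let z := fresh "z" in
  first [apply: disjoint_of_pointwise => z | apply: subset_of_pointwise => z
        | apply/setP => z];
  set_facts z; set_cases z.

Section Factors.
Variables (l : nat) (C : rel 'I_l) (T : finType) (D : rel T).

Local Notation copyset := (copyset C D).
Local Notation fac := (has_factor C D).

Lemma fac0 : fac set0.
Proof.
exists set0; split; first by split=> c; rewrite inE.
by rewrite /covered big_set0.
Qed.

Lemma fac_copyset S : copyset S -> fac S.
Proof.
case=> c [inj_c homo_c] <-; exists [set c]; split; last by rewrite /covered big_set1.
split=> [_ /set1P->|c1 c2 /set1P-> /set1P->]; last by rewrite eqxx.
split=> // i j Cij; rewrite /induced /= homo_c // !imset_f //.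
Qed.

Lemma facU (W1 W2 : {set T}) : [disjoint W1 & W2] -> fac W1 -> fac W2 -> fac (W1 :|: W2).
Proof.
move=> dis [F1 [[cF1 dF1] covF1]] [F2 [[cF2 dF2] covF2]].
have sub1 c : c \in F1 -> vertices c \subset W1.
  by move=> cF; rewrite -covF1 (bigcup_max c).
have sub2 c : c \in F2 -> vertices c \subset W2.
  by move=> cF; rewrite -covF2 (bigcup_max c).
exists (F1 :|: F2); split; last first.
  by rewrite /covered bigcup_setU -!/(covered _) covF1 covF2.
split=> [c|c c'].
  by case/setUP => [/cF1|/cF2] [inj_c homo_c]; split=> // i j /homo_c;
     rewrite /induced /= !inE => /and3P[-> -> ->]; rewrite ?orbT.
case/setUP => cF /setUP[] c'F ne_cc'.
- exact: dF1.
- by have s1 := sub1 c cF; have s2 := sub2 c' c'F; set_tac.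
- by have s1 := sub1 c' c'F; have s2 := sub2 c cF; set_tac.
- exact: dF2.
Qed.

Lemma fac_dvd W : fac W -> l %| #|W|.
Proof.
case=> F [[cF dF] <-]; rewrite /covered.
have triv : trivIset [set vertices c | c in F].
  apply/trivIsetP => _ _ /imsetP[c cinF ->] /imsetP[c' c'F ->] ne.
  by apply: dF => //; apply: contraNneq ne => ->.
have -> : \bigcup_(c in F) vertices c = cover [set vertices c | c in F].
  by rewrite cover_imset.
rewrite -(eqP triv); apply: dvdn_sum => _ /imsetP[c cinF ->]; rewrite /vertices card_imset ?card_ord //.
by have [] := cF c cinF.
Qed.

End Factors.

Section Switching.
Variables (l : nat) (C : rel 'I_l) (T : finType) (D : rel T) (VD : {set T}).

Local Notation copyset := (copyset C D).
Local Notation fac := (has_factor C D).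

(** This is reachability from lattice-based absorption, stated for sets so that whole stars can be
    exchanged. [B] bounds the forbidden set and [c] the switching set. *)
Definition switch (B c : nat) (X Y : {set T}) : Prop :=
  forall F : {set T}, #|F| <= B -> exists R : {set T},
    [/\ R \subset VD, #|R| <= c, [disjoint R & F :|: (X :|: Y)],
        fac (R :|: X) & fac (R :|: Y)].

Definition linked (B c : nat) (K : {set T}) : Prop :=
  {in K &, forall x y, x != y -> switch B c [set x] [set y]}.

Definition robust_star (B : nat) (K : {set T}) (x : T) : Prop :=
  forall F : {set T}, #|F| <= B ->
  exists S : {set T}, [/\ S \subset K, [disjoint S & F], x \notin S,
    #|S| = l.-1 & copyset (x |: S)].

Lemma switchW B c B' c' (X Y : {set T}) : B' <= B -> c <= c' -> switch B c X Y -> switch B' c' X Y.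
Proof.
move=> leB lec H F leF; have [R [H1 H2 H3 H4 H5]] := H F (leq_trans leF leB).
by exists R; split=> //; apply: leq_trans lec.
Qed.

Lemma linkedW B c B' c' (K : {set T}) : B' <= B -> c <= c' -> linked B c K -> linked B' c' K.
Proof. by move=> leB lec H x y xK yK ne; apply: switchW (H x y xK yK ne). Qed.

Lemma switch_sym B c (X Y : {set T}) : switch B c X Y -> switch B c Y X.
Proof.
move=> H F leF; have [R [H1 H2 H3 H4 H5]] := H F leF.
by exists R; split=> //; rewrite [Y :|: X]setUC.
Qed.

Lemma robust_starS B B' (K K' : {set T}) x : B' <= B -> K \subset K' ->
  robust_star B K x -> robust_star B' K' x.
Proof.
move=> leB sK H F leF; have [S [H1 H2 H3 H4 H5]] := H F (leq_trans leF leB).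
by exists S; split=> //; apply: subset_trans sK.
Qed.

(** The elements of [X] and [Y] are paired and switched one pair at a time. A pair uses up [c.+2] of
    the budget: its two vertices and its switching set. *)
Lemma switch_set B B' c (K : {set T}) r (X Y : {set T}) :
    linked B c K -> B' + r * c.+2 <= B ->
    X \subset K -> Y \subset K -> [disjoint X & Y] ->
    #|X| = r -> #|Y| = r -> switch B' (r * c) X Y.
Proof.
move=> linkK; elim: r B' X Y => [|r IH] B' X Y leB sX sY dXY cX cY F leF.
  exists set0.
  rewrite (cards0_eq cX) (cards0_eq cY) !setU0 cards0 sub0set; split=> //.
  - by rewrite -setI_eq0 set0I.
  - exact: fac0.
  - exact: fac0.
have [x xX] : exists x, x \in X by apply/card_gt0P; rewrite cX.
have [y yY] : exists y, y \in Y by apply/card_gt0P; rewrite cY.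
have xNY : x \notin Y by rewrite (disjointFr dXY xX).
have yNX : y \notin X by rewrite (disjointFl dXY yY).
have ne_xy : x != y by apply: contraNneq xNY => ->.
have cX1 : #|X :\ x| = r by move: (cardsD1 x X); rewrite xX cX => -[].
have cY1 : #|Y :\ y| = r by move: (cardsD1 y Y); rewrite yY cY => -[].
have leB1 : B' + 2 + r * c.+2 <= B by move: leB; rewrite mulSn; clear; lia.
have [||||R1 [sR1 cR1 dR1 f1X f1Y]] :=
    IH (B' + 2) (X :\ x) (Y :\ y) leB1 _ _ _ cX1 cY1 ([set x; y] :|: F).
- by set_tac.
- by set_tac.
- by set_tac.
- rewrite (leq_trans (leq_cardU _ _)) // addnC leq_add //.
  by rewrite cards2 (leq_trans _ (leqnn 2)) // ltnS leq_b1.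
have cXY : #|X :|: Y| <= r.+1 + r.+1 by rewrite -{1}cX -cY leq_cardU.
have [|R2 [sR2 cR2 dR2 f2x f2y]] := linkK x y (subsetP sX x xX)
    (subsetP sY y yY) ne_xy (R1 :|: ((X :|: Y) :|: F)).
  apply: leq_trans leB; rewrite (leq_trans (leq_cardU _ _)) //.
  have := leq_cardU (X :|: Y) F; move: leF cR1 cXY; rewrite mulSn mulnS mulnS.
  by clear; lia.
exists (R1 :|: R2); split.
- by set_tac.
- by rewrite (leq_trans (leq_cardU _ _)) // mulSn addnC leq_add.
- by set_tac.
- have -> : R1 :|: R2 :|: X = (R1 :|: (X :\ x)) :|: (R2 :|: [set x]) by set_tac.
  by apply: facU f1X f2x; set_tac.
- have -> : R1 :|: R2 :|: Y = (R1 :|: (Y :\ y)) :|: (R2 :|: [set y]) by set_tac.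
  by apply: facU f1Y f2y; set_tac.
Qed.

Hypothesis l_gt0 : 0 < l.

(* The two stars are exchanged with each other: if [S] and [S'] complete [x] and
   [x'] to copies and [R] switches [S] and [S'], then [R :|: S :|: S'] switches
   [x] and [x']. *)
Lemma linked_extend B B' c (K K' : {set T}) :
    K \subset VD -> linked B c K -> B' + l * c.+2 <= B ->
    {in K', forall x, robust_star B K x} -> linked B' (l * c.+2) K'.
Proof.
move=> sKV linkK leB starK' x x' xK x'K ne_xx' F leF.
have lc2 : l * c.+2 = l + l + l * c by rewrite !mulnS; clear; lia.
have [|S [sS dS xNS cS copS]] := starK' x xK ([set x; x'] :|: F).
  rewrite (leq_trans (leq_cardU _ _)) // cards2.
  move: leB leF; rewrite lc2; case: (x != x'); move: (l * c) => lc; clear -l_gt0; lia.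
have [|S' [sS' dS' xNS' cS' copS']] := starK' x' x'K (S :|: ([set x; x'] :|: F)).
  rewrite (leq_trans (leq_cardU _ _)) // cS.
  have := leq_cardU [set x; x'] F; rewrite cards2.
  move: leB leF; rewrite lc2; case: (x != x'); move: (l * c) => lc; clear -l_gt0; lia.
have [|||R [sR cR dR f1 f2]] := @switch_set B (B' + 2) c K l.-1 S S' linkK _ sS sS' _ cS cS' ([set x; x'] :|: F).
- apply: leq_trans leB; rewrite -addnA leq_add2l -(prednK l_gt0) mulSn leq_add2r.
  by rewrite ltnS ltnS.
- by set_tac.
- rewrite (leq_trans (leq_cardU _ _)) // addnC leq_add // cards2.
  by case: (_ != _).
exists (R :|: (S :|: S')); split.
- by set_tac.
- rewrite (leq_trans (leq_cardU _ _)) // lc2.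
  have := leq_cardU S S'; rewrite cS cS'.
  have : l.-1 * c <= l * c by rewrite leq_mul2r leq_pred orbT.
  by move: cR; move: (l * c) (l.-1 * c) => a1 a2; clear; lia.
- by set_tac.
- have -> : R :|: (S :|: S') :|: [set x] = (R :|: S') :|: (x |: S) by set_tac.
  by apply: facU f2 (fac_copyset copS); set_tac.
- have -> : R :|: (S :|: S') :|: [set x'] = (R :|: S) :|: (x' |: S') by set_tac.
  by apply: facU f1 (fac_copyset copS'); set_tac.
Qed.

(** [i] is the first coordinate of the index vector [(i, l - i)] of the copy with respect to [P] and
    [Q]. *)
Definition robust_type (B i : nat) (P Q : {set T}) : Prop :=
  forall F : {set T}, #|F| <= B -> exists S1 S2 : {set T},
    [/\ S1 \subset P, S2 \subset Q, [disjoint S1 :|: S2 & F],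
        #|S1| = i & #|S2| = l - i /\ copyset (S1 :|: S2)].

(* With [c1] of type (1, l - 1) and [c2] of type (2, l - 2), exchanging the part
   of [c1] in [P] and [x] with that of [c2], and that of [c1] in [Q] with that of
   [c2] and [y], switches [x] and [y]. *)
Lemma linked_merge B B' c (P Q : {set T}) : 1 < l ->
    P \subset VD -> Q \subset VD -> [disjoint P & Q] ->
    linked B c P -> linked B c Q -> B' + 4 * l * c.+2 <= B ->
    robust_type B 1 P Q -> robust_type B 2 P Q ->
  linked B' (4 * l * c.+2) (P :|: Q).
Proof.
move=> l_gt1 sPV sQV dPQ linkP linkQ leB type1 type2.
have lc4 : 4 * l * c.+2 = 8 * l + 4 * (l * c).
  by rewrite -mulnA !mulnS; clear; lia.
have lec : c <= l * c by rewrite leq_pmull.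
have leB' : B' <= B by apply: leq_trans leB; rewrite leq_addr.
have lec' : c <= 4 * l * c.+2.
  by rewrite lc4; move: lec; move: (l * c) => z; clear; lia.
suff main x y : x \in P -> y \in Q -> switch B' (4 * l * c.+2) [set x] [set y].
  move=> x y; rewrite !inE => /orP[]xK /orP[]yK ne.
  - by apply: switchW (linkP x y xK yK ne).
  - exact: main.
  - by apply: switch_sym; apply: main.
  - by apply: switchW (linkQ x y xK yK ne).
move=> xP yQ F leF.
have ne_xy : x != y by apply: contraTneq yQ => <-; rewrite (disjointFr dPQ xP).
have [|S1 [S2 [sS1 sS2 dS cS1 [cS2 copS]]]] := type1 ([set x; y] :|: F).
  rewrite (leq_trans (leq_cardU _ _)) // cards2 ne_xy.
  by move: leB leF; rewrite lc4; move: (l * c) => lc; clear -l_gt0; lia.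
have cS : #|S1 :|: S2| <= l.
  by rewrite (leq_trans (leq_cardU _ _)) // cS1 cS2; clear -l_gt0; lia.
have [|S1' [S2' [sS1' sS2' dS' cS1' [cS2' copS']]]] :=
    type2 ((S1 :|: S2) :|: ([set x; y] :|: F)).
  rewrite (leq_trans (leq_cardU _ _)) //.
  have := leq_cardU [set x; y] F; rewrite cards2 ne_xy; move: cS.
  by move: leB leF; rewrite lc4; move: (l * c) => lc; clear -l_gt0; lia.
have cS' : #|S1' :|: S2'| <= l.
  by rewrite (leq_trans (leq_cardU _ _)) // cS1' cS2'; clear -l_gt1; lia.
have [xNS1 yNS2'] : x \notin S1 /\ y \notin S2'.
  by rewrite -!disjoints1; split; set_tac.
have cX1 : #|x |: S1| = 2 by rewrite cardsU1 xNS1 cS1.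
have cY2 : #|y |: S2'| = l.-1.
  by rewrite cardsU1 yNS2' cS2' add1n; clear -l_gt1; lia.
have cF' : #|(S1 :|: S2 :|: (S1' :|: S2')) :|: ([set x; y] :|: F)|
           <= B' + l + l + 2.
  rewrite (leq_trans (leq_cardU _ _)) //.
  have := leq_cardU (S1 :|: S2) (S1' :|: S2').
  have := leq_cardU [set x; y] F; rewrite cards2 ne_xy.
  by move: leF cS cS'; clear; lia.
have [|||R1 [sR1 cR1 dR1 f1 f1']] :=
    @switch_set B _ c P 2 (x |: S1) S1' linkP _ _ sS1' _ cX1 cS1' _ cF'.
- apply: leq_trans leB; rewrite lc4 mulSn mul1n.
  by move: lec; move: (l * c) => z; clear -l_gt1; lia.
- by set_tac.
- by set_tac.
have [|||||R2 [sR2 cR2 dR2 f2 f2']] :=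
    @switch_set B (B' + l + l + 2 + 2 * c) c Q l.-1 S2 (y |: S2') linkQ _ sS2 _ _ _ cY2
      (R1 :|: ((S1 :|: S2 :|: (S1' :|: S2')) :|: ([set x; y] :|: F))).
- apply: leq_trans leB; rewrite lc4.
  have : l.-1 * c.+2 <= l * c.+2 by rewrite leq_mul2r leq_pred orbT.
  by move: lec; rewrite !mulnS; move: (l * c) (_ * c) => z z'; clear -l_gt1; lia.
- by set_tac.
- by set_tac.
- by rewrite cS2 subn1.
- rewrite (leq_trans (leq_cardU _ _)) //.
  by rewrite addnC leq_add.
exists ((R1 :|: R2) :|: ((S1 :|: S2) :|: (S1' :|: S2'))); split.
- by set_tac.
- rewrite (leq_trans (leq_cardU _ _)) // lc4.
  have := leq_cardU R1 R2; have := leq_cardU (S1 :|: S2) (S1' :|: S2').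
  have : l.-1 * c <= l * c by rewrite leq_mul2r leq_pred orbT.
  move: cS cS' cR1 cR2 lec; move: (l * c) (l.-1 * c) => z z'.
  by clear -l_gt1; lia.
- by set_tac.
- have -> : R1 :|: R2 :|: (S1 :|: S2 :|: (S1' :|: S2')) :|: [set x] =
            ((R1 :|: (x |: S1)) :|: (R2 :|: S2)) :|: (S1' :|: S2') by set_tac.
  apply: facU (facU _ f1 f2) (fac_copyset copS').
    by set_tac.
  by set_tac.
- have -> : R1 :|: R2 :|: (S1 :|: S2 :|: (S1' :|: S2')) :|: [set y] =
            ((R1 :|: S1') :|: (R2 :|: (y |: S2'))) :|: (S1 :|: S2) by set_tac.
  apply: facU (facU _ f1' f2') (fac_copyset copS).
    by set_tac.
  by set_tac.
Qed.

Definition absorbable (B c : nat) (S : {set T}) : Prop :=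
  forall F : {set T}, #|F| <= B -> exists A : {set T},
    [/\ A \subset VD, #|A| <= c, [disjoint A & F :|: S],
        fac A & fac (A :|: S)].

(** A fresh copy [x |: S'] has as many vertices as [S]. If [R] switches the two, then
    [R :|: (x |: S')] has a factor, and together with [S] it splits into [R :|: S] and the copy. *)
Lemma linked_absorb B B' c (K : {set T}) : K \subset VD ->
    linked B c K -> B' + l * c.+2 + l < #|K| -> B' + l * c.+2 + l <= B ->
    {in K, forall x, robust_star B K x} ->
  forall S : {set T}, S \subset K -> #|S| = l -> absorbable B' (l * c.+2) S.
Proof.
move=> sKV linkK ltK leB starK S sSK cS F leF.
have cFS : #|F :|: S| <= B' + l.
  by rewrite (leq_trans (leq_cardU _ _)) // cS leq_add2r.
have [|x xK xNFS] := @pick_outside _ K (F :|: S).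
  by apply: leq_ltn_trans ltK; move: cFS; move: (l * _) => z; clear; lia.
have [|S' [sS' dS' xNS' cS' copS']] := starK x xK (F :|: S).
  by apply: leq_trans leB; move: cFS; move: (l * _) => z; clear; lia.
have [|||||R [sR cR dR f1 f2]] :=
   @switch_set B (B' + l) c K l S (x |: S') linkK _ sSK _ _ cS _ (F :|: S).
- by apply: leq_trans leB; move: (l * _) => z; clear; lia.
- by set_tac.
- by set_tac.
- by rewrite cardsU1 xNS' cS' add1n prednK.
- done.
exists (R :|: (x |: S')); split=> //.
- by set_tac.
- rewrite (leq_trans (leq_cardU _ _)) // cardsU1 xNS' cS' add1n prednK //.
  by rewrite !mulnS; move: cR; move: (l * c) => z; clear; lia.
- by set_tac.
- have -> : R :|: (x |: S') :|: S = (R :|: S) :|: (x |: S') by set_tac.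
  by apply: facU f1 (fac_copyset copS'); set_tac.
Qed.

Section Template.
Variables (B c : nat) (K : {set T}).
Hypothesis sKV : K \subset VD.
Hypothesis absK : forall S : {set T}, S \subset K -> #|S| = l -> absorbable B c S.

(** [G] contains one absorber per member of [s]. Only the absorber of the chosen set is activated;
    the others use their own factors. *)
Lemma absorb_one_of (s : seq {set T}) (O F : {set T}) :
    {in s, forall S : {set T}, S \subset O /\ #|S| = l} -> O \subset K ->
    #|F| + size s * c + #|O| <= B ->
  exists G : {set T}, [/\ G \subset VD, #|G| <= size s * c,
    [disjoint G & F :|: O], fac G & {in s, forall S, fac (G :|: S)}].
Proof.
move=> Hs sOK; elim: s Hs => [|S s IH] Hs leB.
  exists set0; rewrite sub0set cards0; split=> //; first by set_tac.
  exact: fac0.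
have [sSO cS] := Hs S (mem_head _ _).
have [||G [sG cG dG fG fGs]] := IH.
- by move=> S' S's; apply: Hs; rewrite inE S's orbT.
- by apply: leq_trans leB; rewrite /= mulSn; clear; lia.
have [|A [sA cA dA fA fAS]] := @absK S (subset_trans sSO sOK) cS (F :|: G :|: O).
  apply: leq_trans leB; rewrite (leq_trans (leq_cardU _ _)) // leq_add2r.
  by rewrite (leq_trans (leq_cardU _ _)) // leq_add2l (leq_trans cG) // mulSn leq_addl.
exists (G :|: A); split.
- by set_tac.
- by rewrite (leq_trans (leq_cardU _ _)) //= mulSn addnC leq_add.
- by set_tac.
- by apply: facU => //; set_tac.
- move=> S'; rewrite inE => /orP[/eqP->|S's].
    by rewrite -setUA; apply: facU => //; set_tac.
  have -> : G :|: A :|: S' = (G :|: S') :|: A by set_tac.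
  have [sS'O _] : S' \subset O /\ #|S'| = l by apply: Hs; rewrite inE S's orbT.
  by apply: facU (fGs S' S's) fA; set_tac.
Qed.

End Template.

End Switching.

(** * The chain of absorbers along the reservoir *)

Lemma subset_of_card (T : finType) (A : {set T}) k : k <= #|A| ->
  exists2 A' : {set T}, A' \subset A & #|A'| = k.
Proof.
move=> le_k; exists [set x in take k (enum A)].
  by apply/subsetP => x; rewrite inE => /mem_take; rewrite mem_enum.
rewrite cardsE (card_uniqP _) ?take_uniq ?enum_uniq // size_take -cardE.
by case: ltngtP le_k.
Qed.

Lemma subset_outside (T : finType) (K F : {set T}) k : k + #|F| <= #|K| ->
  exists A : {set T}, [/\ A \subset K, [disjoint A & F] & #|A| = k].
Proof.
move=> leK; have [|A sA cA] := @subset_of_card T (K :\: F) k.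
  rewrite cardsD leq_subRL; last by rewrite (subset_leq_card (subsetIl _ _)).
  by rewrite (leq_trans _ leK) // addnC leq_add2l subset_leq_card ?subsetIr.
by exists A; split=> //; set_tac.
Qed.

Section Template.
Variables (l : nat) (C : rel 'I_l) (T : finType) (D : rel T) (VD : {set T}).
Hypothesis l_gt0 : 0 < l.
Local Notation fac := (has_factor C D).
Variables (B c : nat) (K : {set T}).
Hypothesis sKV : K \subset VD.
Hypothesis absK : forall S : {set T}, S \subset K -> #|S| = l ->
  absorbable C D VD B c S.
(** The cost of a link: one absorber for each [l]-subset of a set of at most [2 * l] vertices, and
    room for the carriers. *)
Let w := 2 ^ (2 * l) * c + 2 * l.

(* A chain transporting the number of vertices of [X'] read so far, modulo [l]:
   the carriers in [a'] are those left to the next link. *)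
Lemma absorb_chain (X F : {set T}) :
    X \subset K -> B < #|K| -> #|F| + #|X|.+1 * w.+1 <= B ->
  exists G a : {set T}, [/\ G \subset VD, a \subset K, #|a| = l.-1,
    #|G| <= #|X| * w
  & [/\ [disjoint G & F :|: X], [disjoint a & F :|: X], [disjoint G & a] &
    forall X' : {set T}, X' \subset X -> exists2 a' : {set T},
      a' \subset a & fac (X' :|: G :|: (a :\: a'))]].
Proof.
move=> sXK ltBK; move En: #|X| => n; elim: n X F En sXK => [|n IH] X F En sXK leB.
  have [|a [sa da ca]] := @subset_outside T K F l.-1.
    apply: leq_trans (ltnW ltBK); apply: leq_trans leB.
    by rewrite addnC leq_add2l mul1n /w; move: (_ * c) => z; clear; lia.
  exists set0, a; rewrite (cards0_eq En) sub0set cards0 !setU0; split=> //.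
  split=> //; try by set_tac.
  (* Before anything is read, all [l.-1] carriers are left over. *)
  move=> X'; rewrite subset0 => /eqP->; exists a => //.
  by rewrite setDv !setU0; apply: fac0.
have [x xX] : exists x, x \in X by apply/card_gt0P; rewrite En.
have cY : #|X :\ x| = n by move: (cardsD1 x X); rewrite xX En => -[].
have [||G [a [sG sa ca cG [dG da dGa facG]]]] := IH (X :\ x) (x |: F) cY.
- by set_tac.
- apply: leq_trans leB; rewrite (leq_trans (leq_add (leq_cardU _ _) (leqnn _))) //.
  by rewrite cards1 [in X in _ <= X]mulSn -addnA addnCA leq_add2l leq_add2r.
have cFXG : #|F :|: X :|: G :|: a| + w <= #|F| + n.+2 * w.+1.
  have := leq_cardU (F :|: X :|: G) a; have := leq_cardU (F :|: X) G.
  have := leq_cardU F X; rewrite En ca.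
  have lw : l.-1 <= w by rewrite /w; move: (_ * c) => z; clear; lia.
  by move: cG lw; rewrite !mulSn mulnS; move: (n * w) => nw; clear; lia.
have [|b [sb db cb]] := @subset_outside T K (F :|: X :|: G :|: a) l.-1.
  apply: leq_trans (ltnW ltBK); apply: leq_trans leB; apply: leq_trans cFXG.
  by rewrite addnC leq_add2l /w; move: (_ * c) => z; clear; lia.
(* The link can consume any [l] vertices among the incoming carriers [a], the vertex [x] and the
   outgoing carriers [b]. *)
pose O := a :|: [set x] :|: b.
have cO : #|O| <= 2 * l.
  have := leq_cardU (a :|: [set x]) b; have := leq_cardU a [set x].
  by rewrite cards1 ca cb; clear -l_gt0; rewrite /O; lia.
pose s := enum [set S : {set T} | (S \subset O) && (#|S| == l)].
have memS S : (S \in s) = (S \subset O) && (#|S| == l) by rewrite mem_enum inE.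
have sz_s : size s <= 2 ^ (2 * l).
  rewrite -cardE (leq_trans (n := #|powerset O|)) //.
    by apply: subset_leq_card; apply/subsetP => S; rewrite !inE => /andP[].
  by rewrite card_powerset leq_exp2l.
have le_sc : size s * c <= 2 ^ (2 * l) * c by rewrite leq_mul2r sz_s orbT.
have [|||G1 [sG1 cG1 dG1 fG1 fG1s]] :=
    @absorb_one_of l C T D VD B c K sKV absK s O (F :|: X :|: G).
- by move=> S; rewrite memS => /andP[? /eqP].
- by rewrite /O; set_tac.
- apply: leq_trans leB; apply: leq_trans cFXG.
  rewrite -addnA leq_add ?subset_leq_card ?subsetUl //.
  by rewrite leq_add.
exists (G :|: a :|: G1), b; split=> //.
- by set_tac.
- rewrite (leq_trans (leq_cardU _ _)) // mulSn addnC.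
  have := leq_cardU G a; rewrite ca.
  move: cG1 cG le_sc; rewrite /w; move: (_ ^ _ * c) (_ * (_ + _)) (size s * c) => z1 z2 z3.
  by clear; lia.
have dab : [disjoint a & b] by set_tac.
have dG1O : [disjoint G1 & a] /\ [disjoint G1 & b].
  by split; rewrite /O in dG1; set_tac.
have [dG1a dG1b] := dG1O.
have dG1X : [disjoint G1 & F :|: X] by set_tac.
split; try by set_tac.
move=> X' sX'.
have [|a' sa' fac1] := facG (X' :\ x); first by set_tac.
(* These vertices must be consumed here: the carriers left by the previous link, and [x] if it is
   still present. *)
pose O' := a' :|: (X' :&: [set x]).
have cO' : #|O'| <= l.
  have := leq_cardU a' (X' :&: [set x]).
  have := subset_leq_card (subsetIr X' [set x]); rewrite cards1.
  have := subset_leq_card sa'; rewrite ca -/O'.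
  by move: #|O'| #|a'| #|_ :&: _| => z1 z2 z3; clear -l_gt0; lia.
have facI : fac (X' :|: (G :|: a :|: G1) :|: (b :\: b)) \/ #|O'| <> 0.
  have [/eqP|] := boolP (#|O'| == 0); last by move/eqP; right.
  move/eqP; rewrite cards_eq0 => /eqP O'0; left.
  have -> : X' :|: (G :|: a :|: G1) :|: b :\: b =
            ((X' :\ x) :|: G :|: (a :\: a')) :|: G1.
    move/setP: O'0 => O'0; apply/setP => z; have := O'0 z; rewrite /O' !inE.
    by set_cases z.
  by apply: facU fac1 fG1; set_tac.
case: facI => [facI|O'n0]; first by exists b.
have [|bb sbb cbb] := @subset_of_card T b (l - #|O'|).
  by rewrite cb; move/eqP: O'n0; move: #|O'| => z; clear; lia.
(* The link hands on [#|O'| - 1] carriers. When [O'] was empty it handed on all [l - 1], the same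
   number modulo [l]. *)
exists (b :\: bb); first by set_tac.
have sO'O : O' :|: bb \subset O by rewrite /O' /O; set_tac.
have cO'bb : #|O' :|: bb| = l.
  rewrite cardU_disjoint ?cbb ?subnKC //.
  by rewrite /O'; set_tac.
have facS : fac (G1 :|: (O' :|: bb)).
  by apply: fG1s; rewrite memS sO'O cO'bb eqxx.
have -> : X' :|: (G :|: a :|: G1) :|: b :\: (b :\: bb) =
   ((X' :\ x) :|: G :|: (a :\: a')) :|: (G1 :|: (O' :|: bb)).
  by rewrite /O'; set_tac.
apply: facU fac1 facS.
by rewrite /O'; set_tac.
Qed.

End Template.

(** * Covering by stars and choosing a reservoir *)

Section Cover.
Variables (l : nat) (C : rel 'I_l).
Hypothesis l_ge3 : 3 <= l.
Hypothesis orC : cycle_orientation C.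
Hypothesis ndC : ~ isomorphic (@directed_cycle l) C.
Variables (T : finType) (D : rel T).
Hypothesis irrD : irreflexive D.

Lemma cover_by_stars (b : T -> bool) (U X : {set T}) : [disjoint U & X] ->
    {in U, forall u,
      l ^ 2 * independence_number D + #|U| * l < #|nbrs D (b u) u X|} ->
  exists S : {set T}, [/\ S \subset X, #|S| = #|U| * l.-1
    & has_factor C D (U :|: S)].
Proof.
move En: #|U| => n; elim: n U En => [|n IH] U En dUX ltN.
  exists set0; rewrite (cards0_eq En) setU0 sub0set cards0; split=> //.
  exact: fac0.
have [u uU] : exists u, u \in U by apply/card_gt0P; rewrite En.
have cU : #|U :\ u| = n by move: (cardsD1 u U); rewrite uU En => -[].
have [||S [sS cS fS]] := IH _ cU; first by set_tac.
  move=> v; rewrite inE => /andP[_ vU]; apply: leq_ltn_trans (ltN v vU).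
  by rewrite leq_add2l leq_mul2r leqnSn orbT.
have [|S' [sS' cS' copS']] := star_copy l_ge3 orC ndC irrD (b := b u) (x := u) (W := X :\: S).
  have -> : nbrs D (b u) u (X :\: S) = nbrs D (b u) u X :\: S.
    by apply/setP => z; rewrite !inE andbA.
  rewrite cardsD; have := ltN u uU.
  have : #|nbrs D (b u) u X :&: S| <= n * l.-1.
    by rewrite -cS subset_leq_card ?subsetIr.
  have : n * l.-1 <= n * l by rewrite leq_mul2l leq_pred orbT.
  rewrite mulSn; move: (n * l) (n * l.-1) (l ^ 2 * _) #|nbrs _ _ _ _| #|_ :&: S|.
  by clear -l_ge3; lia.
have sS'X : S' \subset X :\: S by apply: subset_trans sS' (nbrs_sub _ _ _ _).
exists (S :|: S'); split.
- by set_tac.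
- rewrite cardU_disjoint ?cS ?cS' ?mulSn 1?addnC //; by clear sS'; set_tac.
- have -> : U :|: (S :|: S') = (U :\ u :|: S) :|: (u |: S').
    by clear sS'; set_tac.
  by apply: facU fS (fac_copyset copS'); clear sS'; set_tac.
Qed.

End Cover.

Section Hitting.

(** That is, [(1 - 1/(4k))^(12k) <= 1/4]. With [a = 4k - 1], Bernoulli's inequality gives
    [(1 + 1/a)^(12k) >= 1 + 12k/a >= 4]. *)
Lemma bernoulli_quarter k : 0 < k -> 4 * (4 * k).-1 ^ (12 * k) <= (4 * k) ^ (12 * k).
Proof.
move=> k_gt0; pose a := (4 * k).-1.
have -> : 4 * k = a.+1 by rewrite /a prednK // muln_gt0.
have bern n : a ^ n * (a + n) <= a.+1 ^ n * a.
  elim: n => [|n IH]; first by rewrite addn0.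
  rewrite !expnS; apply: leq_trans (_ : a.+1 * (a ^ n * (a + n)) <= _).
    have H : a * (a + n.+1) <= a.+1 * (a + n).
      by rewrite mulSn addnS mulnS leq_add2r leq_addr.
    rewrite mulnAC [in X in _ <= X]mulnCA [in X in _ <= X]mulnC leq_mul2r.
    by rewrite H orbT.
  by rewrite -mulnA leq_mul2l IH orbT.
have a_gt0 : 0 < a by rewrite /a; clear -k_gt0; lia.
rewrite -(leq_pmul2r a_gt0); apply: leq_trans (bern _).
rewrite mulnAC mulnC leq_mul2l; apply/orP; right.
by rewrite /a; clear -k_gt0; lia.
Qed.

Variables (T I : finType) (A : I -> {set T}).

(* Each step halves the weights [2 ^ (N - #|X :&: A i|)] of the sets hit by the
   new point, which is chosen to hit the largest total weight. *)
Lemma hitting_potential k N r : 0 < k -> (forall i, #|T| <= k * #|A i|) ->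
    0 < #|T| -> 2 * k * N <= #|T| -> r <= N ->
  exists X : {set T}, #|X| = r /\
    (4 * k) ^ r * \sum_i 2 ^ (N - #|X :&: A i|) <= (4 * k).-1 ^ r * (#|I| * 2 ^ N).
Proof.
move=> k_gt0 bigA T_gt0 leN; elim: r => [|r IH] le_r.
  exists set0; rewrite cards0 !mul1n; split=> //.
  by rewrite -sum_nat_const leq_sum // => i _; rewrite set0I cards0 subn0.
have [X [cX potX]] := IH (ltnW le_r).
pose om i := 2 ^ (N - #|X :&: A i|); pose Phi := \sum_i om i.
pose S x := \sum_(i | x \in A i) om i.
(* Each [A i] keeps at least [#|T| / (2k)] points outside [X], since [2 * k * N <= #|T|]. Averaging
   over these points finds an [x] that meets a [1/(2k)] share of the potential. *)
have [x xX bigS] : exists2 x, x \in ~: X & Phi <= 2 * k * S x.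
  apply/exists_inP; rewrite -[X in is_true X]negbK negb_exists_in.
  apply/negP => /forall_inP small.
  have eq_sum : \sum_(x in ~: X) S x = \sum_i om i * #|A i :\: X|.
    rewrite (exchange_big_dep predT) //=; apply: eq_bigr => i _.
    rewrite sum_nat_cond_const mulnC; congr (_ * _).
    by apply: eq_card => y; rewrite !inE.
  have lbound : #|T| * Phi <= \sum_(x in ~: X) 2 * k * S x.
    rewrite -big_distrr /= eq_sum !big_distrr /=; apply: leq_sum => i _.
    rewrite mulnCA mulnC leq_mul2l; apply/orP; right.
    rewrite cardsD mulnBr leq_subRL; last first.
      by rewrite leq_mul2l subset_leq_card ?subsetIl ?orbT.
    have : 2 * k * #|A i :&: X| <= #|T|.
      apply: leq_trans leN; rewrite leq_mul2l; apply/orP; right.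
      by rewrite (leq_trans _ (ltnW le_r)) // -cX subset_leq_card ?subsetIr.
    have := bigA i; rewrite -!mulnA; move: (k * _) (k * _) #|T| => z1 z2 t.
    by clear; lia.
  have ubound : \sum_(x in ~: X) (2 * k * S x).+1 <= #|~: X| * Phi.
    rewrite -sum_nat_const; apply: leq_sum => x xX.
    by rewrite ltnNge small.
  have : 0 < #|~: X|.
    have := cardsC X; rewrite cX.
    have : N < #|T| \/ #|T| <= N by case: ltnP; auto.
    case; first by move: le_r; clear; lia.
    move=> le_TN; have : 2 * k * N >= 2 * N.
      by rewrite -mulnA leq_mul2l leq_pmull ?orbT.
    by move: leN le_TN T_gt0; clear; lia.
  have : #|~: X| * Phi <= #|T| * Phi by rewrite leq_mul2r max_card orbT.
  move: ubound lbound.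
  under eq_bigr do rewrite -addn1.
  rewrite big_split /= sum1_card.
  move: (\sum_(_ in _) _) (#|T| * Phi) (#|~: X| * Phi) #|~: X|.
  by clear; lia.
rewrite inE in xX.
exists (x |: X); rewrite cardsU1 xX cX; split=> //.
pose om' i := 2 ^ (N - #|(x |: X) :&: A i|).
have om'E i : om i = if x \in A i then 2 * om' i else om' i.
  rewrite /om /om'; case: ifP => xA.
    have -> : (x |: X) :&: A i = x |: (X :&: A i).
      by apply/setP => y; rewrite !inE; case: eqP => //= ->; rewrite xA.
    rewrite cardsU1 inE (negPf xX) /= -expnS; congr (2 ^ _).
    have : #|X :&: A i| <= r by rewrite -cX subset_leq_card ?subsetIl.
    by move: #|_| le_r => z; clear; lia.
  by congr (2 ^ (_ - #|pred_of_set _|)); apply/setP => y; rewrite !inE;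
     case: eqP => //= ->; rewrite xA !andbF.
have PhiE : 2 * \sum_i om' i + S x = 2 * Phi.
  rewrite /S (bigID (fun i => x \in A i)) /= /Phi [in RHS](bigID (fun i => x \in A i)) /=.
  have -> : \sum_(i | x \in A i) om i = 2 * \sum_(i | x \in A i) om' i.
    by rewrite big_distrr /=; apply: eq_bigr => i xA; rewrite om'E xA.
  have -> : \sum_(i | x \notin A i) om i = \sum_(i | x \notin A i) om' i.
    by apply: eq_bigr => i /negPf xA; rewrite om'E xA.
  by clear; lia.
(* Halving a [1/(2k)] share removes a [1/(4k)] share of the potential. *)
have step : 4 * k * \sum_i om' i <= (4 * k).-1 * Phi.
  have E : 4 * k * \sum_i om' i + 2 * k * S x = 4 * k * Phi.
    have -> : 4 * k * \sum_i om' i = 2 * k * (2 * \sum_i om' i).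
      by rewrite mulnA; congr (_ * _); clear; lia.
    by rewrite -mulnDr PhiE mulnA; congr (_ * _); clear; lia.
  have : (4 * k).-1 * Phi + Phi = 4 * k * Phi.
    by rewrite -{2}(mul1n Phi) -mulnDl addn1 prednK // muln_gt0.
  by move: E bigS; move: (_ * Phi) (_ * Phi) (_ * S x) (_ * _); clear; lia.
rewrite !expnS mulnAC mulnC.
apply: leq_trans (_ : (4 * k) ^ r * ((4 * k).-1 * Phi) <= _).
  by rewrite leq_mul2l step orbT.
by rewrite mulnCA -mulnA leq_mul2l potX orbT.
Qed.

(** A set hit fewer than [n] times would retain a weight above [2^(N - n)], but after [N = 12kn]
    steps the whole potential is at most [#|I| * 2^N / 4^n], which is below [2^(N - n)]. *)
Lemma hitting_set k n : 0 < k -> (forall i, #|T| <= k * #|A i|) ->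
    0 < #|T| -> 2 * k * (12 * k * n) <= #|T| -> #|I| < 2 ^ n ->
  exists X : {set T}, #|X| = 12 * k * n /\ forall i, n <= #|X :&: A i|.
Proof.
move=> k_gt0 bigA T_gt0 leN ltI; set N := 12 * k * n.
have [X [cX potX]] := hitting_potential k_gt0 bigA T_gt0 leN (leqnn N).
exists X; split=> // i; rewrite leqNgt; apply/negP => lt_hn.
have n_gt0 : 0 < n.
  rewrite lt0n; apply: contraTneq ltI => ->.
  by rewrite expn0 -leqNgt; apply/card_gt0P; exists i.
have le1 : 4 ^ n * (4 * k).-1 ^ N <= (4 * k) ^ N.
  by rewrite /N !(expnM _ _ n) -expnMn leq_exp2r // bernoulli_quarter.
have k4 : 0 < (4 * k).-1 ^ N by rewrite expn_gt0; clear -k_gt0; lia.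
have le2 : 4 ^ n * 2 ^ (N - #|X :&: A i|) <= #|I| * 2 ^ N.
  rewrite -(leq_pmul2r k4) [in X in _ <= X]mulnC; apply: leq_trans potX.
  rewrite mulnAC leq_mul ?le1 //.
  by rewrite (bigD1 i) //= leq_addr.
have le3 : 2 ^ (n + n + (N - #|X :&: A i|)) < 2 ^ (n + N).
  rewrite !expnD -expnMn; apply: leq_ltn_trans le2 _.
  by rewrite ltn_pmul2r ?expn_gt0.
by move: le3 lt_hn; rewrite ltn_exp2l //; move: #|_ :&: _| => h; clear; lia.
Qed.

End Hitting.

(** * Copies and switching in a pair of clusters *)

Section CorePair.
Variables (l : nat) (C : rel 'I_l).
Hypothesis l_ge3 : 3 <= l.
Hypothesis orC : cycle_orientation C.
Hypothesis ndC : ~ isomorphic (@directed_cycle l) C.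
Variables (T : finType) (D : rel T) (VD : {set T}).
Hypothesis irrD : irreflexive D.
(** A neighbourhood larger than [thr] still contains the required oriented paths after the [B]
    forbidden vertices and up to [3 * l] vertices in use have been removed. *)
Variables (B thr : nat).
Hypothesis le_thr : l ^ 2 * independence_number D + B + 3 * l <= thr.

Let l_gt0 : 0 < l. Proof. exact: ltn_trans l_ge3. Qed.

Lemma nbrsD b x (W F : {set T}) : nbrs D b x (W :\: F) = nbrs D b x W :\: F.
Proof. by apply/setP => z; rewrite !inE andbA. Qed.

Lemma card_diff_gt (W F : {set T}) r s : r + s < #|W| -> #|F| <= s -> r < #|W :\: F|.
Proof.
rewrite cardsD => lt_W leF; rewrite ltn_subRL addnC.
by apply: leq_ltn_trans lt_W; rewrite leq_add2l (leq_trans _ leF) // subset_leq_card ?subsetIr.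
Qed.

Lemma robust_star_of_nbrs b x (K : {set T}) : thr < #|nbrs D b x K| ->
  robust_star C D B K x.
Proof.
move=> lt_N F leF.
have [|S [sS cS copS]] := star_copy l_ge3 orC ndC irrD (b := b) (x := x) (W := K :\: F).
  rewrite nbrsD; apply: card_diff_gt leF; apply: leq_ltn_trans lt_N.
  by apply: leq_trans le_thr; rewrite leq_addr.
have sSKF := subset_trans sS (nbrs_sub _ _ _ _).
have xNS : x \notin S.
  by apply: contra (nbrs_irr irrD b x (K :\: F)); apply: (subsetP sS).
by exists S; split=> //; clear sS; set_tac.
Qed.

Variables (P Q : {set T}).
Hypothesis sPV : P \subset VD.
Hypothesis sQV : Q \subset VD.
Hypothesis dPQ : [disjoint P & Q].
Hypothesis nbrsP : {in P, forall x, thr < #|nbrs D true x Q|}.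
Hypothesis nbrsQ : {in Q, forall y, thr < #|nbrs D false y P|}.
Hypothesis middle : forall x x' (F : {set T}), x \in P -> x' \in P -> #|F| <= B + 2 ->
  exists2 z, z \in P :\: F & thr < #|nbrs D true x Q :&: nbrs D true z Q| /\
                             thr < #|nbrs D true x' Q :&: nbrs D true z Q|.

(** Two vertices of [P] may have no common out-neighbour, but each has many in common with an
    intermediate [z]. If [S1] completes both [x] and [z], and [S2] both [z] and [x'], then
    [z |: (S1 :|: S2)] switches [x] and [x']. *)
Lemma linked_source_side : linked C D VD B (2 * l) P.
Proof.
move=> x x' xP x'P ne_xx' F leF.
have [|z] := middle (F := F :|: [set x; x']) xP x'P.
  by rewrite (leq_trans (leq_cardU _ _)) // cards2 ne_xx' leq_add2r.
rewrite inE => /andP[zN zP] [big1 big2].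
have [|S1 [sS1 cS1 copS1]] := common_star_copy l_ge3 orC ndC irrD true
   (W := (nbrs D true x Q :&: nbrs D true z Q) :\: F).
  apply: card_diff_gt leF; apply: leq_ltn_trans big1.
  by apply: leq_trans le_thr; rewrite leq_addr.
have [|S2 [sS2 cS2 copS2]] := common_star_copy l_ge3 orC ndC irrD true
   (W := (nbrs D true x' Q :&: nbrs D true z Q) :\: (F :|: S1)).
  apply: (@card_diff_gt _ _ _ (B + l)).
    by apply: leq_ltn_trans big2; apply: leq_trans le_thr; clear; lia.
  by rewrite (leq_trans (leq_cardU _ _)) // leq_add // cS1 leq_pred.
have Hsub (b : bool) w w' (S E : {set T}) :
    S \subset (nbrs D b w Q :&: nbrs D b w' Q) :\: E ->
    S \subset nbrs D b w S /\ S \subset nbrs D b w' S.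
  move=> /subsetP sS; split; apply/subsetP => y yS; rewrite inE yS;
  by have := sS y yS; rewrite !inE => /and3P[_ /andP[_ ?] /andP[_ ?]].
have [S1x S1z] := Hsub _ _ _ _ _ sS1; have [S2x S2z] := Hsub _ _ _ _ _ sS2.
have sS1Q : S1 \subset Q :\: F.
  by apply: subset_trans sS1 _; apply/subsetP => y; rewrite !inE => /and3P[-> /andP[->]].
have sS2Q : S2 \subset Q :\: (F :|: S1).
  by apply: subset_trans sS2 _; apply/subsetP => y; rewrite !inE => /and3P[-> /andP[->]].
have c1x := fac_copyset (copS1 x S1x); have c1z := fac_copyset (copS1 z S1z).
have c2x := fac_copyset (copS2 x' S2x); have c2z := fac_copyset (copS2 z S2z).
clear sS1 sS2 S1x S1z S2x S2z copS1 copS2 big1 big2 Hsub.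
exists (z |: (S1 :|: S2)); split.
- by set_tac.
- rewrite (leq_trans (leq_cardU _ _)) // cards1.
  by have := leq_cardU S1 S2; rewrite cS1 cS2; clear -l_gt0; lia.
- by set_tac.
- have -> : z |: (S1 :|: S2) :|: [set x] = (x |: S1) :|: (z |: S2) by set_tac.
  by apply: facU c1x c2z; set_tac.
- have -> : z |: (S1 :|: S2) :|: [set x'] = (z |: S1) :|: (x' |: S2) by set_tac.
  by apply: facU c1z c2x; set_tac.
Qed.

Hypothesis P_big : B < #|P|.

Lemma robust_type_one : robust_type C D B 1 P Q.
Proof.
move=> F leF; have [x xP xNF] := pick_outside (leq_ltn_trans leF P_big).
have [S [sS dS xNS cS copS]] := robust_star_of_nbrs (nbrsP xP) leF.
exists [set x], S; split=> //.
- by rewrite sub1set.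
- by set_tac.
- by rewrite cards1.
- by split=> //; rewrite cS subn1.
Qed.

Hypothesis type_two : robust_type C D B 2 P Q.

(** [P] is linked through intermediate vertices. [Q] is then linked through [P], its vertices being
    sinks of copies with all other vertices in [P]. The two copy types finally merge both sides. *)
Lemma linked_core c1 c2 : c1 = l * (2 * l).+2 -> c2 = 4 * l * c1.+2 ->
  c1 + c2 <= B -> linked C D VD (B - (c1 + c2)) c2 (P :|: Q).
Proof.
move=> def_c1 def_c2 le_cB.
have linkQ : linked C D VD (B - c1) c1 Q.
  rewrite def_c1; apply: (linked_extend l_gt0 sPV linked_source_side).
    by rewrite -def_c1 subnK // (leq_trans _ le_cB) // leq_addr.
  by move=> y yQ; apply: robust_star_of_nbrs (nbrsQ yQ).
have linkP : linked C D VD (B - c1) c1 P.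
  apply: linkedW linked_source_side; first exact: leq_subr.
  by rewrite def_c1 mulnC leq_mul2l; apply/orP; right; clear -l_gt0; lia.
have typeW i : robust_type C D B i P Q -> robust_type C D (B - c1) i P Q.
  by move=> H F leF; apply: H; apply: leq_trans leF _; apply: leq_subr.
rewrite def_c2; apply: (linked_merge l_gt0 _ sPV sQV dPQ linkP linkQ).
- exact: ltn_trans l_ge3.
- by rewrite -def_c2; move: le_cB; clear; lia.
- exact: typeW robust_type_one.
- exact: typeW type_two.
Qed.

End CorePair.

Section TypeTwo.
Variables (l : nat) (C : rel 'I_l).
Hypothesis l_ge3 : 3 <= l.
Hypothesis orC : cycle_orientation C.
Hypothesis ndC : ~ isomorphic (@directed_cycle l) C.
Variables (T : finType) (D : rel T).
Hypothesis irrD : irreflexive D.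
Variables (B thr : nat).
Hypothesis le_thr : l ^ 2 * independence_number D + B + 3 * l <= thr.
Variables (P Q : {set T}).
Hypothesis dPQ : [disjoint P & Q].

(** [P :\: F] exceeds the independence number and so contains an arc; its ends are the two vertices
    of the copy in [P], the rest lying in their common out-neighbourhood. *)
Lemma type_two_of_dense : B + independence_number D < #|P| ->
    {in P &, forall x x', thr < #|nbrs D true x Q :&: nbrs D true x' Q|} ->
  robust_type C D B 2 P Q.
Proof.
move=> P_big common F leF.
have [x [x' [xPF x'PF Dxx']]] : exists x x', [/\ x \in P :\: F, x' \in P :\: F & D x x'].
  have : ~~ independent D (P :\: F).
    apply/negP => ind; have : #|P :\: F| <= independence_number D.
      exact: (@leq_bigmax_cond _ _ (fun S : {set T} => #|S|)).
    by apply/negP; rewrite -ltnNge; apply: card_diff_gt leF; rewrite addnC.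
  rewrite negb_forall_in => /exists_inP[x xP]; rewrite negb_forall_in.
  move=> /exists_inP[x' x'P]; rewrite negbK => /orP[Dxx'|Dx'x].
    by exists x, x'.
  by exists x', x.
have /setDP[xP xNF] := xPF; have /setDP[x'P x'NF] := x'PF.
pose W := (nbrs D true x Q :&: nbrs D true x' Q) :\: F.
have [|||S [sS cS copS]] := two_source_copy l_ge3 orC ndC irrD (W := W) Dxx'.
- by apply/subsetP => y yW; rewrite inE yW; move: yW; rewrite !inE => /and3P[_ /andP[_ ->]].
- by apply/subsetP => y yW; rewrite inE yW; move: yW; rewrite !inE => /and3P[_ _ /andP[_ ->]].
- apply: card_diff_gt leF; apply: leq_ltn_trans (common x x' xP x'P).
  by apply: leq_trans le_thr; rewrite leq_addr.
have sSQ : S \subset Q :\: F.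
  by apply: subset_trans sS _; apply/subsetP => y; rewrite !inE => /and3P[-> /andP[->]].
have ne_xx' : x != x' by apply: contraTneq Dxx' => ->; rewrite irrD.
clear sS; exists [set x; x'], S; split.
- by set_tac.
- by set_tac.
- by set_tac.
- by rewrite cards2 ne_xx'.
- by split; [rewrite cS; clear; lia|rewrite -setUA].
Qed.

(** The second vertex [v] of the copy in [P] is not adjacent to [x] on the cycle, and its two cycle
    neighbours lie in [Q]. It therefore needs neighbours of both directions among the out-neighbours
    of [x]. *)
Lemma type_two_of_digon : B < #|P| -> B < #|Q| ->
    {in P, forall x (F : {set T}), #|F| <= B -> exists v, [/\ v \in P :\: F, v != x &
       forall b, thr < #|nbrs D b v (nbrs D true x Q :\: F)|]} ->
    {in Q, forall y, thr < #|nbrs D false y P|} ->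
  robust_type C D B 2 P Q.
Proof.
move=> P_big Q_big middle nbrsQ F leF.
(* On a triangle all vertices are adjacent, so no such [v] fits; there two vertices in [P] mean one
   in [Q], which is taken as the sink. *)
have [El|l_ne3] := eqVneq l 3.
  have [y yQ yNF] := pick_outside (leq_ltn_trans leF Q_big).
  have [S [sS dS yNS cS copS]] :=
    robust_star_of_nbrs l_ge3 orC ndC irrD le_thr (nbrsQ y yQ) leF.
  exists S, [set y]; split=> //.
  - by rewrite sub1set.
  - by set_tac.
  - by rewrite cS; clear -El; lia.
  - by split; [rewrite cards1; clear -El; lia|rewrite setUC].
have [x xP xNF] := pick_outside (leq_ltn_trans leF P_big).
have [v [vPF ne_vx bigv]] := middle x xP F leF.
have /setDP[vP vNF] := vPF.
have [||||S [sS cS copS]] := two_apart_copy l_ge3 orC ndC irrD (x := x) (v := v) (W := nbrs D true x Q :\: F) _ ne_vx.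
- by move: l_ge3 l_ne3; clear; lia.
- by apply/subsetP => y yW; rewrite inE yW; move: yW; rewrite !inE => /and3P[_ _ ->].
- by rewrite !inE (disjointFr dPQ vP) /= !andbF.
- move=> b; apply: leq_ltn_trans (bigv b); apply: leq_trans le_thr.
  by clear; lia.
have sSQ : S \subset Q :\: F.
  by apply: subset_trans sS _; apply/subsetP => y; rewrite !inE => /and3P[-> ->].
clear sS; exists [set x; v], S; split.
- by set_tac.
- by set_tac.
- by set_tac.
- by rewrite cards2 eq_sym ne_vx.
- by split; [rewrite cS; clear; lia|rewrite -setUA].
Qed.

End TypeTwo.

(** * The absorbing set and its reservoir *)

Lemma has_factor_induced (l : nat) (C : rel 'I_l) (T : finType) (D : rel T)
    (VD W : {set T}) : W \subset VD ->
  has_factor C D W -> has_factor C (induced D VD) W.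
Proof.
move=> /subsetP sWV [F [[copyF disF] covF]]; exists F; split=> //; split=> // c cF.
have [inj_c homo_c] := copyF c cF; split=> // i j /homo_c.
by rewrite /induced /= => /and3P[/[dup] iW /sWV-> /[dup] jW /sWV-> ->]; rewrite iW jW.
Qed.

Lemma absorbing_set (l : nat) (C : rel 'I_l) (T : finType) (D : rel T)
    (VD X : {set T}) (B B' c h u : nat) :
    (3 <= l)%N -> cycle_orientation C -> ~ isomorphic (@directed_cycle l) C ->
    irreflexive D -> linked C D VD B c VD ->
    {in VD, forall x, robust_star C D B VD x} ->
    B' + l * c.+2 + l <= B -> B' + l * c.+2 + l < #|VD| ->
    X \subset VD -> #|X|.+1 * (2 ^ (2 * l) * (l * c.+2) + 2 * l).+1 <= B' ->
    {in VD, forall x, exists b, h <= #|nbrs D b x X|} ->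
    l ^ 2 * independence_number D + u * l < h ->
  exists A : {set T},
    [/\ A \subset VD,
        #|A| <= #|X|.+1 * (2 ^ (2 * l) * (l * c.+2) + 2 * l).+1 &
        forall U : {set T}, U \subset VD :\: A -> #|U| <= u -> l %| #|A :|: U| ->
          has_factor C D (A :|: U)].
Proof.
move=> l_ge3 orC ndC irrD linkVD starVD leB ltVD sXV leX hitX lt_h.
have l_gt0 : 0 < l by apply: ltn_trans l_ge3.
set w := _ + 2 * l in leX *.
have absVD := linked_absorb l_gt0 (subxx VD) linkVD ltVD leB starVD.
have ltB' : B' < #|VD| by apply: leq_ltn_trans ltVD; rewrite -addnA leq_addr.
have [|G [a [sGV sav ca cG [dG da dGa facG]]]] :=
  @absorb_chain l C T D VD l_gt0 B' _ VD (subxx VD) absVD X set0 sXV ltB'.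
  by rewrite cards0.
rewrite !set0U in dG da; rewrite -/w in cG.
pose A := X :|: G :|: a; exists A; split.
- by rewrite /A !subUset sXV sGV sav.
- have := leq_cardU (X :|: G) a; have := leq_cardU X G; rewrite -/A ca.
  have lw : l <= w by rewrite /w; move: (_ * _); clear; lia.
  move: cG lw; rewrite mulSn mulnS.
  by move: (#|X| * w) #|X| #|G| #|X :|: G| #|A|; clear; lia.
move=> U sU leU dvdAU.
have sUV : U \subset VD := subset_trans sU (subsetDl _ _).
have dUA : [disjoint U & A] by clear -sU; move: A sU => A sU; set_tac.
have [dUX dUG dUa] : [/\ [disjoint U & X], [disjoint U & G] & [disjoint U & a]].
  by split; apply: disjointWr dUA; rewrite /A; clear; set_tac.
pose b x := h <= #|nbrs D true x X|.
have hitb : {in U, forall x, l ^ 2 * independence_number D + #|U| * l < #|nbrs D (b x) x X|}.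
  move=> x /(subsetP sUV)/hitX[b0 le_h].
  apply: leq_ltn_trans (_ : l ^ 2 * independence_number D + u * l < _).
    by rewrite leq_add2l leq_mul2r leU orbT.
  apply: leq_trans lt_h _; rewrite /b; case: (boolP (h <= #|nbrs D true x X|)) => //.
  by case: b0 le_h => // ->.
have [S [sSX cS facUS]] := cover_by_stars l_ge3 orC ndC irrD dUX hitb.
have [a' sa' fac2] := facG (X :\: S) (subsetDl _ _).
have dvd1 := fac_dvd facUS; have dvd2 := fac_dvd fac2.
have AUE : A :|: U = (U :|: S) :|: ((X :\: S :|: G :|: (a :\: a')) :|: a').
  by rewrite /A; clear -sSX sa'; set_tac.
have d1 : [disjoint U :|: S & (X :\: S :|: G :|: (a :\: a')) :|: a'].
  by clear -sSX sa' dUX dUG dUa dG da; set_tac.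
have d2 : [disjoint X :\: S :|: G :|: (a :\: a') & a'].
  by clear -sSX sa' dG da dGa; set_tac.
(* All other parts have size divisible by [l], hence so has [a'], which has fewer than [l] vertices.
   This is where the divisibility condition on [A :|: U] enters. *)
have a'0 : a' = set0.
  apply/eqP; rewrite -cards_eq0; move: dvdAU.
  rewrite AUE (cardU_disjoint d1) dvdn_addr // (cardU_disjoint d2) dvdn_addr //.
  apply: contraTT => a'_n0; rewrite gtnNdvd ?lt0n //.
  by rewrite (leq_ltn_trans (subset_leq_card sa')) // ca ltn_predL.
rewrite AUE a'0 setU0 in d1 *.
apply: facU d1 facUS _; move: fac2; by rewrite a'0.
Qed.

(** The exponent is split at [2 * t]. The inequality serves to show that a number [N] of hits linear
    in the order satisfies [#|T| < 2 ^ N]. *)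
Lemma linear_lt_exp t N : 4 * t <= N -> N.+1 * t < 2 ^ N.
Proof.
move=> le_tN; pose s := 2 * t.
have le_sN : s <= N by rewrite /s; move: le_tN; clear; lia.
rewrite -(subnKC le_sN) expnD.
have lt_s : s < 2 ^ s by apply: ltn_expl.
have lt_Ns : N - s < 2 ^ (N - s) by apply: ltn_expl.
apply: leq_trans (_ : s.+1 * (N - s).+1 <= _); last exact: leq_mul.
by rewrite subnKC // /s; move: le_tN; clear; nia.
Qed.

Lemma reservoir (T : finType) (D : rel T) (VD : {set T}) k N :
    0 < k -> 0 < #|T| ->
    {in VD, forall x, exists b, #|T| <= k * #|nbrs D b x VD|} ->
    2 * k * (12 * k * N) <= #|T| -> #|T| < 2 ^ N ->
  exists X : {set T}, [/\ X \subset VD, #|X| <= 12 * k * N &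
    {in VD, forall x, exists b, N <= #|nbrs D b x X|}].
Proof.
move=> k_gt0 T_gt0 bigVD leN ltT.
pose b x := #|T| <= k * #|nbrs D true x VD|.
(* The default [setT] lets one family be indexed by all vertices while satisfying the size condition
   trivially outside [VD]. *)
pose A x := if x \in VD then nbrs D (b x) x VD else setT.
have bigA x : #|T| <= k * #|A x|.
  rewrite /A; case: ifP => [xV|_]; last by rewrite cardsT leq_pmull.
  rewrite /b; case: (boolP (#|T| <= k * #|nbrs D true x VD|)) => //.
  by have [b0] := bigVD x xV; case: b0 => // ->.
have [X [cX hitX]] := hitting_set k_gt0 bigA T_gt0 leN ltT.
exists (X :&: VD); split; first exact: subsetIr.
  by rewrite -cX subset_leq_card ?subsetIl.
move=> x xV; exists (b x); apply: leq_trans (hitX x) _.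
rewrite /A xV subset_leq_card //; apply/subsetP => y; rewrite !inE.
by case/and3P => -> -> ->.
Qed.

Local Open Scope ring_scope.

(** * Regular pairs and the reduced graph *)

Lemma sum_constR (R : pzRingType) (I : finType) (A : {set I}) (x : R) :
  \sum_(i in A) x = x * #|A|%:R.
Proof. by rewrite sumr_const mulr_natr. Qed.

(* Among the arcs inside [Y], each counted once if both ends have the same sign
   and at most twice otherwise, the worst case is [Pl] halving [Y]. *)
Lemma star_degree_sum (R : realFieldType) (I : finType) (Y Pl : {set I})
    (e : I -> I -> R) (h : R) :
    0 <= h -> (forall i j, 0 <= e i j) -> (forall i j, e i j + e j i <= h) ->
  \sum_(i in Y) (if i \in Pl then \sum_(j in Y) e i j else \sum_(j in Y) e j i)
    <= 3 / 4 * h * #|Y|%:R ^+ 2.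
Proof.
move=> h_ge0 e_ge0 le_eh.
pose S (X Z : {set I}) := \sum_(i in X) \sum_(j in Z) e i j.
pose X := Y :&: Pl; pose Z := Y :\: Pl.
have splitY (f : I -> R) : \sum_(i in Y) f i = \sum_(i in X) f i + \sum_(i in Z) f i.
  by rewrite (big_setID Pl).
have SYr W : S W Y = S W X + S W Z.
  by rewrite /S -big_split; apply: eq_bigr => i _ /=; rewrite splitY.
have SYl W : S Y W = S X W + S Z W by rewrite /S splitY.
have sumE : \sum_(i in Y) (if i \in Pl then \sum_(j in Y) e i j else \sum_(j in Y) e j i)
    = S X Y + S Y Z.
  rewrite splitY; congr (_ + _).
    by apply: eq_bigr => i; rewrite inE => /andP[_ ->].
  rewrite /S [RHS]exchange_big /=; apply: eq_bigr => i.
  by rewrite inE => /andP[/negPf->].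
have Sdiag W : S W W <= h / 2 * #|W|%:R ^+ 2.
  have : S W W + S W W <= h * #|W|%:R ^+ 2.
    rewrite {2}/S exchange_big -big_split /=.
    apply: le_trans (_ : \sum_(i in W) (h * #|W|%:R) <= _).
      apply: ler_sum => i _; rewrite -big_split /= -sum_constR.
      by apply: ler_sum => j _; apply: le_eh.
    by rewrite sum_constR expr2 mulrA.
  by rewrite [h / 2 * _]mulrAC; move: (S W W) (h * _) => s a; lra.
have Soff : S X Z <= h * (#|X|%:R * #|Z|%:R).
  apply: le_trans (_ : \sum_(i in X) (h * #|Z|%:R) <= _).
    apply: ler_sum => i _; rewrite -sum_constR; apply: ler_sum => j _.
    by apply: le_trans (le_eh i j); rewrite lerDl.
  by rewrite sum_constR -mulrA [_ * #|X|%:R]mulrC.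
rewrite sumE SYr SYl.
have cY : #|Y|%:R = #|X|%:R + #|Z|%:R :> R by rewrite -natrD cardsID.
have := Sdiag X; have := Sdiag Z; rewrite cY.
move: Soff; move: (#|X|%:R) (#|Z|%:R) (S X X) (S X Z) (S Z Z) => x z s1 s2 s3.
move=> H2 H3 H1.
(* The slack in the final estimate is a quarter of this square. *)
have : 0 <= h * (x - z) ^+ 2 by rewrite mulr_ge0 ?sqr_ge0.
have -> : h * (x - z) ^+ 2 = h * x ^+ 2 - 2 * (h * (x * z)) + h * z ^+ 2 by ring.
have -> : 3 / 4 * h * (x + z) ^+ 2 =
  3 / 4 * (h * x ^+ 2) + 3 / 2 * (h * (x * z)) + 3 / 4 * (h * z ^+ 2) by field.
move: H1 H3; rewrite ![h / 2 * _]mulrAC.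
by move: (h * x ^+ 2) (h * z ^+ 2) (h * (x * z)) H2 => a b c; lra.
Qed.

Section RegularPairs.
Variables (R : realType) (T : finType) (D : rel T).
Implicit Types X Y W : {set T}.

Lemma card_nbrs b x W : #|nbrs D b x W| = (\sum_(y in W) darc D b x y)%N.
Proof.
rewrite -sum1_card big_mkcond [RHS]big_mkcond /=; apply: eq_bigr => y _.
by rewrite inE; case: (y \in W); case: (darc _ _ _ _).
Qed.

Definition bdensity (b : bool) X Y : R :=
  if b then density R D X Y else density R D Y X.

Lemma density_sum X Y : density R D X Y =
  (\sum_(x in X) #|nbrs D true x Y|)%:R / (#|X|%:R * #|Y|%:R).
Proof.
congr (_%:R / _); under [RHS]eq_bigr do rewrite card_nbrs.
rewrite pair_big /= -sum1_card big_mkcond [RHS]big_mkcond /=.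
apply: eq_bigr => -[x y] _ /=; rewrite !inE /=.
by case: (x \in X); case: (y \in Y) => //=; rewrite /darc; case: (D x y).
Qed.

Lemma nbrs_exchange b X Y :
  (\sum_(x in X) #|nbrs D b x Y| = \sum_(y in Y) #|nbrs D (~~ b) y X|)%N.
Proof.
under eq_bigr do rewrite card_nbrs; under [RHS]eq_bigr do rewrite card_nbrs.
by rewrite exchange_big; apply: eq_bigr => y _; apply: eq_bigr => x _; rewrite darcN.
Qed.

Lemma bdensity_sum b X Y : bdensity b X Y =
  (\sum_(x in X) #|nbrs D b x Y|)%:R / (#|X|%:R * #|Y|%:R).
Proof.
rewrite /bdensity; case: b; rewrite density_sum //.
by rewrite (nbrs_exchange true) [_%:R * #|Y|%:R]mulrC.
Qed.

Definition atypical (eps : R) b X Y W : {set T} :=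
  [set x in X | #|nbrs D b x W|%:R < (bdensity b X Y - eps) * #|W|%:R].

(** Otherwise the atypical vertices and [W] would be a pair of admissible size whose density is at
    least [eps] below that of the clusters. Both orders are assumed regular since [b] selects one of
    them. *)
Lemma atypical_small (eps : R) b X Y W : 0 < eps ->
    regular_pair eps D X Y -> regular_pair eps D Y X ->
    X != set0 -> Y != set0 -> W \subset Y -> eps * #|Y|%:R <= #|W|%:R ->
  #|atypical eps b X Y W|%:R < eps * #|X|%:R.
Proof.
move=> eps_gt0 regXY regYX X_n0 Y_n0 sWY bigW.
rewrite ltNge; apply/negP => bigA; set A := atypical _ _ _ _ _ in bigA.
have sAX : A \subset X by apply/subsetP => x; rewrite inE => /andP[].
have A_gt0 : 0 < #|A|%:R :> R.
  by apply: lt_le_trans bigA; rewrite mulr_gt0 // ltr0n card_gt0.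
have W_gt0 : 0 < #|W|%:R :> R.
  by apply: lt_le_trans bigW; rewrite mulr_gt0 // ltr0n card_gt0.
have reg : `|bdensity b A W - bdensity b X Y| < eps.
  by rewrite /bdensity; case: (b); [apply: regXY|apply: regYX].
have : bdensity b A W <= bdensity b X Y - eps.
  rewrite bdensity_sum ler_pdivrMr ?mulr_gt0 // natr_sum.
  apply: le_trans (_ : \sum_(x in A) ((bdensity b X Y - eps) * #|W|%:R) <= _).
    by apply: ler_sum => x; rewrite inE => /andP[_ /ltW].
  by rewrite sum_constR -mulrA [_ * #|A|%:R]mulrC.
by move: reg; rewrite ltr_norml => /andP[]; lra.
Qed.

End RegularPairs.

Lemma sigma_ore_le (R : realType) (T : finType) (D : rel T) (s : R) x y :
    (s%:E <= sigma_ore R D)%E -> x != y -> ~~ D x y -> ~~ D y x ->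
  s <= (maxdeg D x)%:R + (maxdeg D y)%:R.
Proof.
move=> le_s ne_xy Nxy Nyx; rewrite -lee_fin.
rewrite (le_trans le_s) // -natrD /sigma_ore.
rewrite (bigD1 (x, y)) /= ?ne_xy ?Nxy // ge_min lexx //.
Qed.

(** * Consequences of the Ore condition for the reduced graph *)

Section ReducedGraph.
Variables (R : realType) (T : finType) (D : rel T) (mu eps d : R).
Variables (M0 M k m : nat) (V0 : {set T}) (V : 'I_k -> {set T}) (D' : rel T).
Hypothesis orD : oriented_graph D.
Hypothesis RP : regularity_partition D eps d M0 M m V0 V D'.
Local Notation n := (#|T|%:R).
Hypothesis ore : (((3 / 4 + mu) * n)%:E <= sigma_ore R D)%E.
Local Notation kap := (d + 2 * eps).
Hypothesis mu_gt0 : 0 < mu.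
Hypothesis mu_le : mu <= 1 / 100.
Hypothesis eps_gt0 : 0 < eps.
Hypothesis eps_le : eps <= mu / 1000.
Hypothesis d_gt0 : 0 < d.
Hypothesis kap_le : kap <= mu / 1000.
Hypothesis n_large : 1000 <= mu * n.

Let n_gt0 : 0 < n :> R.
Proof. by rewrite -(pmulr_rgt0 _ mu_gt0); apply: lt_le_trans n_large. Qed.

Let D'D b x y : darc D' b x y -> darc D b x y.
Proof. by case: b; apply: (rp_sub RP). Qed.

(** This is [d^*] measured in [D'], but in the direction that attains the maximum in [D]; the
    direction is thus constant on each cluster. *)
Definition stardeg v : nat := #|nbrs D' (v \in Pplus D) v setT|.

Lemma deg_loss b v : v \notin V0 ->
  #|nbrs D b v setT|%:R - kap * n <= #|nbrs D' b v setT|%:R.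
Proof. by case: b; [apply: (rp_outdeg RP)|apply: (rp_indeg RP)]. Qed.

Lemma maxdeg_stardeg v : v \notin V0 -> (maxdeg D v)%:R <= (stardeg v)%:R + kap * n.
Proof.
move=> vNV0; have -> : maxdeg D v = #|nbrs D (v \in Pplus D) v setT|.
  by rewrite /maxdeg inE; case: (leqP (indeg D v) (outdeg D v)).
by have := deg_loss (v \in Pplus D) vNV0; rewrite /stardeg; lra.
Qed.

Lemma lost_nbrs b v (Z : {set T}) : v \notin V0 ->
    {in Z, forall z, ~~ darc D' b v z} -> #|nbrs D b v Z|%:R <= kap * n.
Proof.
move=> vNV0 noZ.
have le1 : (#|nbrs D' b v setT| + #|nbrs D b v Z| <= #|nbrs D b v setT|)%N.
  rewrite -cardU_disjoint; last first.
    apply: disjoint_of_pointwise => z; rewrite !inE /=.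
    apply/implyP => a'; rewrite negb_and; apply/orP; left.
    by apply: contraTN a' => /noZ.
  apply: subset_leq_card; apply/subsetP => z; rewrite !inE /=.
  by case/orP => [/D'D|/andP[]].
have := deg_loss b vNV0; move: le1; rewrite -(ler_nat R) natrD.
lra.
Qed.

Lemma stardeg_sum (Y : {set T}) :
    (forall x y, x \in Y -> D' x y || D' y x -> y \in Y) ->
  \sum_(v in Y) (stardeg v)%:R <= 3 / 4 * #|Y|%:R ^+ 2 :> R.
Proof.
move=> closedY.
have := @star_degree_sum R T Y (Pplus D) (fun x y => (D' x y)%:R) 1.
rewrite mulr1; move=> H; apply: le_trans (H _ _ _) => //.
- apply: ler_sum => v vY; rewrite /stardeg card_nbrs.
  have E b : (\sum_(y in [set: T]) darc D' b v y = \sum_(y in Y) darc D' b v y)%N.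
    rewrite (bigID (fun y => y \in Y)) /= [X in (_ + X)%N]big1 ?addn0.
      by apply: eq_bigl => y; rewrite inE.
    move=> y /andP[_ yNY]; apply/eqP; rewrite eqb0; apply: contra yNY => a.
    by apply: (closedY v) => //; move: a; rewrite /darc; case: b => ->; rewrite ?orbT.
  by rewrite E natr_sum; case: ifP => _; apply: ler_sum.
- move=> x y; have [_ asymD] := orD; have := asymD x y.
  have := @rp_sub _ _ _ _ _ _ _ _ _ _ _ _ RP x y.
  have := @rp_sub _ _ _ _ _ _ _ _ _ _ _ _ RP y x.
  case: (D' x y); case: (D' y x) => H1 H2 //=; rewrite ?addr0 ?add0r ?ler01 //.
  by rewrite (H1 isT) (H2 isT).
Qed.

(** Take [y] in [Y] of at most average star degree, that is [3/4 * #|Y|]. Almost all [x] in [X] are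
    non-adjacent to [y] in [D], so by the Ore condition their star degrees exceed [3/4 * #|X|] by
    nearly [mu * n], too much for the average over [X]. Taking [X] as the larger part makes the
    exceptional neighbours of [y] a small proportion of it. *)
Lemma no_split (X Y : {set T}) : [disjoint X & Y] -> V0 :|: (X :|: Y) = setT ->
    [disjoint V0 & X :|: Y] -> Y != set0 -> (#|Y| <= #|X|)%N ->
  (forall x y, x \in X -> y \in Y -> ~~ D' x y && ~~ D' y x) -> False.
Proof.
move=> dXY covXY dV0 Y_n0 leYX noXY.
have inXY x : x \notin V0 -> (x \in X) || (x \in Y).
  by move=> xN; have := in_setT x; rewrite -covXY !inE (negPf xN).
have notV0 x : x \in X :|: Y -> x \notin V0.
  by move=> xXY; rewrite (disjointFl dV0 xXY).
have iso x y : D' x y || D' y x -> y \notin V0.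
  move=> a; apply: contraTN a => yV0.
  by have [/negPf-> /negPf->] := rp_isolated RP x yV0.
have closedX x y : x \in X -> D' x y || D' y x -> y \in X.
  move=> xX a; have /orP[//|yY] := inXY y (iso _ _ a).
  by have := noXY x y xX yY; rewrite -negb_or a.
have closedY x y : x \in Y -> D' x y || D' y x -> y \in Y.
  move=> xY a; have /orP[yX|//] := inXY y (iso _ _ a).
  by have := noXY y x yX xY; rewrite -negb_or orbC a.
have sumX := stardeg_sum closedX; have sumY := stardeg_sum closedY.
have Y_gt0 : 0 < #|Y|%:R :> R by rewrite ltr0n card_gt0.
have [y yY dy] : exists2 y, y \in Y & (stardeg y)%:R <= 3 / 4 * #|Y|%:R :> R.
  apply/exists_inP; rewrite -[X in is_true X]negbK negb_exists_in.
  apply/negP => /forall_inP big_y; move: sumY; apply/negP; rewrite -ltNge.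
  rewrite expr2 mulrA -sum_constR.
  apply: ltr_sum; last by move=> v vY; rewrite ltNge big_y.
  by have [v vY] := set0Pn _ Y_n0; apply/hasP; exists v; rewrite ?mem_index_enum.
have yNV0 : y \notin V0 by apply: notV0; rewrite inE yY orbT.
have lost b : #|nbrs D b y X|%:R <= kap * n.
  apply: lost_nbrs => // x xX; have := noXY x y xX yY.
  by rewrite /darc; case: b => /andP[].
pose N := X :\: (nbrs D true y X :|: nbrs D false y X).
have cN : #|X|%:R - 2 * kap * n <= #|N|%:R.
  have : (#|X| <= #|N| + (#|nbrs D true y X| + #|nbrs D false y X|))%N.
    rewrite -(cardsID (nbrs D true y X :|: nbrs D false y X) X) addnC leq_add2l.
    by rewrite (leq_trans _ (leq_cardU _ _)) // subset_leq_card ?subsetIr.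
  rewrite -(ler_nat R) !natrD; have := lost true; have := lost false.
  lra.
have degN x : x \in N -> (3 / 4 + mu - 2 * kap) * n - 3 / 4 * #|Y|%:R <= (stardeg x)%:R.
  rewrite !inE negb_or => /andP[/andP[Nyx Nxy] xX].
  have xNV0 : x \notin V0 by apply: notV0; rewrite inE xX.
  have ne_xy : x != y by apply: contraTneq xX => ->; rewrite (disjointFl dXY yY).
  rewrite xX /= in Nyx Nxy.
  have := sigma_ore_le ore ne_xy Nxy Nyx.
  have := maxdeg_stardeg xNV0; have := maxdeg_stardeg yNV0.
  by move: dy; lra.
have sumN : #|N|%:R * ((3 / 4 + mu - 2 * kap) * n - 3 / 4 * #|Y|%:R)
    <= 3 / 4 * #|X|%:R ^+ 2.
  rewrite mulrC -sum_constR; apply: le_trans sumX.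
  rewrite [leRHS](bigID (fun x => x \in N)) /=.
  rewrite -[leLHS]addr0 lerD ?sumr_ge0 //.
  rewrite [leRHS](eq_bigl (mem N)); first exact: ler_sum.
  by move=> x /=; rewrite [x \in N]inE; case: (x \in X); rewrite ?andbF ?andbT.
have cT : #|V0|%:R + (#|X|%:R + #|Y|%:R) = n :> R.
  by rewrite -!natrD -(cardU_disjoint dXY) -(cardU_disjoint dV0) covXY cardsT.
have V0_le := rp_V0 RP.
have X_big : n / 3 <= #|X|%:R :> R.
  move: leYX; rewrite -(ler_nat R); have : eps * n <= n / 4.
    by rewrite mulrC ler_pM2l //; move: eps_le mu_le; lra.
  by move: V0_le cT; lra.
have V0_ge0 : 0 <= #|V0|%:R :> R by [].
have kap_gt0 : 0 < kap by move: d_gt0 eps_gt0; lra.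
pose s := (3 / 4 + mu - 2 * kap) * n - 3 / 4 * #|Y|%:R.
pose t := 3 / 4 * #|X|%:R + (mu - 2 * kap) * n.
have le_ts : t <= s by rewrite /s /t; move: cT V0_ge0; lra.
have mukap : 0 < mu - 2 * kap by move: kap_le mu_gt0; lra.
have t_gt0 : 0 < t.
  by rewrite /t ltr_wpDl ?mulr_ge0 ?mulr_gt0 //; lra.
have small : 2 * kap * n <= n / 3.
  by rewrite mulrC ler_pM2l //; move: kap_le mu_le; lra.
have lower : (#|X|%:R - 2 * kap * n) * t <= #|N|%:R * s.
  by rewrite ler_pM ?(ltW t_gt0) // subr_ge0 (le_trans small).
have upper : #|X|%:R * (mu - 2 * kap) * n <= 2 * kap * t * n.
  have := le_trans lower sumN; rewrite mulrBl.
  have -> : #|X|%:R * t = 3 / 4 * #|X|%:R ^+ 2 + #|X|%:R * (mu - 2 * kap) * n.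
    by rewrite /t; ring.
  rewrite [2 * kap * n * t]mulrAC.
  by move: (_ * t * n) (_ * n) (_ ^+ 2) => a b c; lra.
have upper' : #|X|%:R * (mu - 2 * kap) <= 2 * kap * t.
  by rewrite -(ler_pM2r n_gt0).
have t_le : t <= n :> R.
  rewrite /t; have : (mu - 2 * kap) * n <= 1 / 4 * n.
    by rewrite ler_pM2r //; move: mu_le kap_gt0; lra.
  by move: cT Y_gt0 V0_ge0; lra.
have : n / 3 * (mu - 2 * kap) <= 2 * kap * n.
  apply: le_trans (_ : #|X|%:R * (mu - 2 * kap) <= _).
    by rewrite ler_pM2r.
  by rewrite (le_trans upper') // ler_pM2l // mulr_gt0.
rewrite [leRHS]mulrC -mulrA ler_pM2l //.
by move: kap_gt0 kap_le mu_gt0; lra.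
Qed.

Lemma cluster_gt0 : (0 < m)%N.
Proof.
rewrite lt0n; apply/eqP => m0.
have V_0 i : V i = set0 by apply/eqP; rewrite -cards_eq0 (rp_card RP) m0.
have := rp_cover RP; rewrite (eq_bigr (fun=> set0)) => [|i _]; last exact: V_0.
rewrite big1_eq setU0 => V0T; have := rp_V0 RP; rewrite V0T cardsT.
apply/negP; rewrite -ltNge -[ltRHS]mul1r ltr_pM2r //.
by move: eps_le mu_le; lra.
Qed.

Lemma cluster_neq0 i : V i != set0.
Proof. by rewrite -card_gt0 (rp_card RP) cluster_gt0. Qed.

Lemma bdensity_dichotomy b i j : i != j ->
  bdensity R D' b (V i) (V j) = 0 \/ d <= bdensity R D' b (V i) (V j).
Proof.
by move=> ne_ij; case: b; apply: (rp_density RP) => //; rewrite eq_sym.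
Qed.

Lemma bdensity0 b i j x y : bdensity R D' b (V i) (V j) = 0 ->
  x \in V i -> y \in V j -> ~~ darc D' b x y.
Proof.
rewrite bdensity_sum !(rp_card RP) => /eqP; rewrite mulf_eq0 invr_eq0.
rewrite mulf_eq0 !pnatr_eq0 !(gtn_eqF cluster_gt0) !orbF => /eqP sum0 xi yj.
move/eqP: sum0; rewrite sum_nat_eq0 => /forall_inP/(_ x xi).
by rewrite cards_eq0 => /eqP/setP/(_ y); rewrite !inE yj /= => ->.
Qed.

Lemma in_cluster x : x \notin V0 -> exists i, x \in V i.
Proof.
move=> xN; have := in_setT x; rewrite -(rp_cover RP) inE (negPf xN) /=.
by case/bigcupP => i _ xi; exists i.
Qed.

Lemma reduced_connected (S : {set 'I_k}) : S != set0 -> S != setT ->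
  exists i j b, [/\ i \notin S, j \in S & d <= bdensity R D' b (V i) (V j)].
Proof.
move=> S_n0 S_nT.
have [/existsP[i /existsP[j /and3P[iS jS H]]]|noedge] :=
  boolP [exists i, [exists j, [&& i \notin S, j \in S &
     (d <= bdensity R D' true (V i) (V j)) || (d <= bdensity R D' false (V i) (V j))]]].
  by case/orP: H => H; exists i, j; [exists true|exists false].
exfalso.
pose X := \bigcup_(j in S) V j; pose Y := \bigcup_(i in ~: S) V i.
have noarc i j b x y : i \notin S -> j \in S -> x \in V i -> y \in V j ->
    ~~ darc D' b x y.
  move=> iS jS; apply: bdensity0.
  have ne_ij : i != j by apply: contraNneq iS => ->.
  have [//|H] := bdensity_dichotomy b ne_ij.
  case/negP: noedge; apply/existsP; exists i; apply/existsP; exists j.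
  by rewrite iS jS /=; case: b H => ->; rewrite ?orbT.
have dXY : [disjoint X & Y].
  apply: disjoint_of_pointwise => z; apply/implyP => /bigcupP[j jS zj].
  apply/negP => /bigcupP[i]; rewrite inE => iS zi.
  have ne_ij : i != j by apply: contraNneq iS => ->.
  by have := rp_disj RP ne_ij; move/disjointFr/(_ zi); rewrite zj.
have XYE : X :|: Y = \bigcup_i V i.
  rewrite [RHS](bigID (mem S)) /=.
  by congr (_ :|: _); apply: eq_bigl => i; rewrite ?inE.
have cov : V0 :|: (X :|: Y) = setT by rewrite XYE (rp_cover RP).
have dV0 : [disjoint V0 & X :|: Y].
  apply: disjoint_of_pointwise => z; apply/implyP => zV0; apply/negP.
  by rewrite XYE => /bigcupP[i _ zi]; have := disjointFr (rp_disj0 RP i) zV0; rewrite zi.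
have X_n0 : X != set0.
  have [j jS] := set0Pn _ S_n0; have [x xj] := set0Pn _ (cluster_neq0 j).
  by apply/set0Pn; exists x; apply/bigcupP; exists j.
have Y_n0 : Y != set0.
  have [i iS] : exists i, i \in ~: S.
    by apply/set0Pn; rewrite -setCT (inj_eq (@setC_inj _)).
  have [x xi] := set0Pn _ (cluster_neq0 i).
  by apply/set0Pn; exists x; apply/bigcupP; exists i.
have noYX x y : x \in X -> y \in Y -> ~~ D' x y && ~~ D' y x.
  move=> /bigcupP[j jS xj] /bigcupP[i]; rewrite inE => iS yi.
  by rewrite (noarc i j true y x) // (noarc i j false y x).
case/orP: (leq_total #|Y| #|X|) => [leYX|leXY].
  exact: (no_split (X:=X)(Y:=Y)).
apply: (no_split (X:=Y)(Y:=X)) => //.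
- by rewrite disjoint_sym.
- by rewrite [Y :|: X]setUC.
- by rewrite [Y :|: X]setUC.
- by move=> x y xY yX; rewrite andbC noYX.
Qed.

Lemma size_clusters : (k * m)%N%:R <= n :> R /\ n <= (k * m)%N%:R + eps * n.
Proof.
have cU : #|\bigcup_i V i| = (k * m)%N.
  rewrite -sum1_card partition_disjoint_bigcup; last exact: (rp_disj RP).
  under eq_bigr do rewrite sum1_card (rp_card RP).
  by rewrite sum_nat_const card_ord.
split; first by rewrite ler_nat -cU max_card.
apply: le_trans (_ : #|V0|%:R + #|\bigcup_i V i|%:R <= _).
  by rewrite -natrD ler_nat -cardsT -(rp_cover RP) leq_cardU.
by rewrite cU addrC lerD2l (rp_V0 RP).
Qed.

Lemma D'_adjacent_count v (L : {set T}) : v \notin V0 ->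
    {in L, forall u, u != v -> D v u || D u v} ->
  #|L|%:R <= #|nbrs D' true v L|%:R + #|nbrs D' false v L|%:R + 2 * kap * n + 1.
Proof.
move=> vN adjL; pose N b := nbrs D' b v L.
pose P b := nbrs D b v (L :\: N b).
have lostP b : #|P b|%:R <= kap * n.
  apply: (lost_nbrs) => // z; rewrite !inE negb_and => /andP[H zL].
  by move: H; rewrite zL.
have sub : L \subset [set v] :|: (N true :|: N false) :|: (P true :|: P false).
  apply/subsetP => u uL; rewrite !inE uL /=.
  have [//|ne] := eqVneq u v; have := adjL u uL ne; rewrite /darc /=.
  by case/orP => ->; rewrite ?andbT; case: (D' v u); case: (D' u v); rewrite ?orbT.
have := subset_leq_card sub; rewrite -(ler_nat R).
have : #|[set v] :|: (N true :|: N false) :|: (P true :|: P false)|%:R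
    <= 1 + (#|N true|%:R + #|N false|%:R) + (#|P true|%:R + #|P false|%:R) :> R.
  rewrite -[1]/(1%:R) -!natrD ler_nat (leq_trans (leq_cardU _ _)) //.
  rewrite leq_add ?leq_cardU //.
  by rewrite (leq_trans (leq_cardU _ _)) // cards1 leq_add2l leq_cardU.
by have := lostP true; have := lostP false; rewrite /N; lra.
Qed.

Lemma cluster_arcs_sub i j (X Y : {set T}) : i != j ->
    X \subset V i -> Y \subset V j -> eps * m%:R <= #|X|%:R -> eps * m%:R <= #|Y|%:R ->
  (\sum_(x in X) #|nbrs D' true x Y|)%N%:R
    <= (density R D' (V i) (V j) + eps) * (#|X|%:R * #|Y|%:R).
Proof.
move=> ne_ij sX sY cX cY.
have em_gt0 : 0 < eps * m%:R by rewrite mulr_gt0 // ltr0n cluster_gt0.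
have XY_gt0 : 0 < #|X|%:R * #|Y|%:R :> R.
  by rewrite mulr_gt0 // (lt_le_trans em_gt0).
have := @rp_regular _ _ _ _ _ _ _ _ _ _ _ _ RP i j ne_ij X Y sX sY.
rewrite !(rp_card RP) => /(_ cX cY); rewrite ltr_norml => /andP[_ H].
rewrite -ler_pdivrMr // -density_sum; lra.
Qed.

(** Almost all pairs in [L] are still joined in [D'], while regularity allows at most a 3/4
    proportion of joined pairs. Intersections of [L] with clusters below the size that regularity
    controls are dropped, at a total cost of [eps * n]. For the rest [B], the comparison [#|B|^2 <=
    3/4 * #|B|^2 + (2 * kap * n + 1) * #|B|] yields the constants [8 * kap] and 4. *)
Lemma clique_small (L : {set T}) : [disjoint L & V0] ->
    {in L &, forall u v, u != v -> D v u || D u v} ->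
    (forall i j, i != j -> density R D' (V i) (V j) + density R D' (V j) (V i)
                           <= 1 / 2 + mu / 4) ->
  #|L|%:R <= (8 * kap + eps) * n + 4.
Proof.
move=> dL adjL sparse.
pose F i := if eps * m%:R <= #|L :&: V i|%:R then L :&: V i else set0.
pose G i := if eps * m%:R <= #|L :&: V i|%:R then set0 else L :&: V i.
have FL i : F i \subset L :&: V i by rewrite /F; case: ifP; rewrite ?sub0set.
have dF i j : i != j -> [disjoint F i & F j].
  move=> /(rp_disj RP) dV; apply: disjoint_of_pointwise => z; apply/implyP.
  move=> /(subsetP (FL i)); rewrite inE => /andP[_ zi].
  apply/negP => /(subsetP (FL j)); rewrite inE => /andP[_].
  by rewrite (disjointFr dV zi).
pose B := \bigcup_i F i.
have BL : B \subset L.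
  by apply/bigcupsP => i _; apply: subset_trans (FL i) (subsetIl _ _).
have sumB (f : T -> R) : \sum_(x in B) f x = \sum_i \sum_(x in F i) f x.
  exact: partition_disjoint_bigcup.
have cB : #|B|%:R = \sum_i #|F i|%:R :> R.
  rewrite -[LHS]mul1r -sum_constR sumB; apply: eq_bigr => i _.
  by rewrite sum_constR mul1r.
have cL : #|L|%:R <= #|B|%:R + eps * n.
  apply: le_trans (_ : #|B|%:R + \sum_(i < k) #|G i|%:R <= _).
    rewrite -natr_sum -natrD ler_nat.
    apply: leq_trans (_ : #|B :|: \bigcup_i G i| <= _)%N.
      apply: subset_leq_card; apply/subsetP => x xL.
      have [i xi] := in_cluster (negbT (disjointFr dL xL)).
      rewrite inE; apply/orP; have [big|small] := boolP (eps * m%:R <= #|L :&: V i|%:R).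
        by left; apply/bigcupP; exists i; rewrite // /F big inE xL.
      by right; apply/bigcupP; exists i; rewrite // /G (negPf small) inE xL.
    apply: leq_trans (leq_cardU _ _) _; rewrite leq_add2l.
    by elim/big_rec2: _ => [|i c A _ IH]; rewrite ?cards0 // (leq_trans (leq_cardU _ _)) // leq_add2l.
  rewrite lerD2l; apply: le_trans (_ : \sum_(i < k) eps * m%:R <= _).
    apply: ler_sum => i _; rewrite /G; case: ifP => [_|/negbT].
      by rewrite cards0 mulr_ge0 // ltW.
    by rewrite -ltNge => /ltW.
  rewrite sumr_const card_ord -[_ *+ k]mulr_natr -mulrA ler_pM2l // -natrM mulnC.
  by have [] := size_clusters.
have arcs_le b : \sum_(x in B) #|nbrs D' b x B|%:R
    = \sum_i \sum_j (\sum_(x in F i) #|nbrs D' b x (F j)|)%N%:R :> R.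
  rewrite sumB; apply: eq_bigr => i _.
  under [RHS]eq_bigr do rewrite natr_sum.
  rewrite exchange_big; apply: eq_bigr => x _ /=.
  rewrite card_nbrs natr_sum sumB; apply: eq_bigr => j _.
  by rewrite card_nbrs natr_sum.
have upper : \sum_(x in B) #|nbrs D' true x B|%:R + \sum_(x in B) #|nbrs D' false x B|%:R
    <= 3 / 4 * #|B|%:R ^+ 2 :> R.
  rewrite !arcs_le -big_split /= expr2 {2}cB mulr_sumr mulr_sumr.
  apply: ler_sum => i _; rewrite -big_split /= cB mulr_suml mulr_sumr.
  apply: ler_sum => j _.
  have [Fi0|Fi_n0] := eqVneq (F i) set0.
    by rewrite Fi0 !big_set0 !cards0 addr0 !mulr0.
  have [Fj0|Fj_n0] := eqVneq (F j) set0.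
    rewrite Fj0 !big1 ?cards0 ?addr0 ?mul0r ?mulr0 // => x _;
      by apply/eqP; rewrite cards_eq0 -subset0 nbrs_sub.
  have bigF h : F h != set0 -> eps * m%:R <= #|F h|%:R.
    by rewrite /F; case: ifP; rewrite ?eqxx.
  have FV h : F h \subset V h by apply: subset_trans (FL h) (subsetIr _ _).
  have [Eij|ne_ij] := eqVneq i j.
    have no b x : x \in F i -> #|nbrs D' b x (F j)| = 0%N.
      move=> xF; apply/eqP; rewrite cards_eq0; apply/eqP/setP => y.
      rewrite !inE; apply/negP => /andP[yF].
      have xi := subsetP (FV i) x xF; have := subsetP (FV j) y yF.
      rewrite -Eij => yi; apply/negP; rewrite /darc; case: b.
        exact: (rp_inner RP xi yi).
      exact: (rp_inner RP yi xi).
    rewrite !big1 ?addr0; last 2 first.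
    - by move=> x /no.
    - by move=> x /no.
    by rewrite !mulr_ge0 ?invr_ge0.
  rewrite (nbrs_exchange D' false) /=.
  have ne_ji : j != i by rewrite eq_sym.
  have := cluster_arcs_sub ne_ij (FV i) (FV j) (bigF i Fi_n0) (bigF j Fj_n0).
  have := cluster_arcs_sub ne_ji (FV j) (FV i) (bigF j Fj_n0) (bigF i Fi_n0).
  have := sparse i j ne_ij; rewrite [#|F j|%:R * _]mulrC.
  have : 0 <= #|F i|%:R * #|F j|%:R :> R by rewrite mulr_ge0.
  move: (#|F i|%:R * #|F j|%:R) (density _ _ (V i) _) (density _ _ (V j) _).
  move: (_%N%:R : R) (_%N%:R : R) => s1 s2 z p q z0 Hpq H1 H2.
  have : (p + q + 2 * eps) * z <= 3 / 4 * z.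
    by rewrite ler_wpM2r //; move: eps_le mu_le; lra.
  by move: H1 H2; rewrite !mulrDl; lra.
have lower : \sum_(x in B) #|B|%:R <=
   \sum_(x in B) (#|nbrs D' true x B|%:R + #|nbrs D' false x B|%:R + (2 * kap * n + 1)) :> R.
  apply: ler_sum => x xB; rewrite addrA; apply: D'_adjacent_count.
    by rewrite (disjointFr dL) // (subsetP BL).
  by move=> u uB ne; apply: adjL => //; apply: (subsetP BL).
rewrite !big_split /= !sum_constR in lower.
have [B0|B_n0] := eqVneq B set0.
  rewrite B0 cards0 add0r in cL; apply: le_trans cL _.
  have kap_ge0 : 0 <= kap by move: d_gt0 eps_gt0; lra.
  have : 0 <= 8 * kap * n by rewrite !mulr_ge0.
  by rewrite mulrDl; lra.
have B_gt0 : 0 < #|B|%:R :> R by rewrite ltr0n card_gt0.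
have : #|B|%:R <= 8 * kap * n + 4.
  rewrite -(ler_pM2r B_gt0); move: upper lower; rewrite expr2 mulrDl.
  by move: (\sum_(_ in _) _) (\sum_(_ in _) _) => s1 s2; lra.
by move: cL; rewrite mulrDl; lra.
Qed.

(** By the Ore condition the vertices with [d^*] below [(3/8 + mu/2) n] are pairwise adjacent.
    Without a dense pair they are few, so the average star degree is almost that large; but
    [star_degree_sum] on the clusters bounds it by [3/4 * (1/2 + mu/4) n = (3/8 + 3 mu/16) n]. *)
Lemma dense_pair : exists i j, i != j /\
  1 / 2 + mu / 4 <= density R D' (V i) (V j) + density R D' (V j) (V i).
Proof.
have [/existsP[i /existsP[j /andP[ne H]]]|nodense] :=
  boolP [exists i, [exists j, (i != j) &&
    (1 / 2 + mu / 4 <= density R D' (V i) (V j) + density R D' (V j) (V i))]].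
  by exists i, j.
exfalso.
have sparse i j : i != j -> density R D' (V i) (V j) + density R D' (V j) (V i)
                             <= 1 / 2 + mu / 4.
  move=> ne; rewrite leNgt; apply/negP => /ltW H; case/negP: nodense.
  by apply/existsP; exists i; apply/existsP; exists j; rewrite ne.
pose L := [set v | (v \notin V0) && ((maxdeg D v)%:R < (3 / 8 + mu / 2) * n :> R)].
have dL : [disjoint L & V0].
  apply: disjoint_of_pointwise => v; rewrite inE.
  by apply/implyP => /andP[].
have cliqueL : {in L &, forall u v, u != v -> D v u || D u v}.
  move=> u v; rewrite !inE => /andP[_ ltu] /andP[_ ltv] ne.
  apply: contraT; rewrite negb_or => /andP[Nvu Nuv].
  by have := sigma_ore_le ore ne Nuv Nvu; lra.
have cL := clique_small dL cliqueL sparse.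
pose e i j : R := (\sum_(x in V i) #|nbrs D' true x (V j)|)%N%:R.
have m2_gt0 : 0 < m%:R * m%:R :> R by rewrite -natrM ltr0n muln_gt0 cluster_gt0.
have eE i j : e i j = density R D' (V i) (V j) * (m%:R * m%:R).
  by rewrite density_sum !(rp_card RP) divfK // gt_eqF.
pose Pl := [set i | V i \subset Pplus D].
have signV i v : v \in V i -> (v \in Pplus D) = (i \in Pl).
  move=> vi; rewrite [i \in Pl]inE; case: (rp_sign RP i) => sV.
    by rewrite sV (subsetP sV).
  have vN : v \notin Pplus D by have := subsetP sV v vi; rewrite inE.
  by rewrite (negPf vN); apply/esym/negP => /subsetP/(_ v vi); apply/negP.
have disjV : forall i j, i != j -> [disjoint V i & V j] := rp_disj RP.
have nbrsV b v : (#|nbrs D' b v setT|%:R : R) = \sum_j (#|nbrs D' b v (V j)|)%:R.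
  rewrite -natr_sum; congr (_%:R).
  under eq_bigr do rewrite card_nbrs.
  rewrite -(partition_disjoint_bigcup addn (fun y => nat_of_bool (darc D' b v y)) disjV).
  rewrite card_nbrs [LHS](bigID (mem (\bigcup_i V i))) /=.
  rewrite [X in (_ + X)%N]big1 ?addn0.
    by apply: eq_bigl => y; rewrite in_setT.
  move=> y /andP[_ yN]; apply/eqP; rewrite eqb0.
  have yV0 : y \in V0 by have := in_setT y; rewrite -(rp_cover RP) inE (negPf yN) orbF.
  by have [H1 H2] := rp_isolated RP v yV0; rewrite /darc; case: b.
have stardegE i : \sum_(v in V i) (stardeg v)%:R =
    (if i \in Pl then \sum_(j in setT) e i j else \sum_(j in setT) e j i) :> R.
  transitivity (\sum_(v in V i) \sum_j #|nbrs D' (i \in Pl) v (V j)|%:R : R).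
    by apply: eq_bigr => v vi; rewrite /stardeg nbrsV (signV i v vi).
  rewrite exchange_big /=; case: (i \in Pl) => /=.
    by apply: eq_big => [j|j _]; rewrite ?in_setT // /e natr_sum.
  apply: eq_big => [j|j _]; rewrite ?in_setT // /e (nbrs_exchange D' true).
  by rewrite natr_sum.
have sum_star : \sum_i \sum_(v in V i) (stardeg v)%:R
    <= 3 / 4 * ((1 / 2 + mu / 4) * (m%:R * m%:R)) * k%:R ^+ 2 :> R.
  rewrite (eq_bigr _ (fun i _ => stardegE i)).
  have := @star_degree_sum R 'I_k setT Pl e ((1 / 2 + mu / 4) * (m%:R * m%:R)).
  rewrite cardsT card_ord => H.
  rewrite (eq_bigl (mem [set: 'I_k])) => [|i]; last by rewrite /= in_setT.
  apply: H => [|i j|i j].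
  - by rewrite mulr_ge0 // ltW //; move: mu_gt0; lra.
  - by [].
  - have [<-|ne] := eqVneq i j; last first.
      by rewrite !eE -mulrDl ler_pM2r // sparse.
    have -> : e i i = 0.
      rewrite /e big1 // => x xi; apply/eqP; rewrite cards_eq0; apply/eqP/setP => y.
      by rewrite !inE; apply/negP => /andP[yi]; apply/negP; apply: (rp_inner RP xi yi).
    by rewrite addr0 mulr_ge0 ?(ltW m2_gt0) //; move: mu_gt0; lra.
have lower : (n - eps * n - #|L|%:R) * ((3 / 8 + mu / 2) * n)
    <= \sum_i \sum_(v in V i) ((stardeg v)%:R + kap * n) :> R.
  rewrite -(partition_disjoint_bigcup +%R (fun v => (stardeg v)%:R + kap * n) disjV).
  have VN0 v : v \in \bigcup_i V i -> v \notin V0.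
    by case/bigcupP => i _ vi; rewrite (disjointFl (rp_disj0 RP i) vi).
  have kap_ge0 : 0 <= kap * n by rewrite mulr_ge0 //; move: d_gt0 eps_gt0; lra.
  apply: le_trans (_ : \sum_(v in (\bigcup_i V i) :\: L) ((3 / 8 + mu / 2) * n) <= _).
    rewrite sum_constR mulrC; apply: ler_wpM2l.
      by rewrite mulr_ge0 //; move: mu_gt0; lra.
    rewrite lerBlDr -natrD.
    have cU : (#|\bigcup_i V i| <= #|(\bigcup_i V i) :\: L| + #|L|)%N.
      by rewrite -(cardsID L (\bigcup_i V i)) addnC leq_add2l subset_leq_card ?subsetIr.
    rewrite -(ler_nat R) in cU; apply: le_trans cU.
    rewrite lerBlDr; apply: le_trans (_ : (#|V0| + #|\bigcup_i V i|)%N%:R <= _).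
      by rewrite ler_nat -cardsT -(rp_cover RP) leq_cardU.
    by rewrite natrD addrC lerD2l (rp_V0 RP).
  rewrite [leRHS](big_setID L) /= -[leLHS]add0r lerD ?sumr_ge0 //.
    by move=> v _; rewrite addr_ge0.
  apply: ler_sum => v; rewrite inE => /andP[vL vV].
  apply: le_trans (maxdeg_stardeg (VN0 v vV)).
  by move: vL; rewrite inE (VN0 v vV) /= -leNgt.
move: lower; under eq_bigr do rewrite big_split /= sum_constR (rp_card RP).
rewrite big_split /= sumr_const card_ord -[_ *+ k]mulr_natr.
have [km_le n_le] := size_clusters; rewrite natrM in km_le.
have h0_gt0 : 0 < 1 / 2 + mu / 4 by move: mu_gt0; lra.
have s1 : \sum_i \sum_(v in V i) (stardeg v)%:R <= 3 / 4 * (1 / 2 + mu / 4) * n * n :> R.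
  apply: le_trans sum_star _.
  have -> : 3 / 4 * ((1 / 2 + mu / 4) * (m%:R * m%:R)) * k%:R ^+ 2 =
     3 / 4 * (1 / 2 + mu / 4) * ((k%:R * m%:R) * (k%:R * m%:R)) :> R by ring.
  rewrite -[leRHS]mulrA ler_wpM2l ?ler_pM ?mulr_ge0 ?invr_ge0 ?(ltW h0_gt0) //.
have s2 : kap * n * m%:R * k%:R <= kap * n * n.
  rewrite -mulrA [m%:R * _]mulrC ler_wpM2l // mulr_ge0 //.
  by move: d_gt0 eps_gt0; lra.
move: s1 s2; move: (\sum_i _) (_ * k%:R) => S1 S2 s1 s2 lower.
have : (n - eps * n - #|L|%:R) * (3 / 8 + mu / 2) <=
       (3 / 4 * (1 / 2 + mu / 4) + kap) * n :> R.
  by rewrite -(ler_pM2r n_gt0) mulrDl; move: lower; rewrite mulrA; lra.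
have : (1 - 2 * eps - 8 * kap) * n - 4 <= n - eps * n - #|L|%:R by move: cL; lra.
have c_gt0 : 0 < 3 / 8 + mu / 2 by move: mu_gt0; lra.
move=> H1 H2.
have H3 : ((1 - 2 * eps - 8 * kap) * n - 4) * (3 / 8 + mu / 2)
    <= (3 / 4 * (1 / 2 + mu / 4) + kap) * n.
  by apply: le_trans H2; rewrite ler_wpM2r // ltW.
have four : 4 <= mu / 250 * n by move: n_large; lra.
have H4 : (1 - 2 * eps - 8 * kap - mu / 250) * (3 / 8 + mu / 2)
    <= 3 / 4 * (1 / 2 + mu / 4) + kap.
  rewrite -(ler_pM2r n_gt0); apply: le_trans H3; rewrite mulrAC ler_wpM2r ?(ltW c_gt0) //.
  by rewrite mulrBl; lra.
move: H4; apply/negP; rewrite -ltNge.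
have : (1 - mu / 50) * (3 / 8 + mu / 2) <= (1 - 2 * eps - 8 * kap - mu / 250) * (3 / 8 + mu / 2).
  by rewrite ler_wpM2r ?(ltW c_gt0) //; move: eps_le kap_le mu_gt0; lra.
apply: lt_le_trans.
have : mu * mu <= mu * (1 / 100) by rewrite ler_pM2l.
by move: kap_le mu_gt0 mu_le; nra.
Qed.

End ReducedGraph.

(** * Growing the class of switchable vertices *)

Lemma nbrs_subrel (T : finType) (D D' : rel T) b x (W : {set T}) :
  (forall x y, D' x y -> D x y) -> nbrs D' b x W \subset nbrs D b x W.
Proof.
move=> sD; apply/subsetP => y; rewrite !inE => /andP[-> a] /=.
by move: a; rewrite /darc; case: b; apply: sD.
Qed.

(** Source side: [2 * l]; extension to the other side: [l * (2 * l).+2]; merging the two: the value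
    here. *)
Definition core_size (l : nat) : nat := (4 * l * (l * (2 * l).+2).+2)%N.

(** After [t] extensions of the core, [link_size] bounds the switching sets, and [link_cost] below
    is what has been taken off the size of the forbidden sets. *)
Fixpoint link_size (l t : nat) : nat :=
  if t is t'.+1 then (l * (link_size l t').+2)%N else core_size l.

Fixpoint link_cost (l t : nat) : nat :=
  if t is t'.+1 then (link_cost l t' + link_size l t)%N
  else (l * (2 * l).+2 + core_size l)%N.

Lemma link_size_le l t t' : (0 < l)%N -> (t <= t')%N ->
  (link_size l t <= link_size l t')%N.
Proof.
move=> l_gt0; elim: t' => [|t' IH]; first by rewrite leqn0 => /eqP->.
rewrite leq_eqVlt => /orP[/eqP-> //|/IH le_t]; apply: leq_trans le_t _ => /=.
by apply: leq_trans (leq_pmull _ l_gt0); rewrite ltnW.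
Qed.

Lemma link_cost_le l t t' : (t <= t')%N -> (link_cost l t <= link_cost l t')%N.
Proof.
elim: t' => [|t' IH]; first by rewrite leqn0 => /eqP->.
rewrite leq_eqVlt => /orP[/eqP-> //|/IH le_t]; apply: leq_trans le_t _ => /=.
exact: leq_addr.
Qed.

Section Growth.
Variables (R : realType) (T : finType) (D : rel T) (mu eps d : R).
Variables (M0 M k m : nat) (V0 : {set T}) (V : 'I_k -> {set T}) (D' : rel T).
Hypothesis orD : oriented_graph D.
Hypothesis RP : regularity_partition D eps d M0 M m V0 V D'.
Local Notation n := (#|T|%:R).
Hypothesis ore : (((3 / 4 + mu) * n)%:E <= sigma_ore R D)%E.
Local Notation kap := (d + 2 * eps).
Hypothesis mu_gt0 : 0 < mu.
Hypothesis mu_le : mu <= 1 / 100.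
Hypothesis eps_gt0 : 0 < eps.
Hypothesis d_gt0 : 0 < d.
Hypothesis d_le : d <= mu / 2000.
Hypothesis eps_le_d : eps <= d ^+ 4 / 1000.
Hypothesis n_large : 1000 <= mu * n.
Variables (l : nat) (C : rel 'I_l).
Hypothesis l_ge3 : (3 <= l)%N.
Hypothesis orC : cycle_orientation C.
Hypothesis ndC : ~ isomorphic (@directed_cycle l) C.
Variable VD : {set T}.
Local Notation sq := (Num.sqrt eps).
Hypothesis VD_cluster : forall i, #|V i :\: VD|%:R <= 3 * sq * m%:R.
Variables B thr : nat.
Hypothesis le_thr : (l ^ 2 * independence_number D + B + 3 * l <= thr)%N.
Hypothesis thr_lt : thr%:R < d ^+ 2 / 32 * m%:R.

Let l_gt0 : (0 < l)%N. Proof. exact: ltn_trans l_ge3. Qed.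
Let irrD : irreflexive D. Proof. by case: orD. Qed.
Let d_lt1 : d <= 1 / 1000. Proof. by move: d_le mu_le; lra. Qed.
Let d2_le : d ^+ 2 <= d / 1000.
Proof. by rewrite expr2 ler_pM2l //; move: d_lt1; lra. Qed.
Let eps_d2 : eps <= d ^+ 2 / 1000.
Proof.
apply: le_trans eps_le_d _; rewrite ler_pM2r ?invr_gt0 //.
rewrite -[4%N]/(2 + 2)%N exprD -[leRHS]mulr1 ler_pM2l ?exprn_gt0 //.
by move: d2_le d_lt1 d_gt0; lra.
Qed.
Let eps_le : eps <= mu / 1000.
Proof. by move: eps_d2 d2_le d_le d_gt0 mu_gt0; lra. Qed.
Let kap_le : kap <= mu / 1000.
Proof. by move: eps_d2 d2_le d_le d_gt0 mu_gt0; lra. Qed.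
Let sq_le : sq <= d ^+ 2 / 30.
Proof.
have d2_ge0 : 0 <= d ^+ 2 / 30 by rewrite mulr_ge0 ?exprn_ge0 ?invr_ge0 // ltW.
rewrite -(@ler_pXn2r _ 2) ?nnegrE ?sqrtr_ge0 // sqr_sqrtr ?(ltW eps_gt0) //.
apply: le_trans eps_le_d _; rewrite exprMn -exprM exprVn.
by rewrite ler_pM2l ?exprn_gt0 // lef_pV2 ?posrE ?exprn_gt0 // -natrX ler_nat.
Qed.

Local Notation mm := (m%:R).
Let m_gt0 : 0 < mm :> R. Proof. by rewrite ltr0n (cluster_gt0 RP mu_gt0 mu_le eps_le n_large). Qed.

(** The scales [q], [e], [w] and [m] are far apart in this order. Treating them as atoms leaves
    mostly linear estimates. *)
Let q := d ^+ 2 * mm.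
Let e := d * mm.
Let w := mu * mm.
Let q_gt0 : 0 < q. Proof. by rewrite mulr_gt0 ?exprn_gt0. Qed.
Let q_e : q <= e / 1000.
Proof. by rewrite /q /e [leRHS]mulrAC ler_pM2r. Qed.
Let e_w : e <= w / 2000.
Proof. by rewrite /e /w [leRHS]mulrAC ler_pM2r. Qed.
Let w_m : w <= mm / 100.
Proof. by rewrite /w [leLHS]mulrC ler_pM2l //; move: mu_le; lra. Qed.
Let eps_q : eps * mm <= q / 1000.
Proof. by rewrite /q [leRHS]mulrAC ler_pM2r. Qed.
Let sq_q : sq * mm <= q / 30.
Proof. by rewrite /q [leRHS]mulrAC ler_pM2r. Qed.
Let thr_q : thr%:R < q / 32.
Proof. by rewrite /q mulrAC. Qed.

Let V_n0 i : V i != set0.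
Proof. exact: cluster_neq0 RP mu_gt0 mu_le eps_le n_large i. Qed.

Lemma few_atypical b i j (W : {set T}) : i != j -> W \subset V j ->
  eps * mm <= #|W|%:R -> #|atypical D' eps b (V i) (V j) W|%:R <= q / 1000.
Proof.
move=> ne_ij sW bigW; apply: le_trans eps_q; apply: ltW.
rewrite -(rp_card RP i); apply: atypical_small => //.
- exact: (rp_regular RP).
- by apply: (rp_regular RP); rewrite eq_sym.
- by rewrite (rp_card RP).
Qed.

Lemma typical_nbrs b i j (W : {set T}) x (p : R) : x \in V i -> 0 <= p ->
    p <= bdensity R D' b (V i) (V j) - eps ->
    x \notin atypical D' eps b (V i) (V j) W ->
  p * #|W|%:R <= #|nbrs D' b x W|%:R.
Proof.
move=> xi p_ge0 le_p; rewrite inE xi /= -leNgt; apply: le_trans.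
by rewrite ler_wpM2r.
Qed.

Lemma card_setD_ge (A F : {set T}) : #|A|%:R - #|F|%:R <= #|A :\: F|%:R :> R.
Proof.
rewrite lerBlDr -natrD ler_nat -(cardsID F A) addnC leq_add2l.
by rewrite subset_leq_card ?subsetIr.
Qed.

Lemma cluster_in_VD i : mm - q / 10 <= #|V i :&: VD|%:R.
Proof.
have := VD_cluster i; have := cardsID VD (V i); rewrite (rp_card RP).
by move=> /(congr1 (fun x => x%:R : R)); rewrite natrD; move: sq_q; lra.
Qed.

(** Densities being 0 or at least [d], a large total density either lies in a single direction or
    comes with positive density both ways. *)
Lemma source_pair : exists i j, [/\ i != j, d <= density R D' (V i) (V j)
  & 1 / 2 + mu / 4 <= density R D' (V i) (V j) \/ d <= density R D' (V j) (V i)].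
Proof.
have [i [j [ne_ij H]]] :=
  dense_pair RP ore mu_gt0 mu_le eps_gt0 eps_le d_gt0 kap_le n_large.
have ne_ji : j != i by rewrite eq_sym.
have dhalf : d <= 1 / 2 + mu / 4 by move: d_lt1 mu_gt0; lra.
case: (rp_density RP ne_ij) => [E|Hij].
  rewrite E add0r in H; exists j, i; split=> //; [exact: le_trans H|by left].
exists i, j; split=> //; case: (rp_density RP ne_ji) => [E|]; last by right.
by left; rewrite E addr0 in H.
Qed.

Ltac clear_local :=
  clear -R T D mu eps d M0 M k m V0 V D' orD RP ore mu_gt0 mu_le eps_gt0 d_gt0
    d_le eps_le_d n_large l C l_ge3 orC ndC VD VD_cluster B thr le_thr thr_lt
    l_gt0 irrD d_lt1 d2_le eps_d2 eps_le kap_le sq_le m_gt0 q e w q_gt0 q_e e_w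
    w_m eps_q sq_q thr_q V_n0.
Ltac lra_section := clear_local; lra.
Ltac lia_section := clear; lia.

(** [P] and [Q] are the typical vertices of the two clusters inside [VD]. In the last bound,
    [3 * sq] pays for the exceptional tiling and one more [sq] for the atypical vertices. *)
Lemma core_exists c1 c2 : c1 = (l * (2 * l).+2)%N -> c2 = (4 * l * c1.+2)%N ->
    (c1 + c2 <= B)%N ->
  exists (K : {set T}) i, [/\ K \subset VD, linked C D VD (B - (c1 + c2)) c2 K,
    {in K, forall x, robust_star C D B K x} & #|V i :\: K|%:R <= 4 * sq * mm].
Proof.
move=> def_c1 def_c2 le_cB.
have [i [j [ne_ij dij dense]]] := source_pair.
have ne_ji : j != i by rewrite eq_sym.
have sq_ge : eps * mm <= sq * mm.
  rewrite ler_pM2r // -{1}(sqr_sqrtr (ltW eps_gt0)) expr2 -[leRHS]mulr1.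
  rewrite ler_wpM2l ?sqrtr_ge0 //; move: sq_le d2_le d_lt1; lra_section.
pose P1 := V i :&: VD; pose Q1 := V j :&: VD.
have sQ1 : Q1 \subset V j := subsetIl _ _.
have sP1 : P1 \subset V i := subsetIl _ _.
have cP1 := cluster_in_VD i; have cQ1 := cluster_in_VD j.
rewrite -/P1 in cP1; rewrite -/Q1 in cQ1.
have emm : q <= mm / 1000 by move: q_e e_w w_m m_gt0; lra_section.
pose AP := atypical D' eps true (V i) (V j) Q1.
pose AQ := atypical D' eps false (V j) (V i) P1.
have cAP : #|AP|%:R <= q / 1000 by apply: few_atypical => //; move: eps_q emm cP1 cQ1 q_gt0 m_gt0; lra_section.
have cAQ : #|AQ|%:R <= q / 1000 by apply: few_atypical => //; move: eps_q emm cP1 cQ1 q_gt0 m_gt0; lra_section.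
pose P := P1 :\: AP; pose Q := Q1 :\: AQ.
have sPi : P \subset V i := subset_trans (subsetDl _ _) sP1.
have sQj : Q \subset V j := subset_trans (subsetDl _ _) sQ1.
have cP : mm - q / 5 <= #|P|%:R by have := card_setD_ge P1 AP; rewrite -/P; move: cAP cP1 q_gt0; lra_section.
have cQ : mm - q / 5 <= #|Q|%:R by have := card_setD_ge Q1 AQ; rewrite -/Q; move: cAQ cQ1 q_gt0; lra_section.
have dPQ : [disjoint P & Q].
  exact: disjointWl sPi (disjointWr sQj (rp_disj RP ne_ij)).
have sub' b x (W : {set T}) : #|nbrs D' b x W|%:R <= #|nbrs D b x W|%:R :> R.
  by rewrite ler_nat subset_leq_card // nbrs_subrel // => y z; apply: (rp_sub RP).
have p_ge0 : 0 <= density R D' (V i) (V j) - eps.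
  by move: dij eps_d2 d2_le d_gt0; lra_section.
have nbrP x : x \in P ->
   (density R D' (V i) (V j) - eps) * (mm - q / 10) - q / 1000 <= #|nbrs D' true x Q|%:R.
  rewrite inE => /andP[xA xP1]; have xi := subsetP sP1 x xP1.
  have := typical_nbrs (b := true) xi p_ge0 (lexx _) xA.
  have : (density R D' (V i) (V j) - eps) * (mm - q / 10) <=
    (density R D' (V i) (V j) - eps) * #|Q1|%:R by rewrite ler_wpM2l.
  have := card_setD_ge (nbrs D' true x Q1) AQ; rewrite -nbrsD -/Q; move: cAQ q_gt0; lra_section.
have nbrQ y : y \in Q -> e / 2 <= #|nbrs D' false y P|%:R.
  rewrite inE => /andP[yA yQ1]; have yj := subsetP sQ1 y yQ1.
  have := typical_nbrs (b := false) yj p_ge0 (lexx _) yA.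
  have : 9 / 10 * d * (9 / 10 * mm) <= (density R D' (V i) (V j) - eps) * #|P1|%:R.
    have d9 : 0 <= 9 / 10 * d by move: d_gt0; lra_section.
    have m9 : 0 <= 9 / 10 * mm :> R by move: m_gt0; lra_section.
    apply: ler_pM => //; last by move: cP1 emm m_gt0; lra_section.
    by move: dij eps_d2 d2_le d_gt0; lra_section.
  have := card_setD_ge (nbrs D' false y P1) AP; rewrite -nbrsD -/P.
  have -> : 9 / 10 * d * (9 / 10 * mm) = 81 / 100 * e by rewrite /e; field.
  by move: q_e q_gt0 cAP; lra_section.
have nbrPe x : x \in P -> e / 2 <= #|nbrs D' true x Q|%:R.
  move=> /nbrP; apply: le_trans.
  have : 9 / 10 * d * (9 / 10 * mm) <= (density R D' (V i) (V j) - eps) * (mm - q / 10).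
    have d9 : 0 <= 9 / 10 * d by move: d_gt0; lra_section.
    have m9 : 0 <= 9 / 10 * mm :> R by move: m_gt0; lra_section.
    apply: ler_pM => //; last by move: emm m_gt0; lra_section.
    by move: dij eps_d2 d2_le d_gt0; lra_section.
  have -> : 9 / 10 * d * (9 / 10 * mm) = 81 / 100 * e by rewrite /e; field.
  by move: q_e q_gt0; lra_section.
have e2q : q < e / 2 by move: q_e q_gt0; lra_section.
have thr_nat r : q / 32 <= r%:R -> (thr < r)%N.
  by move=> H; rewrite -(ltr_nat R); apply: lt_le_trans H.
have nbrsP : {in P, forall x, (thr < #|nbrs D true x Q|)%N}.
  move=> x xP; apply: thr_nat; apply: le_trans (sub' _ _ _).
  by have := nbrPe x xP; move: e2q q_gt0; lra_section.
have nbrsQ : {in Q, forall y, (thr < #|nbrs D false y P|)%N}.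
  move=> y yQ; apply: thr_nat; apply: le_trans (sub' _ _ _).
  by have := nbrQ y yQ; move: e2q q_gt0; lra_section.
have sPV : P \subset VD := subset_trans (subsetDl _ _) (subsetIr _ _).
have sQV : Q \subset VD := subset_trans (subsetDl _ _) (subsetIr _ _).
have le_B2 : (B + 2 <= thr)%N by apply: leq_trans le_thr; move: l_gt0; lia_section.
have large_common (W : {set T}) x b : W \subset V j -> q * (4 / 10) <= #|W|%:R * d -> x \in P ->
    d <= bdensity R D' b (V i) (V j) ->
    x \notin atypical D' eps b (V i) (V j) W -> q / 4 <= #|nbrs D' b x W|%:R.
  move=> sW bigW xP dW xN; have xi := subsetP sPi x xP.
  have p'_ge0 : 0 <= 9 / 10 * d by move: d_gt0; lra_section.
  have H : 9 / 10 * d <= bdensity R D' b (V i) (V j) - eps.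
    by move: dW eps_d2 d2_le d_gt0; lra_section.
  apply: le_trans (typical_nbrs xi p'_ge0 H xN).
  by move: bigW q_gt0; lra_section.
have e_d : e / 2 * d = q / 2 by rewrite /e /q; field.
have middle x x' (F : {set T}) : x \in P -> x' \in P -> (#|F| <= B + 2)%N ->
  exists2 z, z \in P :\: F & (thr < #|nbrs D true x Q :&: nbrs D true z Q|)%N /\
                             (thr < #|nbrs D true x' Q :&: nbrs D true z Q|)%N.
  move=> xP x'P leF; pose N x := nbrs D' true x Q.
  have sN y : N y \subset V j := subset_trans (nbrs_sub _ _ _ _) sQj.
  have bigN y : y \in P -> e / 2 <= #|N y|%:R := nbrPe y.
  pose A y := atypical D' eps true (V i) (V j) (N y).
  have cA y : y \in P -> #|A y|%:R <= q / 1000.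
    move=> yP; apply: few_atypical => //.
    by have := bigN y yP; move: e2q eps_q q_gt0; lra_section.
  (* [z] is typical towards the out-neighbourhoods of both [x] and [x']. These have size at least
     [e / 2], so [z] meets each in nearly [d * e / 2 = q / 2] vertices. *)
  have [|z zP zN] := @pick_outside _ P (F :|: (A x :|: A x')).
    rewrite -(ltr_nat R); apply: (@le_lt_trans _ _ q).
      apply: le_trans (_ : (#|F| + (#|A x| + #|A x'|))%N%:R <= _).
        rewrite ler_nat (leq_trans (leq_cardU _ _)) // leq_add2l.
        exact: leq_cardU.
      have : #|F|%:R <= thr%:R :> R by rewrite ler_nat (leq_trans leF).
      by rewrite !natrD; have := cA x xP; have := cA x' x'P; move: thr_q q_gt0; lra_section.
    by move: cP emm m_gt0 q_gt0; lra_section.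
  move: zN; rewrite !in_setU !negb_or => /and3P[zF zA zA'].
  have common y : y \in P -> z \notin A y ->
      (thr < #|nbrs D true y Q :&: nbrs D true z Q|)%N.
    move=> yP zAy; apply: thr_nat; apply: le_trans (_ : #|nbrs D' true z (N y)|%:R <= _).
      apply: le_trans (large_common _ _ true (sN y) _ zP dij zAy) => //.
        by move: q_gt0; lra_section.
      have := bigN y yP; rewrite -(ler_pM2r d_gt0) e_d.
      by move: q_gt0; lra_section.
    rewrite ler_nat subset_leq_card //; apply/subsetP => u; rewrite !inE.
    by case/andP => /andP[-> /(rp_sub RP) /= ->] /(rp_sub RP) /= ->.
  by exists z; [apply/setDP|split; apply: common].
have type2 : robust_type C D B 2 P Q.
  have P_thr r : (r <= thr)%N -> (r < #|P|)%N.
    move=> le_r; apply: leq_ltn_trans le_r _; apply: thr_nat.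
    by move: cP emm m_gt0 q_gt0; lra_section.
  case: dense => [dense|dji].
    apply: (type_two_of_dense l_ge3 orC ndC irrD le_thr dPQ).
      apply: P_thr; apply: leq_trans le_thr.
      have : (independence_number D <= l ^ 2 * independence_number D)%N.
        by rewrite leq_pmull // expn_gt0 l_gt0.
      by move: (l ^ 2 * _)%N; lia_section.
    move=> x x' xP x'P; apply: thr_nat.
    apply: le_trans (_ : #|nbrs D' true x Q :&: nbrs D' true x' Q|%:R <= _); last first.
      rewrite ler_nat subset_leq_card // setISS // nbrs_subrel // => y z;
      exact: (rp_sub RP).
    (* Two out-neighbourhoods, each larger than half of a cluster by about [mu * m / 8], must
       overlap. *)
    have cI := cardsUI (nbrs D' true x Q) (nbrs D' true x' Q).
    have cU : (#|nbrs D' true x Q :|: nbrs D' true x' Q| <= m)%N.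
      rewrite -(rp_card RP j) subset_leq_card // subUset.
      by rewrite !(subset_trans (nbrs_sub _ _ _ _) sQj).
    have Hx := nbrP x xP; have Hx' := nbrP x' x'P.
    have : (1 / 2 + mu / 8) * (mm - q / 10) <=
           (density R D' (V i) (V j) - eps) * (mm - q / 10).
      rewrite ler_wpM2r //; first by move: emm m_gt0; lra_section.
      by move: dense eps_le mu_gt0; lra_section.
    have : (1 / 2 + mu / 8) * (mm - q / 10) >= 1 / 2 * mm + w / 8 - q / 10.
      have : 0 <= (1 / 2 - mu / 8) * (q / 10).
        by rewrite mulr_ge0 ?divr_ge0 ?(ltW q_gt0) //; move: mu_le; lra.
      by rewrite /w; lra_section.
    move: cU; rewrite -(ler_nat R); move: cI => /(congr1 (fun x => x%:R : R)).
    rewrite !natrD; move: q_e e_w q_gt0 Hx Hx'.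
    by move: ((density _ _ _ _ - _) * _) => pp; lra_section.
  have Q_thr : (B < #|Q|)%N.
    apply: (@leq_ltn_trans thr); first by move: le_B2; lia_section.
    by apply: thr_nat; move: cQ emm m_gt0 q_gt0; lra_section.
  apply: (type_two_of_digon l_ge3 orC ndC irrD le_thr dPQ) => //.
    by apply: P_thr; move: le_B2; lia_section.
  move=> x xP F leF; pose W := nbrs D true x Q :\: F.
  have sWj : W \subset V j.
    by apply: subset_trans (subsetDl _ _) _; apply: subset_trans (nbrs_sub _ _ _ _) sQj.
  have cF : #|F|%:R <= q / 32.
    by apply: le_trans (ltW thr_q); rewrite ler_nat (leq_trans leF) // (leq_trans _ le_B2) // leq_addr.
  have bigW : e * (45 / 100) <= #|W|%:R.
    have := card_setD_ge (nbrs D true x Q) F; rewrite -/W.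
    have := sub' true x Q; have := nbrPe x xP; move: cF q_e q_gt0; lra_section.
  pose A b := atypical D' eps b (V i) (V j) W.
  have cA b : #|A b|%:R <= q / 1000.
    by apply: few_atypical => //; move: bigW q_e eps_q q_gt0; lra_section.
  (* Arcs run both ways between the clusters here, so almost every [v] is typical towards [W] in
     both directions. *)
  have [|v vP vN] := @pick_outside _ P (F :|: [set x] :|: (A true :|: A false)).
    rewrite -(ltr_nat R); apply: (@le_lt_trans _ _ q); last first.
      by move: cP emm m_gt0 q_gt0; lra_section.
    apply: le_trans (_ : (#|F :|: [set x]| + (#|A true| + #|A false|))%N%:R <= _).
      by rewrite ler_nat (leq_trans (leq_cardU _ _)) // leq_add2l leq_cardU.
    have : #|F :|: [set x]|%:R <= thr%:R :> R.
      rewrite ler_nat (leq_trans (leq_cardU _ _)) // cards1.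
      by move: leF le_B2; lia_section.
    by rewrite !natrD; have := cA true; have := cA false; move: thr_q q_gt0; lra_section.
  move: vN; rewrite !in_setU in_set1 !negb_or.
  move=> /andP[/andP[vF ne_vx] /andP[vA1 vA2]].
  exists v; split=> [|//|b]; first by apply/setDP.
  apply: thr_nat.
  apply: le_trans (sub' _ _ _); apply: le_trans (_ : q / 4 <= _).
    by move: q_gt0; lra_section.
  have bigWd : q * (4 / 10) <= #|W|%:R * d.
    apply: le_trans (_ : e * (45 / 100) * d <= _); last by rewrite ler_pM2r.
    have -> : e * (45 / 100) * d = q * (45 / 100) by rewrite /e /q; field.
    by move: q_gt0; lra_section.
  by apply: large_common => //; case: b.
have cPB : (B < #|P|)%N.
  apply: (@leq_ltn_trans thr); first by move: le_B2; lia_section.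
  by apply: thr_nat; move: cP emm m_gt0 q_gt0; lra_section.
exists (P :|: Q), i; split.
- by rewrite subUset sPV.
- exact: (linked_core l_ge3 orC ndC irrD le_thr sPV sQV dPQ nbrsP nbrsQ middle cPB type2 def_c1 def_c2 le_cB).
- move=> x; rewrite inE => /orP[xP|xQ].
    apply: robust_starS (leqnn _) (subsetUr P Q) _.
    exact (robust_star_of_nbrs l_ge3 orC ndC irrD le_thr (nbrsP x xP)).
  apply: robust_starS (leqnn _) (subsetUl P Q) _.
  exact (robust_star_of_nbrs l_ge3 orC ndC irrD le_thr (nbrsQ x xQ)).
- have : (#|V i :\: (P :|: Q)| <= #|V i :\: VD| + #|AP|)%N.
    apply: leq_trans (leq_cardU _ _); apply: subset_leq_card.
    apply/subsetP => x; rewrite !inE negb_or negb_and => /andP[/andP[H _] xi].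
    by move: H; rewrite xi !negb_and negbK /=; case: (x \in VD); rewrite ?orbF.
  rewrite -(ler_nat R) natrD; have := VD_cluster i.
  have : #|AP|%:R <= sq * mm.
    apply: le_trans sq_ge; apply: ltW; rewrite -(rp_card RP i).
    apply: atypical_small => //.
    + exact: (rp_regular RP).
    + exact: (rp_regular RP).
    + by rewrite (rp_card RP); move: eps_q emm cQ1 q_gt0 m_gt0; lra_section.
  by lra_section.
Qed.

Let sq_lt : 4 * sq * mm <= q / 7.
Proof. by rewrite -mulrA; move: sq_q q_gt0; lra. Qed.

(** Each step follows an edge of the reduced graph leaving [S] and adds the typical vertices of the
    new cluster. Losses in the clusters do not accumulate: a new cluster only needs most of one old
    cluster to be in [K]. Stars are rebuilt from neighbourhoods and keep the full budget [B]; only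
    linking pays. *)
Lemma growth t : (link_cost l t <= B)%N ->
  exists (K : {set T}) (S : {set 'I_k}),
    [/\ K \subset VD, linked C D VD (B - link_cost l t) (link_size l t) K,
        {in K, forall x, robust_star C D B K x},
        (t < #|S|)%N \/ S = setT
      & S != set0 /\ forall j, j \in S -> #|V j :\: K|%:R <= 4 * sq * mm].
Proof.
elim: t => [|t IH] le_cB.
  have [K [i [sKV linkK starK cK]]] := core_exists erefl erefl le_cB.
  exists K, [set i]; split=> //; first by left; rewrite cards1.
  split; first by apply/set0Pn; exists i; rewrite set11.
  by move=> j /set1P->.
have le_cB' : (link_cost l t <= B)%N by apply: leq_trans le_cB; rewrite leq_addr.
have [K [S [sKV linkK starK cS [S_n0 cK]]]] := IH le_cB'.
have [ST|S_nT] := eqVneq S setT.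
  exists K, S; split=> //; last by right.
  apply: linkedW linkK; first by rewrite leq_sub2l ?leq_addr.
  exact: link_size_le.
have [i [j [b [iS jS dij]]]] := reduced_connected orD RP ore mu_gt0 mu_le
  eps_gt0 eps_le d_gt0 kap_le n_large S_n0 S_nT.
have ne_ij : i != j by apply: contraNneq iS => ->.
pose W := V j :&: K; have sWj : W \subset V j := subsetIl _ _.
have cW : 9 / 10 * mm <= #|W|%:R :> R.
  have := cK j jS; have := cardsID K (V j); rewrite (rp_card RP) -/W.
  move=> /(congr1 (fun x => x%:R : R)); rewrite natrD.
  by move: sq_lt q_e e_w w_m m_gt0; lra_section.
pose A := atypical D' eps b (V i) (V j) W.
have sq_ge : eps * mm <= sq * mm.
  rewrite ler_pM2r // -{1}(sqr_sqrtr (ltW eps_gt0)) expr2 -[leRHS]mulr1.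
  by rewrite ler_wpM2l ?sqrtr_ge0 //; move: sq_le d2_le d_lt1; lra_section.
have bigW : eps * mm <= #|W|%:R.
  by move: cW eps_q q_e e_w w_m m_gt0; lra_section.
have cA : #|A|%:R <= sq * mm.
  apply: le_trans sq_ge; apply: ltW; rewrite -(rp_card RP i).
  apply: atypical_small => //.
  - exact: (rp_regular RP).
  - by apply: (rp_regular RP); rewrite eq_sym.
  - by rewrite (rp_card RP).
pose N := (V i :&: VD) :\: A.
have starN x : x \in N -> robust_star C D B K x.
  rewrite in_setD in_setI => /andP[xA /andP[xi _]].
  have nbrs_x : (thr < #|nbrs D b x K|)%N.
    rewrite -(ltr_nat R); apply: lt_le_trans (_ : #|nbrs D' b x W|%:R <= _).
      have d9 : 0 <= 9 / 10 * d by move: d_gt0; lra_section.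
      have H : 9 / 10 * d <= bdensity R D' b (V i) (V j) - eps.
        by move: dij eps_d2 d2_le d_gt0; lra_section.
      apply: lt_le_trans (typical_nbrs xi d9 H xA).
      apply: lt_le_trans (_ : 9 / 10 * d * (9 / 10 * mm) <= _); last first.
        by rewrite ler_wpM2l.
      have -> : 9 / 10 * d * (9 / 10 * mm) = 81 / 100 * e by rewrite /e; field.
      by move: thr_q q_gt0 q_e; lra_section.
    rewrite ler_nat; apply: subset_leq_card; apply: subset_trans (nbrsS _ _ _ (subsetIr (V j) K)).
    by apply: nbrs_subrel => y z; apply: (rp_sub RP).
  exact (robust_star_of_nbrs l_ge3 orC ndC irrD le_thr nbrs_x).
have starKN x : x \in K :|: N -> robust_star C D B K x.
  by rewrite in_setU => /orP[/starK|/starN].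
exists (K :|: N), (i |: S); split.
- by rewrite subUset sKV; apply: subset_trans (subsetDl _ _) (subsetIr _ _).
- apply: (linked_extend l_gt0 sKV linkK).
    by move: le_cB => /=; move: (l * _)%N (link_cost l t); clear; lia.
  by move=> x /starKN; apply: robust_starS (leq_subr _ _) (subxx _).
- move=> x /starKN; apply: robust_starS (leqnn _) (subsetUl _ _).
- case: cS => [lt_t|ST]; last by rewrite ST eqxx in S_nT.
  by left; rewrite cardsU1 iS.
split; first by apply/set0Pn; exists i; rewrite setU11.
move=> h /setU1P[->|hS]; last first.
  apply: le_trans (cK h hS); rewrite ler_nat subset_leq_card //.
  by rewrite setDS // subsetUl.
have : (#|V i :\: (K :|: N)| <= #|V i :\: VD| + #|A|)%N.
  apply: leq_trans (leq_cardU _ _); apply: subset_leq_card.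
  apply/subsetP => x; rewrite in_setD !in_setU negb_or => /andP[/andP[_ xN] xi].
  rewrite in_setD xi andbT orbC; apply: contraR xN; rewrite negb_or negbK.
  by move=> /andP[xA xV]; apply/setDP; rewrite in_setI xi.
rewrite -(ler_nat R) natrD; have := VD_cluster i; move: cA.
by move: (#|_|%:R) (#|_|%:R) (#|_|%:R) => x1 x2 x3; lra_section.
Qed.

(** One extra extension picks up the vertices of [VD] that the growth left out as atypical: each has
    many neighbours in some cluster, and every cluster is by now almost contained in [K]. *)
Lemma linked_everything : (link_cost l k.+1 <= B)%N ->
    {in VD, forall x, exists j b, (d - eps) * mm <= #|nbrs D' b x (V j)|%:R} ->
  linked C D VD (B - link_cost l k.+1) (link_size l k.+1) VD /\
  {in VD, forall x, robust_star C D B VD x}.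
Proof.
move=> le_cB goodVD.
have le_cB' : (link_cost l k <= B)%N by apply: leq_trans le_cB; rewrite leq_addr.
have [K [S [sKV linkK starK cS [S_n0 cK]]]] := growth le_cB'.
(* After [k] steps the first alternative would give more than [k] clusters. *)
have ST : S = setT.
  case: cS => // lt_k; have := max_card (mem S); rewrite card_ord.
  by rewrite leqNgt lt_k.
have starVD x : x \in VD -> robust_star C D B K x.
  move=> /goodVD[j [b bigN]].
  have nbrs_x : (thr < #|nbrs D b x K|)%N.
    rewrite -(ltr_nat R).
    apply: lt_le_trans (_ : #|nbrs D' b x (V j) :\: (V j :\: K)|%:R <= _).
      apply: lt_le_trans (card_setD_ge _ _).
      have cKj : #|V j :\: K|%:R <= 4 * sq * mm by apply: cK; rewrite ST inE.
      move: bigN cKj sq_lt thr_q q_gt0 q_e eps_q; rewrite mulrBl -/e.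
      by move: (#|_|%:R) (#|_|%:R) => x1 x2; lra_section.
    rewrite ler_nat; apply: subset_leq_card; apply/subsetP => y.
    rewrite !inE => /andP[H /andP[yj a]].
    move: H; rewrite yj andbT negbK => -> /=.
    by move: a; rewrite /darc; case: b {bigN}; apply: (rp_sub RP).
  exact (robust_star_of_nbrs l_ge3 orC ndC irrD le_thr nbrs_x).
split.
  apply: (linked_extend l_gt0 sKV linkK).
    by move: le_cB => /=; move: (l * _)%N (link_cost l k); clear; lia.
  by move=> x /starVD; apply: robust_starS (leq_subr _ _) (subxx _).
by move=> x /starVD; apply: robust_starS (leqnn _) sKV.
Qed.

End Growth.

(** * Neighbourhoods of the vertices outside the exceptional tiling, and the choice of constants *)

Lemma nbrs_of_partner (R : realType) (T : finType) (D : rel T) (eps d : R)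
    (M0 M k m l : nat) (C : rel 'I_l) (V0 : {set T}) (V : 'I_k -> {set T})
    (D' : rel T) (f : 'I_k -> 'I_k) (FE : {set {ffun 'I_l -> T}}) x :
    regularity_partition D eps d M0 M m V0 V D' -> partner_map D d V D' f ->
    exceptional_tiling C D eps m V (bad_set D eps m V0 V D' f) FE ->
    x \in ~: covered FE ->
  exists j b, (d - eps) * m%:R <= #|nbrs D' b x (V j)|%:R.
Proof.
move=> RP pf ET xV.
have xNbad : x \notin bad_set D eps m V0 V D' f.
  by apply: contraTN xV => xbad; rewrite inE negbK (subsetP (et_cover ET)).
move: xNbad; rewrite in_setU negb_or => /andP[xN0 xNbad].
have [i xi] := in_cluster RP xN0.
have xNi : x \notin bad_vertices D eps m V D' f i.
  by apply: contra xNbad => xb; apply/bigcupP; exists i.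
have [_ fplus fminus] := pf i.
have m_ge0 : 0 <= m%:R :> R by [].
move: xNi; rewrite /bad_vertices; case: ifP => sV.
  rewrite inE xi /= -leNgt => le_x; exists (f i), true.
  by apply: le_trans le_x; rewrite ler_wpM2r // lerD2r fplus.
have sV' : V i \subset Pminus D by case: (rp_sign RP i) => //; rewrite sV.
rewrite inE xi /= -leNgt => le_x; exists (f i), false.
by apply: le_trans le_x; rewrite ler_wpM2r // lerD2r fminus.
Qed.

Theorem theorem3p5 (R : realType) :
  exists (phi_eta phi_d : R -> R) (phi_eps : R -> R -> R -> R),
  [/\ forall a, 0 < a -> 0 < phi_eta a,
      forall a, 0 < a -> 0 < phi_d a &
      forall a b c, 0 < a -> 0 < b -> 0 < c -> 0 < phi_eps a b c] /\
  forall (l : nat) (C : rel 'I_l) (mu eta d eps : R) (M : nat),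
  (3 <= l)%N ->
  cycle_orientation C ->
  ~ isomorphic (@directed_cycle l) C ->
  0 < mu -> mu <= 10 ^- 2 ->
  0 < eta -> eta <= phi_eta mu ->
  0 < d -> d <= phi_d (mu ^+ 2) ->
  0 < eps -> eps <= phi_eps (d ^+ 4) (mu ^+ 2) (l%:R^-1) ->
  exists2 xi : R, 0 < xi &
  forall M0 : nat, (3 < M0)%N -> (M0 <= M)%N ->
  exists2 gamma0 : R, 0 < gamma0 &
  forall gamma : R, 0 < gamma -> gamma <= gamma0 ->
  exists n0 : nat,
  forall (T : finType) (D : rel T),
  oriented_graph D ->
  (n0 <= #|T|)%N ->
  (((3 / 4 + mu) * #|T|%:R)%:E <= sigma_ore R D)%E ->
  (independence_number D)%:R <= gamma * #|T|%:R ->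
  forall (k m : nat) (V0 : {set T}) (V : 'I_k -> {set T}) (D' : rel T)
    (f : 'I_k -> 'I_k) (FE : {set {ffun 'I_l -> T}}),
  regularity_partition D eps d M0 M m V0 V D' ->
  partner_map D d V D' f ->
  exceptional_tiling C D eps m V (bad_set D eps m V0 V D' f) FE ->
  let VD1 := ~: covered FE in
  let D1 := induced D VD1 in
  exists A : {set T},
  [/\ A \subset VD1,
      #|A|%:R <= eta * #|T|%:R &
      forall U : {set T}, U \subset VD1 :\: A ->
        #|U|%:R <= xi * #|T|%:R ->
        (l %| #|A :|: U|)%N ->
        has_factor C D1 (A :|: U)].
Proof.
(* With [mu <= 1/100], the bound [d <= mu^2 / 20] gives [d <= mu / 2000]; the bound
   [eps <= d^4 / 1000] makes [sqrt eps] at most [d^2 / 30]. *)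
exists (fun=> 1), (fun x => x / 20), (fun a _ _ => a / 1000); split.
  by split=> [a _|a a_gt0|a b c a_gt0 _ _]; rewrite ?divr_gt0.
move=> l C mu eta d eps M l_ge3 orC ndC mu_gt0 mu_le eta_gt0 _ d_gt0 d_le eps_gt0 eps_le.
have mu_le' : mu <= 1 / 100.
  by apply: le_trans mu_le _; rewrite div1r lef_pV2 ?posrE ?exprn_gt0 // -natrX ler_nat.
have d_le' : d <= mu / 2000.
  apply: le_trans d_le _; have : mu * mu <= mu * (1 / 100) by rewrite ler_pM2l.
  by rewrite expr2; move: (mu * mu) => z; lra.
have l_gt0 : (0 < l)%N by apply: ltn_trans l_ge3.
have lR_gt0 : 0 < l%:R :> R by rewrite ltr0n.
have [->|M_n0] := posnP M.
  by exists 1 => // M0 M0_gt3; rewrite leqNgt (ltn_trans _ M0_gt3).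
have MR_gt0 : 0 < M%:R :> R by rewrite ltr0n.
pose c := link_size l M.+1; pose cost := link_cost l M.+1.
pose w := (2 ^ (2 * l) * (l * c.+2) + 2 * l)%N.
(* [beta * n] is the budget for forbidden sets. As [m >= n / (2M)], four times this is at most
   [d^2 / 32 * m]; three of the four parts go to the independence number, to [B] and to [3 * l] in
   [thr]. *)
pose beta : R := d ^+ 2 / (256 * M%:R).
have beta_gt0 : 0 < beta by rewrite divr_gt0 ?exprn_gt0 ?mulr_gt0.
(* Every vertex of [VD] will have at least [d / 2 * m >= n / kk] neighbours of one direction in
   [VD]. *)
pose kk := (Num.bound (4 * M%:R / d)).+1.
have kk_ge : 4 * M%:R / d <= kk%:R.
  apply: ltW; apply: lt_le_trans (archi_boundP _) _; last by rewrite ler_nat.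
  by rewrite divr_ge0 ?mulr_ge0 ?(ltW d_gt0).
have kk_gt0 : 0 < kk%:R :> R by rewrite ltr0n.
pose mn := Num.min beta eta.
have mn_gt0 : 0 < mn by rewrite lt_min beta_gt0.
have mn_beta : mn <= beta by rewrite ge_min lexx.
have mn_eta : mn <= eta by rewrite ge_min lexx orbT.
(* [theta * n] is the number of hits required of the reservoir. The first term keeps the chain
   within both [eta * n] and the budget; the second is the size condition of [reservoir]. *)
pose theta : R := Num.min (mn / (48 * kk%:R * w.+1%:R)) (1 / (24 * kk%:R ^+ 2)).
have w_gt0 : 0 < w.+1%:R :> R by rewrite ltr0n.
have theta_gt0 : 0 < theta.
  by rewrite lt_min !divr_gt0 ?mulr_gt0 ?exprn_gt0.
have theta1 : theta * (48 * kk%:R * w.+1%:R) <= mn.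
  by rewrite -ler_pdivlMr ?mulr_gt0 // ge_min lexx.
have theta2 : theta * (24 * kk%:R ^+ 2) <= 1.
  by rewrite -ler_pdivlMr ?mulr_gt0 ?exprn_gt0 // ge_min lexx orbT.
(* Covering [U] by stars then uses at most a quarter of the hits; [gamma0] will allot another
   quarter to the independence number. *)
exists (theta / (4 * l%:R)); first by rewrite divr_gt0 ?mulr_gt0.
move=> M0 M0_gt3 le_M0M.
pose gamma0 := Num.min (beta / l%:R ^+ 2) (theta / (4 * l%:R ^+ 2)).
have gamma0_gt0 : 0 < gamma0.
  by rewrite lt_min !divr_gt0 ?mulr_gt0 ?exprn_gt0.
exists gamma0 => // gamma gamma_gt0 le_gamma.
have gamma1 : gamma * l%:R ^+ 2 <= beta.
  by rewrite -ler_pdivlMr ?exprn_gt0 // (le_trans le_gamma) // ge_min lexx.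
have gamma2 : gamma * (4 * l%:R ^+ 2) <= theta.
  rewrite -ler_pdivlMr ?mulr_gt0 ?exprn_gt0 // (le_trans le_gamma) //.
  by rewrite ge_min lexx orbT.
pose t := (Num.bound (1 / theta)).+1.
have t_ge : 1 / theta <= t%:R.
  apply: ltW; apply: lt_le_trans (archi_boundP _) _; last by rewrite ler_nat.
  by rewrite divr_ge0 ?(ltW theta_gt0).
(* The part of the budget spent on linking and on the absorbers; the chain gets [B - slack]. *)
pose slack := (cost + l * c.+2 + l + 1)%N.
(* Each summand secures one of the lower bounds [n1] to [n5] on the order. *)
pose H : R := 1000 / mu + 3 * l%:R / beta + 2 * slack%:R / beta
  + 4 * w.+1%:R / mn + (4 * t.+1)%N%:R / theta.
exists (Num.bound H) => T D orD le_n0 ore indep k m V0 V D' f FE RP pf ET VD D1.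
have irrD : irreflexive D by case: orD.
set n : R := #|T|%:R in ore indep *.
have nn (x y : R) : 0 <= x -> 0 < y -> 0 <= x / y by move=> x0 y0; rewrite divr_ge0 // ltW.
have p1 : 0 <= 1000 / mu by apply: nn.
have p2 : 0 <= 3 * l%:R / beta by apply: nn; rewrite ?mulr_ge0.
have p3 : 0 <= 2 * slack%:R / beta by apply: nn; rewrite ?mulr_ge0.
have p4 : 0 <= 4 * w.+1%:R / mn by apply: nn; rewrite ?mulr_ge0.
have p5 : 0 <= (4 * t.+1)%N%:R / theta by apply: nn.
have H_le : H <= n.
  apply: ltW; apply: lt_le_trans (archi_boundP _) _; last by rewrite ler_nat.
  by rewrite /H; move: p1 p2 p3 p4 p5; clear; lra.
have part (x y : R) : 0 < y -> 0 <= x -> x / y <= H -> x <= y * n.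
  by move=> y_gt0 x_ge0 le_xy; rewrite mulrC -ler_pdivrMr // (le_trans le_xy).
have n1 : 1000 <= mu * n.
  by apply: part => //; rewrite /H; move: p1 p2 p3 p4 p5; clear; lra.
have n2 : 3 * l%:R <= beta * n.
  by apply: part; rewrite ?mulr_ge0 // /H; move: p1 p2 p3 p4 p5; clear; lra.
have n3 : 2 * slack%:R <= beta * n.
  by apply: part; rewrite ?mulr_ge0 // /H; move: p1 p2 p3 p4 p5; clear; lra.
have n4 : 4 * w.+1%:R <= mn * n.
  by apply: part; rewrite ?mulr_ge0 // /H; move: p1 p2 p3 p4 p5; clear; lra.
have n5 : (4 * t.+1)%N%:R <= theta * n.
  by apply: part; rewrite // /H; move: p1 p2 p3 p4 p5; clear; lra.
have n_gt0 : 0 < n.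
  by rewrite -(pmulr_rgt0 _ mu_gt0); apply: lt_le_trans n1.
have bn_ge0 : 0 <= beta * n by rewrite mulr_ge0 ?ltW.
have tn_ge0 : 0 <= theta * n by rewrite mulr_ge0 ?ltW.
pose B := Num.truncn (beta * n); pose N := Num.truncn (theta * n).
have /andP[B_le B_gt] := truncn_itv bn_ge0; have /andP[N_le N_gt] := truncn_itv tn_ge0.
rewrite -/B in B_le B_gt; rewrite -/N in N_le N_gt.
have d_lt1 : d <= 1 by move: d_le' mu_le'; clear; lra.
have d4_le : d ^+ 4 <= d ^+ 2.
  by rewrite -[4%N]/(2 + 2)%N exprD ler_piMl ?exprn_ge0 ?exprn_ile1 ?(ltW d_gt0).
have d2_le : d ^+ 2 <= d by rewrite expr2 ler_piMl ?(ltW d_gt0).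
have eps_d : eps <= d / 1000 by move: eps_le d4_le d2_le; clear; lra.
have eps_mu : eps <= mu / 1000 by move: eps_d d_le' mu_gt0; clear; lra.
have [km_le n_le] := size_clusters RP.
have /andP[_ le_kM] := rp_k RP.
have m_big : n / 2 <= M%:R * m%:R.
  have le1 : (k * m)%N%:R <= M%:R * m%:R :> R by rewrite -natrM ler_nat leq_mul2r le_kM orbT.
  have : eps * n <= n / 2.
    by rewrite mulrC ler_pM2l //; move: eps_mu mu_le'; clear; lra.
  by move: n_le le1; rewrite -/n; clear; lra.
have m_gt0 : 0 < m%:R :> R.
  by rewrite -(pmulr_rgt0 _ MR_gt0); apply: lt_le_trans m_big; rewrite divr_gt0.
have beta_m : 4 * (beta * n) <= d ^+ 2 / 32 * m%:R.
  have -> : d ^+ 2 / 32 * m%:R = d ^+ 2 / (64 * M%:R) * 2 * (M%:R * m%:R).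
    by field; rewrite gt_eqF.
  have -> : 4 * (beta * n) = d ^+ 2 / (64 * M%:R) * 2 * (n / 2).
    by rewrite /beta; field; rewrite gt_eqF.
  by rewrite ler_pM2l // mulr_gt0 // divr_gt0 ?exprn_gt0 ?mulr_gt0.
have cost_le t' : (t' <= M.+1)%N -> (link_cost l t' <= cost)%N := @link_cost_le l t' M.+1.
have slack_B : (slack + slack <= B + 1)%N.
  have : slack%:R + slack%:R <= B%:R + 1 :> R.
    by move: n3 B_gt; rewrite -[B.+1%:R]natr1; clear; lra.
  by rewrite natr1 -(natrD R slack slack) ler_nat addn1.
have cost_slack : (cost + l * c.+2 + l + 1 = slack)%N by [].
have cost_B : (link_cost l k.+1 <= B)%N.
  apply: leq_trans (cost_le _ _) _; first by rewrite ltnS.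
  by move: slack_B cost_slack; move: (l * _)%N => z; clear; lia.
pose thr := (l ^ 2 * independence_number D + B + 3 * l)%N.
have thr_lt : thr%:R < d ^+ 2 / 32 * m%:R.
  apply: lt_le_trans beta_m; rewrite /thr (natrD R (_ + B)) (natrD R _ B).
  rewrite (natrM R (l ^ 2)) natrX (natrM R 3).
  have : l%:R ^+ 2 * (independence_number D)%:R <= beta * n.
    apply: le_trans (_ : l%:R ^+ 2 * (gamma * n) <= _).
      by rewrite ler_pM2l ?exprn_gt0.
    by rewrite mulrA [_ * gamma]mulrC ler_pM2r.
  by move: B_le n2; have := mulr_gt0 beta_gt0 n_gt0; clear; lra.
have VD_cl i : #|V i :\: VD|%:R <= 3 * Num.sqrt eps * m%:R.
  apply: le_trans (et_cluster ET i); rewrite ler_nat subset_leq_card //.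
  by apply/subsetP => x; rewrite !inE negbK.
have goodVD : {in VD, forall x, exists j b, (d - eps) * m%:R <= #|nbrs D' b x (V j)|%:R}.
  by move=> x xV; apply: nbrs_of_partner RP pf ET xV.
have [linkVD starVD] := linked_everything orD RP ore mu_gt0 mu_le' eps_gt0 d_gt0
   d_le' eps_le n1 l_ge3 orC ndC VD_cl (leqnn thr) thr_lt cost_B goodVD.
rewrite -/c in linkVD.
have link_c : linked C D VD (B - cost) c VD.
  apply: linkedW linkVD; first by rewrite leq_sub2l // cost_le // ltnS.
  by apply: link_size_le => //; rewrite ltnS.
have star_c : {in VD, forall x, robust_star C D (B - cost) VD x}.
  by move=> x /starVD; apply: robust_starS (leq_subr _ _) (subxx _).
pose B' := (B - slack)%N.
have leB' : (B' + l * c.+2 + l <= B - cost)%N.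
  by move: slack_B cost_slack; rewrite /B'; move: (l * _)%N => z; clear; lia.
have k_gt0 : (0 < k)%N.
  have /andP[le_M0k _] := rp_k RP; exact: leq_trans (ltn_trans _ M0_gt3) le_M0k.
pose sq := Num.sqrt eps.
have sq_ge0 : 0 <= sq by apply: sqrtr_ge0.
have sq_le : sq <= d / 30.
  rewrite -(@ler_pXn2r _ 2) ?nnegrE ?sqrtr_ge0 ?divr_ge0 ?(ltW d_gt0) //.
  rewrite sqr_sqrtr ?(ltW eps_gt0) // exprMn exprVn.
  apply: le_trans eps_le _; apply: le_trans (_ : d ^+ 2 / 1000 <= _).
    by rewrite ler_pM2r ?invr_gt0.
  by rewrite ler_pM2l ?exprn_gt0 // lef_pV2 ?posrE ?exprn_gt0 // -natrX ler_nat.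
have sqm : 3 * sq * m%:R <= d / 10 * m%:R by rewrite ler_pM2r //; move: sq_le; clear; lra.
have outVD i : #|V i :\: VD|%:R <= d / 10 * m%:R := le_trans (VD_cl i) sqm.
have VD_big : (B' + l * c.+2 + l < #|VD|)%N.
  apply: leq_ltn_trans leB' _; apply: leq_ltn_trans (leq_subr _ _) _.
  pose i := Ordinal k_gt0.
  apply: leq_trans (subset_leq_card (subsetIr (V i) VD)).
  have := cardsID VD (V i); rewrite (rp_card RP) => /(congr1 (fun x => x%:R : R)).
  rewrite natrD -(ltr_nat R); have := outVD i; move: B_le beta_m.
  have : d / 10 * m%:R <= 1 / 10 * m%:R by rewrite ler_pM2r //; move: d_lt1; clear; lra.
  have : d ^+ 2 / 32 * m%:R <= 1 / 32 * m%:R.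
    by rewrite ler_pM2r //; move: d_lt1 d2_le; clear; lra.
  by move: m_gt0; clear; lra.
have bigVD : {in VD, forall x, exists b, #|T| <= kk * #|nbrs D b x VD|}%N.
  move=> x /goodVD[j [b le_x]]; exists b.
  rewrite -(ler_nat R) natrM -/n.
  have le1 : d / 2 * m%:R <= #|nbrs D b x VD|%:R.
    apply: le_trans (_ : #|nbrs D' b x (V j) :\: (V j :\: VD)|%:R <= _).
      apply: le_trans (card_setD_ge _ _ _).
      have : (d - d / 1000) * m%:R <= (d - eps) * m%:R.
        by rewrite ler_pM2r //; move: eps_d; clear; lra.
      have := mulr_gt0 d_gt0 m_gt0.
      by move: le_x (outVD j); rewrite !mulrBl; clear; lra.
    rewrite ler_nat; apply: subset_leq_card; apply/subsetP => y.
    rewrite in_setD in_setD => /andP[yN].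
    rewrite [y \in nbrs D' _ _ _]inE => /andP[yj a].
    rewrite yj andbT negbK in yN; rewrite inE yN /=.
    by move: a; rewrite /darc; case: (b); apply: (rp_sub RP).
  apply: le_trans (_ : 4 * M%:R / d * (d / 2 * m%:R) <= _).
    have -> : 4 * M%:R / d * (d / 2 * m%:R) = 2 * (M%:R * m%:R).
      by field; rewrite gt_eqF.
    by move: m_big; clear; lra.
  apply: ler_pM => //; first by rewrite divr_ge0 ?mulr_ge0 // ltW.
  by rewrite mulr_ge0 // divr_ge0 // ltW.
have le_N : (2 * kk * (12 * kk * N) <= #|T|)%N.
  rewrite -(ler_nat R) -/n; have -> : (2 * kk * (12 * kk * N))%N%:R = N%:R * (24 * kk%:R ^+ 2) :> R.
    by rewrite !natrM; ring.
  apply: le_trans (_ : theta * n * (24 * kk%:R ^+ 2) <= _).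
    by rewrite ler_wpM2r // mulr_ge0 ?exprn_ge0.
  by rewrite mulrAC -[leRHS]mul1r ler_pM2r.
have lt_TN : (#|T| < 2 ^ N)%N.
  have le_4t : (4 * t <= N)%N.
    have : (4 * t.+1 < N.+1)%N by rewrite -(ltr_nat R); apply: le_lt_trans n5 N_gt.
    by clear; lia.
  apply: leq_ltn_trans (linear_lt_exp le_4t); rewrite -(ler_nat R) natrM -/n.
  apply: le_trans (_ : N.+1%:R * (1 / theta) <= _); last by rewrite ler_wpM2l.
  by rewrite mulrA mulr1 ler_pdivlMr // mulrC ltW.
have T_gt0 : (0 < #|T|)%N by rewrite -(ltr_nat R).
have [X [sXV cX hitX]] := reservoir (ltn0Sn _) T_gt0 bigVD le_N lt_TN.
have X_small : (#|X|.+1 * w.+1)%N%:R <= mn * n / 2.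
  apply: le_trans (_ : (12 * kk * N).+1%:R * w.+1%:R <= _).
    by rewrite -natrM ler_nat leq_mul2r ltnS cX orbT.
  rewrite -natr1 mulrDl mul1r.
  have : (12 * kk * N)%N%:R * w.+1%:R <= mn * n / 4.
    have -> : mn * n / 4 = n / 4 * mn by ring.
    apply: le_trans (_ : n / 4 * (theta * (48 * kk%:R * w.+1%:R)) <= _); last first.
      by rewrite ler_pM2l ?divr_gt0.
    have -> : n / 4 * (theta * (48 * kk%:R * w.+1%:R)) = 12 * kk%:R * (theta * n) * w.+1%:R.
      by field.
    by rewrite ler_pM2r // !natrM ler_pM2l ?mulr_gt0.
  by move: n4; clear; lra.
have X_B' : (#|X|.+1 * w.+1 <= B')%N.
  rewrite -ltnS -(ltr_nat R); apply: le_lt_trans X_small _.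
  have : slack%:R + B'%:R = B%:R :> R.
    rewrite -natrD /B' subnKC //; move: slack_B cost_slack.
    by move: (l * _)%N => z; clear; lia.
  have : mn * n <= beta * n by rewrite ler_pM2r.
  by move: n3 B_gt; rewrite -[B.+1%:R]natr1 -[B'.+1%:R]natr1; clear; lra.
pose u := Num.truncn (theta / (4 * l%:R) * n).
have xi_ge0 : 0 <= theta / (4 * l%:R) * n by rewrite mulr_ge0 ?divr_ge0 ?mulr_ge0 ?(ltW theta_gt0) ?(ltW n_gt0).
have lt_h : (l ^ 2 * independence_number D + u * l < N)%N.
  have le1 : (l ^ 2 * independence_number D)%N%:R <= theta * n / 4.
    rewrite natrM natrX; apply: le_trans (_ : l%:R ^+ 2 * (gamma * n) <= _).
      by rewrite ler_pM2l ?exprn_gt0.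
    have -> : l%:R ^+ 2 * (gamma * n) = gamma * (4 * l%:R ^+ 2) * n / 4 by field.
    by rewrite ler_pM2r ?invr_gt0 // ler_pM2r.
  have le2 : (u * l)%N%:R <= theta * n / 4.
    have /andP[u_le _] := truncn_itv xi_ge0.
    rewrite natrM; apply: le_trans (_ : theta / (4 * l%:R) * n * l%:R <= _).
      by rewrite ler_pM2r.
    have -> : theta / (4 * l%:R) * n * l%:R = theta * n / 4.
      by field; rewrite gt_eqF.
    by [].
  have t8 : 8 <= theta * n.
    by apply: le_trans n5; rewrite ler_nat /t; clear; lia.
  rewrite -(ltr_nat R) natrD; move: le1 le2 N_gt t8; rewrite -[N.+1%:R]natr1.
  by clear; lra.
have [A [sAV cA absA]] := absorbing_set l_ge3 orC ndC irrD link_c star_c leB' VD_big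
  sXV X_B' hitX lt_h.
exists A; split=> //.
  apply: le_trans (_ : mn * n / 2 <= _).
    by apply: le_trans X_small; rewrite ler_nat.
  have : mn * n <= eta * n by rewrite ler_pM2r.
  by have := mulr_gt0 eta_gt0 n_gt0; clear; lra.
move=> U sU leU dvdU; apply: has_factor_induced.
  by rewrite subUset sAV; apply: subset_trans sU (subsetDl _ _).
by apply: absA => //; rewrite /u truncn_ge_nat.
Qed.
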